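(* Assume $f\in C^1([0,\infty))$ satisfies (F1)--(F4). Let $\mathcal G$ be a generalized star graph whose essential reduction is isometric to $\mathbb R$. Then $$d_\lambda(\mathcal G)=d_\lambda^\infty\qquad\text{for every }\lambda\in(-mc^2,mc^2).$$
   Context: Constants $m>0$, $c>0$ are fixed. $F(t)=\int_0^t f(s)s\,ds$ for $t\ge0$, and the hypotheses on $f\in C^1([0,\infty))$ are: (F1) $f(0)=0$ and $f(t)\ge0$ for $t\ge0$; (F2) there exist $p>2$, $C>0$ with $f(t)\le C(1+t^{p-2})$ for $t\ge0$; (F3) there exists $\theta>2$ with $0<\theta F(t)\le f(t)t^2$ for $t>0$; (F4) $f$ is nondecreasing on $(0,\infty)$. Graphs. A generalized star graph $\mathcal G$ is a connected noncompact metric graph with finitely many bounded edges, whose union (the compact core) $\mathcal K$ is nonempty, and finitely many half-lines $e_1,\dots,e_M$ with pairwise disjoint interiors, such that $\mathcal G=\mathcal K\cup\bigcup_j e_j$ and $\mathcal K\cap e_j=\{v_j\}$. Loops and multiple edges are allowed. Each edge carries an oriented arclength coordinate. A spinor on $\mathcal G$ is $u=(u_e)_e$ with $u_e=(u_e^1,u_e^2)^T:e\to\mathbb C^2$. The Dirac-Kirchhoff condition at a vertex $v$ is: $u_e^1(v)=u_f^1(v)$ for all edge ends $e,f$ incident at $v$, and $\sum_{e\succ v}\nu_{v,e}u_e^2(v)=0$, the sum being over edge ends incident at $v$ (a loop contributes two), with $\nu_{v,e}=1$ if the coordinate on that edge end is outgoing from $v$ and $\nu_{v,e}=-1$ otherwise.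 At a terminal (degree-one) vertex this reads $u^2(v)=0$. At a degree-two vertex the condition is purely transmissive. The essential reduction of $\mathcal G$ is the metric graph obtained by suppressing every transmissive vertex of degree two and replacing each resulting chain of edges by one edge of the same total length. Variational setting. Let $\sigma_1=\begin{pmatrix}0&1\\1&0\end{pmatrix}$, $\sigma_3=\begin{pmatrix}1&0\\0&-1\end{pmatrix}$. For $X=\mathcal G$ or $X=\mathbb R$, let $\mathcal D_X$ be the self-adjoint operator in $L^2(X,\mathbb C^2)$ acting (edgewise) as $-ic\sigma_1u'+mc^2\sigma_3u$, with domain the edgewise $H^1$ spinors satisfying the Dirac-Kirchhoff condition at every vertex if $X=\mathcal G$, and $H^1(\mathbb R,\mathbb C^2)$ if $X=\mathbb R$. Its spectrum does not meet $(-mc^2,mc^2)$. Put $Y_X=\mathrm{dom}(|\mathcal D_X|^{1/2})$ with norm $\|u\|_{Y_X}=\||\mathcal D_X|^{1/2}u\|_{L^2(X)}$, and $Y_X=Y_X^+\oplus Y_X^-$ the splitting into positive and negative spectral subspaces, $u=u^++u^-$. For $\lambda\in(-mc^2,mc^2)$ let $$J_{\lambda,X}(u)=\tfrac12\big(\|u^+\|_{Y_X}^2-\|u^-\|_{Y_X}^2\big)+\tfrac\lambda2\|u\|_{L^2(X)}^2-\int_XF(|u|)\,dx,$$ a $C^1$ functional on $Y_X$ (viewed as a real Hilbert space), and $$\mathcal N_{\lambda,X}=\{u\in Y_X\setminus Y_X^-: J'_{\lambda,X}(u)[u]=0,\ J'_{\lambda,X}(u)[\eta]=0\ \forall\eta\in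 Y_X^-\}.$$ Then $d_\lambda(\mathcal G)=\inf_{\mathcal N_{\lambda,\mathcal G}}J_{\lambda,\mathcal G}$ and $d_\lambda^\infty=d_{\lambda,\mathbb R}=\inf_{\mathcal N_{\lambda,\mathbb R}}J_{\lambda,\mathbb R}$. *)

(* Defs.v *)
From mathcomp Require Import all_boot all_order all_algebra.
From mathcomp Require Import all_classical all_reals all_analysis.
From mathcomp Require Import complex.

Set Implicit Arguments.
Unset Strict Implicit.
Unset Printing Implicit Defensive.

Import Order.TTheory GRing.Theory Num.Theory.
Import numFieldNormedType.Exports.

Local Open Scope classical_set_scope.
Local Open Scope complex_scope.
Local Open Scope ring_scope.

Section MetricGraph.
Variable R : realType.

(* An edge e is parametrised by arclength on the closed interval with ends
   bound e false < bound e true.  The pair (e, b) is an "edge end"; it sits at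
   the vertex inc e b when bound e b is finite and at no vertex when it is
   infinite.  Bounded edges, half-lines (with either orientation) and lines are
   all covered; a loop has inc e false = inc e true. *)
Record metric_graph := MetricGraph {
  vertex : finType;
  edge : finType;
  bound : edge -> bool -> \bar R;
  inc : edge -> bool -> option vertex;
  bound_lt : forall e, (bound e false < bound e true)%E;
  inc_bound : forall e b, (inc e b == None) = (bound e b \isn't a fin_num) }.

Implicit Type G H : metric_graph.

Definition edge_dom G (e : edge G) : set R :=
  [set x | (bound e false <= x%:E)%E /\ (x%:E <= bound e true)%E].

Definition edge_length G (e : edge G) : \bar R :=
  (bound e true - bound e false)%E.

Definition bounded_edge G (e : edge G) : bool :=
  (inc e false != None) && (inc e true != None).

Definition half_line G (e : edge G) : bool :=
  (inc e false != None) (+) (inc e true != None).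

Definition ends_at G (v : vertex G) : {set edge G * bool} :=
  [set a : edge G * bool | inc a.1 a.2 == Some v].

Definition degree G (v : vertex G) : nat := #|ends_at v|.

Definition end_coord G (a : edge G * bool) : R := fine (bound a.1 a.2).

Definition adjacent G : rel (vertex G) := fun v w =>
  [exists e : edge G, exists b : bool,
    (inc e b == Some v) && (inc e (~~ b) == Some w)].

Definition generalized_star G : Prop :=
  [/\ (forall v w : vertex G, connect (@adjacent G) v w),
      (forall e : edge G, bounded_edge e || half_line e),
      (exists e : edge G, bounded_edge e),
      (exists e : edge G, half_line e) &
      (* a half-line meets the compact core at its vertex *)
      (forall (e : edge G) b v, half_line e -> inc e b = Some v ->
         exists2 e', bounded_edge e' & exists b', inc e' b' = Some v)].

(* An edge end (e, b) is also read as the traversal of e starting from that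
   end; the traversal then finishes at the opposite end. *)
Definition opp_end G (a : edge G * bool) : edge G * bool := (a.1, ~~ a.2).

Definition through_transmissive G : rel (edge G * bool) := fun a a' =>
  if inc (opp_end a).1 (opp_end a).2 is Some v then
    (degree v == 2) && (inc a'.1 a'.2 == Some v)
  else false.

(* H arises from G by suppressing all vertices of degree two.  The vertices of
   H are the remaining ones (through iota); an edge h of H replaces the chain
   of traversals a1 :: chain h, which runs through suppressed vertices only,
   and inherits its extremities and its total length. *)
Definition essential_reduction G H : Prop :=
  exists (iota : vertex H -> vertex G)
         (first : edge H -> edge G * bool)
         (chain : edge H -> seq (edge G * bool)),
  [/\ injective iota,
      (forall v : vertex G, degree v != 2 <-> exists w, iota w = v),
      perm_eq (flatten [seq [seq a.1 | a <- first h :: chain h]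
                          | h <- enum (edge H)]) (enum (edge G)),
      (forall h, path (@through_transmissive G) (first h) (chain h)) &
      forall h,
        let a := first h in
        let z := opp_end (last (first h) (chain h)) in
        [/\ omap iota (inc h false) = inc a.1 a.2,
            omap iota (inc h true) = inc z.1 z.2 &
            edge_length h =
              (\sum_(d <- first h :: chain h) edge_length d.1)%E]].

(* walk p q l: the points p, q (edge, coordinate) are joined by a piecewise
   linear path of length l.  End points of edges at a common vertex are
   identified. *)
Inductive walk G : edge G * R -> edge G * R -> R -> Prop :=
| walk_refl p : walk p p 0
| walk_along e x y q l : edge_dom e x -> edge_dom e y ->
    walk (e, y) q l -> walk (e, x) q (`|x - y| + l)
| walk_glue (a b : edge G * bool) v q l :
    inc a.1 a.2 = Some v -> inc b.1 b.2 = Some v ->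
    walk (b.1, end_coord b) q l -> walk (a.1, end_coord a) q l.

Definition graph_dist G (p q : edge G * R) : \bar R :=
  ereal_inf [set l%:E | l in walk p q].

Definition isometric_to_R G : Prop :=
  exists phi : edge G -> R -> R,
    (forall e x e' x', edge_dom e x -> edge_dom e' x' ->
       graph_dist (e, x) (e', x') = (`|phi e x - phi e' x'|)%:E) /\
    (forall y, exists e x, edge_dom e x /\ phi e x = y).

Lemma line_bound_lt (e : unit) : ((-oo : \bar R) < +oo)%E.
Proof. by []. Qed.

Lemma line_inc_bound (e : unit) (b : bool) :
  ((None : option void) == None)
  = ((if b then +oo else -oo : \bar R)%E \isn't a fin_num).
Proof. by case: b. Qed.

(* The real line: one edge, no vertex. *)
Definition line : metric_graph :=
  @MetricGraph void unit (fun _ b => if b then +oo else -oo)%E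
    (fun _ _ => None) line_bound_lt line_inc_bound.

End MetricGraph.

Section Spinors.
Variables (R : realType) (G : metric_graph R).

Local Notation mu := (@lebesgue_measure R).

(* Only the values on edge_dom e, up to null sets, are relevant.  The two
   components are indexed by 0 and 1. *)
Definition spinor := edge G -> R -> 'cV[R[i]]_2.

Implicit Types u v w : spinor.

Definition Cintegral (A : set R) (g : R -> R[i]) : R[i] :=
  (\int[mu]_(x in A) complex.Re (g x)) +i* (\int[mu]_(x in A) complex.Im (g x)).

Definition C2norm (z : 'cV[R[i]]_2) : R :=
  Num.sqrt (\sum_k ComplexField.Normc.normc (z k 0) ^+ 2).

Definition spinor_aeq u v : Prop :=
  forall e, {ae mu, forall x, edge_dom e x -> u e x = v e x}.

Definition L2normsq u : \bar R :=
  (\sum_(e : edge G) \int[mu]_(x in edge_dom e) (C2norm (u e x) ^+ 2)%:E)%E.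

Definition inL2 u : Prop :=
  (forall e k,
     measurable_fun (edge_dom e) (fun x => complex.Re (u e x k 0)) /\
     measurable_fun (edge_dom e) (fun x => complex.Im (u e x k 0))) /\
  (L2normsq u < +oo)%E.

Definition L2inner u v : R[i] :=
  \sum_(e : edge G)
    Cintegral (edge_dom e) (fun x => \sum_k u e x k 0 * conjc (v e x k 0)).

(* w is the (continuous) representative of an edgewise H^1 spinor and w' its
   weak derivative. *)
Definition H1_derivative w w' : Prop :=
  [/\ inL2 w, inL2 w' &
      forall e x y, edge_dom e x -> edge_dom e y -> x <= y ->
        forall k, w e y k 0 - w e x k 0 = Cintegral `[x, y] (fun s => w' e s k 0)].

Definition end_value w (a : edge G * bool) : 'cV[R[i]]_2 := w a.1 (end_coord a).

(* nu: the coordinate leaves the vertex at a lower end of an edge. *)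
Definition end_sign (a : edge G * bool) : R[i] := if a.2 then -1 else 1.

Definition dirac_kirchhoff w : Prop :=
  forall v : vertex G,
    (forall a b, a \in ends_at v -> b \in ends_at v ->
       end_value w a 0 0 = end_value w b 0 0) /\
    \sum_(a in ends_at v) end_sign a * end_value w a 1 0 = 0.

Definition pauli1 : 'M[R[i]]_2 := \matrix_(j, k) (j != k)%:R.
Definition pauli3 : 'M[R[i]]_2 := \matrix_(j, k) ((-1) ^+ j * (j == k)%:R).

(* The graph of the operator: dirac_op m c u v iff u is in the domain and D u = v.
   On line there is no vertex condition and the domain is H^1(R, C^2). *)
Definition dirac_op (m c : R) u v : Prop :=
  [/\ inL2 u, inL2 v & exists w w',
    [/\ spinor_aeq u w, H1_derivative w w', dirac_kirchhoff w &
        spinor_aeq v (fun e x =>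
          (- ('i * c%:C)) *: (pauli1 *m w' e x)
          + (m * c ^+ 2)%:C *: (pauli3 *m w e x))]].

(* The spectral measure of a self-adjoint operator D, given by its graph:
   spectral_proj A is the spectral projection of the Borel set A, mass u is the measure
   A |-> <spectral_proj A u, u>, and D = int t d(spectral_proj) in the quadratic form sense. *)
Record spectral_measure (D : spinor -> spinor -> Prop) := SpectralMeasure {
  spectral_proj : set R -> spinor -> spinor;
  mass : spinor -> {measure set (measurableTypeR R) -> \bar R};
  proj_L2 : forall A u, measurable A -> inL2 u -> inL2 (spectral_proj A u);
  proj_aeq : forall A u v, measurable A -> inL2 u -> inL2 v ->
    spinor_aeq u v -> spinor_aeq (spectral_proj A u) (spectral_proj A v);
  proj_linear : forall A (a : R[i]) u v, measurable A -> inL2 u -> inL2 v ->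
    spinor_aeq (spectral_proj A (a *: u + v)) (a *: spectral_proj A u + spectral_proj A v);
  proj_sym : forall A u v, measurable A -> inL2 u -> inL2 v ->
    L2inner (spectral_proj A u) v = L2inner u (spectral_proj A v);
  proj_setT : forall u, inL2 u -> spinor_aeq (spectral_proj setT u) u;
  proj_setI : forall A B u, measurable A -> measurable B -> inL2 u ->
    spinor_aeq (spectral_proj (A `&` B) u) (spectral_proj A (spectral_proj B u));
  mass_proj : forall A u, measurable A -> inL2 u ->
    mass u A = L2normsq (spectral_proj A u);
  spectral_dom : forall u, inL2 u ->
    (exists v, D u v) <-> (\int[mass u]_t (t ^+ 2)%:E < +oo)%E;
  spectral_action : forall u v, D u v ->
    L2inner v u = (\int[mass u]_t (t : R))%:C }.

End Spinors.

Section Action.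
Variables (R : realType) (G : metric_graph R).
Variables (D : spinor G -> spinor G -> Prop) (E : spectral_measure D).
Variables (f : R -> R) (lam : R).

Implicit Types u v h : spinor G.

Definition inY u : Prop :=
  inL2 u /\ (\int[mass E u]_t (`|t|)%:E < +oo)%E.

(* || |D|^(1/2) u ||^2 *)
Definition Ynormsq u : R := \int[mass E u]_t `|t : R|.

Definition Ynorm u : R := Num.sqrt (Ynormsq u).

Definition pos_part u : spinor G := spectral_proj E `]0, +oo[ u.
Definition neg_part u : spinor G := spectral_proj E `]-oo, 0[ u.

Definition inYneg u : Prop := inY u /\ spinor_aeq (neg_part u) u.

Definition primF (t : R) : R :=
  \int[@lebesgue_measure R]_(s in `[0, t]) (f s * s).

Definition action_functional u : R :=
  2^-1 * (Ynormsq (pos_part u) - Ynormsq (neg_part u))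
  + lam / 2 * fine (L2normsq u)
  - \sum_(e : edge G)
      \int[@lebesgue_measure R]_(x in edge_dom e) primF (C2norm (u e x)).

(* L = J'(u), the Frechet derivative on Y as a real Hilbert space. *)
Definition frechet_derivative (J : spinor G -> R) u (L : spinor G -> R) : Prop :=
  [/\ (forall (a : R) v w, inY v -> inY w ->
         L (a%:C *: v + w) = a * L v + L w),
      (exists K : R, forall v, inY v -> `|L v| <= K * Ynorm v) &
      (forall eps : R, 0 < eps -> exists2 del : R, 0 < del &
         forall h, inY h -> Ynorm h < del ->
           `|J (u + h) - J u - L h| <= eps * Ynorm h)].

Definition nehari u : Prop :=
  [/\ inY u, ~ inYneg u & exists L, [/\ frechet_derivative action_functional u L,
      L u = 0 & forall eta, inYneg eta -> L eta = 0]].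

End Action.

(* By the spectral theorem the self-adjoint operator dirac_op m c has one and only
   one spectral measure E, up to equality almost everywhere of the projected
   spinors; the quantifier over E merely names it. *)
Definition ground_level (R : realType) (m c : R) (f : R -> R)
    (G : metric_graph R) (lam : R) : \bar R :=
  ereal_inf [set y | exists (E : spectral_measure (@dirac_op R G m c)) u,
                       nehari E f lam u /\ y = (action_functional E f lam u)%:E].

Section Nonlinearity.
Variables (R : realType) (f : R -> R).

(* f is C^1 on [0, +oo[, one-sidedly at 0; its values at negative reals are
   never used. *)
Definition C1_nonneg : Prop :=
  exists f' : R -> R,
    (forall t, 0 <= t ->
       (fun s => (f s - f t) / (s - t)) @ within [set s | 0 <= s] t^' --> f' t) /\
    {within [set t | 0 <= t], continuous f'}.

Definition F1 : Prop := f 0 = 0 /\ forall t, 0 <= t -> 0 <= f t.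

Definition F2 : Prop := exists p C : R,
  [/\ 2 < p, 0 < C & forall t, 0 <= t -> f t <= C * (1 + t `^ (p - 2))].

Definition F3 : Prop := exists2 theta : R, 2 < theta &
  forall t, 0 < t -> 0 < theta * primF f t /\ theta * primF f t <= f t * t ^+ 2.

Definition F4 : Prop := forall s t, 0 < s -> s <= t -> f s <= f t.

End Nonlinearity.

(* Main.v *)
Require Import Defs.
From mathcomp Require Import all_boot all_order all_algebra.
From mathcomp Require Import all_classical all_reals all_analysis.
From mathcomp Require Import measurable_realfun complex ring lra.

(** Through a vertex of degree two the Dirac-Kirchhoff condition only says that
    the spinor, read in a coordinate that runs through the vertex, is continuous.
    A graph that is a chain of edges joined at such vertices is therefore a line
    with marked points.  The change of coordinates is a unitary map between the
    two spaces of square-integrable spinors that intertwines the Dirac operators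
    and preserves the pointwise modulus.  It carries a spectral measure, its
    energy space, the action and the Nehari set to their counterparts on the
    other side, so both ground levels are infima of one set of numbers
    ([ground_level_iso]).

    The chain.  In the real line there are exactly two points at a given small
    distance r from a given point; in a metric graph the points at distance r
    from a vertex correspond to its edge ends.  So an isometry with the line
    forces every vertex of the reduced graph H to have degree two
    ([degree_vertex]).  Reduction preserves degrees and suppresses the vertices
    of degree two ([reduced_degree]), hence H has no vertex
    ([reduced_no_vertex]).  Then H is one edge, infinite at both ends, and G is
    the chain of edges that it replaces ([chain_layout]).

    The unitary map.  The edge e is placed on the line by x |-> x + t or
    x |-> - x + t; in the reflected case the second component of the spinor
    changes sign, which restores the form of the Dirac operator
    ([flip_dirac]).  That [to_graph] respects the domains is a computation on
    each edge; for the inverse map [to_line], the primitives on the pieces have to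
    be glued, and the vertex condition makes this possible ([to_line_closed],
    [glue_primitive]).

    The potential energy.  The action contains a sum over the edges of
    real-valued integrals, in which a divergent integral counts as 0; such a sum is
    additive only where the integrals are finite.  At a Nehari point u the
    action J is differentiable, so J is bounded on a ball around u.
    For w in that ball the spectral truncations E([- n, n]) w lie in the domain
    of the operator; they are bounded spinors, their potential energy is finite,
    and the bound on J controls it uniformly in n.  Fatou's lemma passes the
    bound to w ([frechet_potential_finite]).  This is enough to compare the
    two actions near u, hence their derivatives ([nehari_transport]). *)

Set Implicit Arguments.
Unset Strict Implicit.
Unset Printing Implicit Defensive.

Import Order.TTheory GRing.Theory Num.Theory.
Import numFieldNormedType.Exports.
Local Open Scope classical_set_scope.
Local Open Scope complex_scope.
Local Open Scope ring_scope.

(** * Spinors and their moduli *)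

Section Components.
Variable R : realType.
Implicit Types (a b : R[i]) (z y : 'cV[R[i]]_2).

Lemma normc_sqr a :
  ComplexField.Normc.normc a ^+ 2 = complex.Re a ^+ 2 + complex.Im a ^+ 2.
Proof. by case: a => x y /=; rewrite sqr_sqrtr// addr_ge0 ?sqr_ge0. Qed.

Lemma C2norm_sqr z : C2norm z ^+ 2 =
  \sum_k (complex.Re (z k 0) ^+ 2 + complex.Im (z k 0) ^+ 2).
Proof.
rewrite sqr_sqrtr ?sumr_ge0// => [|k _]; last exact: sqr_ge0.
by apply: eq_bigr => k _; rewrite normc_sqr.
Qed.

Lemma C2norm_ge0 z : 0 <= C2norm z. Proof. exact: sqrtr_ge0. Qed.

Lemma C2norm0 : C2norm (0 : 'cV[R[i]]_2) = 0.
Proof.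
by rewrite /C2norm big1 ?sqrtr0// => k _; rewrite mxE normc_sqr/= expr0n/= addr0.
Qed.

Lemma sqr_ReDIm_add a b :
  complex.Re (a + b) ^+ 2 + complex.Im (a + b) ^+ 2 <=
  2 * (complex.Re a ^+ 2 + complex.Im a ^+ 2)
  + 2 * (complex.Re b ^+ 2 + complex.Im b ^+ 2).
Proof.
case: a b => [p q] [r s] /=.
by have := sqr_ge0 (p - r); have := sqr_ge0 (q - s); nra.
Qed.

Lemma sqr_ReDIm_mul a b :
  complex.Re (a * b) ^+ 2 + complex.Im (a * b) ^+ 2 =
  (complex.Re a ^+ 2 + complex.Im a ^+ 2) * (complex.Re b ^+ 2 + complex.Im b ^+ 2).
Proof. by case: a b => [p q] [r s] /=; ring. Qed.

Lemma C2norm_add_sqr z y :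
  C2norm (z + y) ^+ 2 <= 2 * C2norm z ^+ 2 + 2 * C2norm y ^+ 2.
Proof.
rewrite !C2norm_sqr !mulr_sumr -big_split/=; apply: ler_sum => k _.
by rewrite mxE; exact: sqr_ReDIm_add.
Qed.

Lemma C2norm_scale_sqr a z : C2norm (a *: z) ^+ 2 =
  (complex.Re a ^+ 2 + complex.Im a ^+ 2) * C2norm z ^+ 2.
Proof.
rewrite !C2norm_sqr mulr_sumr; apply: eq_bigr => k _.
by rewrite mxE sqr_ReDIm_mul.
Qed.

Lemma C2norm_entry_le z k :
  complex.Re (z k 0) ^+ 2 <= C2norm z ^+ 2 /\
  complex.Im (z k 0) ^+ 2 <= C2norm z ^+ 2.
Proof.
have h j : 0 <= complex.Re (z j 0) ^+ 2 + complex.Im (z j 0) ^+ 2.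
  by rewrite addr_ge0 ?sqr_ge0.
have hk : complex.Re (z k 0) ^+ 2 + complex.Im (z k 0) ^+ 2 <= C2norm z ^+ 2.
  by rewrite C2norm_sqr (bigD1 k)//= lerDl sumr_ge0.
by split; apply: le_trans hk; rewrite ?lerDl ?lerDr sqr_ge0.
Qed.

End Components.

Section AlmostEverywhere.
Variable R : realType.
Local Notation mu := (@lebesgue_measure R).

Lemma aeS (P Q : R -> Prop) : (forall x, P x -> Q x) ->
  {ae mu, forall x, P x} -> {ae mu, forall x, Q x}.
Proof. by move=> PQ; exact: (@filterS _ _ (ae_filter_ringOfSetsType mu)). Qed.

Lemma aeS2 (P Q S : R -> Prop) : (forall x, P x -> Q x -> S x) ->
  {ae mu, forall x, P x} -> {ae mu, forall x, Q x} -> {ae mu, forall x, S x}.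
Proof. by move=> PQ; exact: (@filterS2 _ _ (ae_filter_ringOfSetsType mu)). Qed.

End AlmostEverywhere.

Section L2.
Variables (R : realType) (G : metric_graph R).
Implicit Types (u v w : spinor G) (e : edge G).
Local Notation mu := (@lebesgue_measure R).

Lemma measurable_edge_dom e : measurable (edge_dom e).
Proof.
rewrite [edge_dom e](_ : _ = EFin @^-1` [set` `[bound e false, bound e true]]).
  rewrite -[X in measurable X]setTI; apply: (@EFin_measurable R setT) => //.
  exact: emeasurable_itv.
by apply/seteqP; split=> x /=; rewrite in_itv/=; [case=> -> ->|case/andP].
Qed.

Definition measurable_spinor u := forall e k,
  measurable_fun (edge_dom e) (fun x => complex.Re (u e x k 0)) /\
  measurable_fun (edge_dom e) (fun x => complex.Im (u e x k 0)).

Lemma inL2_measurable u : inL2 u -> measurable_spinor u.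
Proof. by case. Qed.

Lemma measurable_spinor_lin (a : R[i]) u v :
  measurable_spinor u -> measurable_spinor v -> measurable_spinor (a *: u + v).
Proof.
move=> hu hv e k.
have [mur mui] := hu e k; have [mvr mvi] := hv e k.
split.
  rewrite [X in measurable_fun _ X](_ : _ = fun x => complex.Re a * complex.Re (u e x k 0)
    - complex.Im a * complex.Im (u e x k 0) + complex.Re (v e x k 0)).
    by apply: measurable_funD => //; apply: measurable_funB; exact: measurable_funM.
  apply/funext => x; rewrite !fctE !mxE; case: a => p q.
  by case: (u e x k 0) (v e x k 0) => ? ? [].
rewrite [X in measurable_fun _ X](_ : _ = fun x => complex.Re a * complex.Im (u e x k 0)
  + complex.Im a * complex.Re (u e x k 0) + complex.Im (v e x k 0)).
  by apply: measurable_funD => //; apply: measurable_funD; exact: measurable_funM.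
apply/funext => x; rewrite !fctE !mxE; case: a => p q.
by case: (u e x k 0) (v e x k 0) => ? ? [].
Qed.

Lemma measurable_C2norm u e : measurable_spinor u ->
  measurable_fun (edge_dom e) (fun x => C2norm (u e x)).
Proof.
have ms : measurable_fun setT (@Num.sqrt R : R -> R).
  by apply: nondecreasing_measurable => // a b; exact: ler_wsqrtr.
move=> mu_; rewrite /C2norm; apply: (measurableT_comp ms).
apply: measurable_sum => k.
under eq_fun do rewrite normc_sqr.
by have [mr mi] := mu_ e k; apply: measurable_funD; apply: measurable_funX.
Qed.

(** With g the square this is the squared L^2 norm, with g a primitive of the
    nonlinearity it is the potential energy with values in the extended reals;
    both are transported by the same argument. *)
Definition modulus_integral (g : R -> R) u : \bar R :=
  (\sum_(e : edge G) \int[mu]_(x in edge_dom e) (g (C2norm (u e x)))%:E)%E.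

Lemma L2normsq_modulus u : L2normsq u = modulus_integral (fun t => t ^+ 2) u.
Proof. by []. Qed.

Lemma measurable_modulus (g : R -> R) u e : measurable_fun setT g -> measurable_spinor u ->
  measurable_fun (edge_dom e) (fun x => (g (C2norm (u e x)))%:E).
Proof.
move=> mg u2; apply/measurable_EFinP.
by apply: (measurableT_comp mg); exact: measurable_C2norm.
Qed.

Lemma modulus_integral_aeq (g : R -> R) u v : measurable_fun setT g ->
  (forall t, 0 <= g t) -> measurable_spinor u -> measurable_spinor v ->
  spinor_aeq u v -> forall e,
  (\int[mu]_(x in edge_dom e) (g (C2norm (u e x)))%:E =
   \int[mu]_(x in edge_dom e) (g (C2norm (v e x)))%:E)%E.
Proof.
move=> mg g0 u2 v2 uv e; apply: ge0_ae_eq_integral.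
- exact: measurable_edge_dom.
- exact: (measurable_modulus mg u2).
- exact: (measurable_modulus mg v2).
- by move=> x _; rewrite lee_fin.
- by move=> x _; rewrite lee_fin.
- by apply: (aeS _ (uv e)) => x h ex; rewrite h.
Qed.

Lemma L2normsq_aeq u v : inL2 u -> inL2 v -> spinor_aeq u v ->
  L2normsq u = L2normsq v.
Proof.
move=> u2 v2 uv; apply: eq_bigr => e _.
apply: (@modulus_integral_aeq (fun t => t ^+ 2) u v) => //.
- by move=> t; exact: sqr_ge0.
- exact: inL2_measurable.
- exact: inL2_measurable.
Qed.

Lemma L2normsq_ge0 u : (0 <= L2normsq u)%E.
Proof.
by apply: sume_ge0 => e _; apply: integral_ge0 => x _; rewrite lee_fin sqr_ge0.
Qed.

Lemma L2normsq_fin_num u : inL2 u -> L2normsq u \is a fin_num.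
Proof. by move=> [_ h]; rewrite ge0_fin_numE// L2normsq_ge0. Qed.

Lemma inL2_edge_lty u e : inL2 u ->
  (\int[mu]_(x in edge_dom e) (C2norm (u e x) ^+ 2)%:E < +oo)%E.
Proof.
move=> [_]; apply: le_lt_trans; rewrite /L2normsq (bigD1 e)//= leeDl// sume_ge0//.
by move=> i _; apply: integral_ge0 => x _; rewrite lee_fin sqr_ge0.
Qed.

Lemma spinor_aeq_refl u : spinor_aeq u u.
Proof. by move=> e; apply: aeW. Qed.

Lemma spinor_aeq_sym u v : spinor_aeq u v -> spinor_aeq v u.
Proof. by move=> uv e; apply: (aeS _ (uv e)) => x h /h. Qed.

Lemma spinor_aeq_trans u v w : spinor_aeq u v -> spinor_aeq v w -> spinor_aeq u w.
Proof.
by move=> uv vw e; apply: (aeS2 _ (uv e) (vw e)) => x h1 h2 ex; rewrite h1// h2.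
Qed.

Lemma spinor_aeq_lin (a : R[i]) u u' v v' : spinor_aeq u u' -> spinor_aeq v v' ->
  spinor_aeq (a *: u + v) (a *: u' + v').
Proof.
move=> uu vv e; apply: (aeS2 _ (uu e) (vv e)) => x h1 h2 ex.
by rewrite /= !fctE h1// h2.
Qed.

Lemma measurable_sqr_C2norm u e : measurable_spinor u ->
  measurable_fun (edge_dom e) (fun x => (C2norm (u e x) ^+ 2)%:E).
Proof. by move=> u2; apply: (measurable_modulus (g := fun t => t ^+ 2)) => //;
    exact: (@exprn_measurable R setT 2). Qed.


Definition sqr_modulus (a : R[i]) : R := complex.Re a ^+ 2 + complex.Im a ^+ 2.

Lemma sqr_modulus_ge0 a : 0 <= sqr_modulus a.
Proof. by rewrite addr_ge0 ?sqr_ge0. Qed.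

(** The factor 2 is that of |z + y|^2 <= 2 |z|^2 + 2 |y|^2.  This inequality
    replaces the triangle inequality throughout, because it is linear in the
    squared norms and so passes to the masses of a spectral measure. *)
Lemma L2normsq_lin_le a u v : inL2 u -> inL2 v ->
  (L2normsq (a *: u + v)%R <=
   (2 * sqr_modulus a)%:E * L2normsq u + 2%:E * L2normsq v)%E.
Proof.
move=> u2 v2.
have i0 w (i : edge G) : (0 <= \int[mu]_(x in edge_dom i) (C2norm (w i x) ^+ 2)%:E)%E.
  by apply: integral_ge0 => x _; rewrite lee_fin sqr_ge0.
have c0 : (0 <= (2 * sqr_modulus a)%:E)%E.
  by rewrite lee_fin mulr_ge0// sqr_modulus_ge0.
have two0 : (0 <= 2%:E :> \bar R)%E by rewrite lee_fin.
rewrite /L2normsq !ge0_sume_distrr//; try by move=> i _; exact: i0.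
rewrite -big_split/=; apply: lee_sum => e _.
have mD := measurable_edge_dom e.
have mu2 := @measurable_sqr_C2norm u e (inL2_measurable u2).
have mv2 := @measurable_sqr_C2norm v e (inL2_measurable v2).
have p0 w x : (0 <= (C2norm (w e x) ^+ 2)%:E)%E by rewrite lee_fin sqr_ge0.
rewrite -!ge0_integralZl//.
rewrite -ge0_integralD//; first last.
- exact: measurable_funeM.
- by move=> x _; rewrite mule_ge0.
- exact: measurable_funeM.
- by move=> x _; rewrite mule_ge0.
apply: ge0_le_integral => //.
- by apply: measurable_sqr_C2norm; apply: measurable_spinor_lin; exact: inL2_measurable.
- by apply: emeasurable_funD; exact: measurable_funeM.
- move=> x _; rewrite -!EFinM -EFinD lee_fin !fctE.
  by rewrite (le_trans (C2norm_add_sqr _ _))// C2norm_scale_sqr mulrA.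
Qed.

Lemma inL2_lin a u v : inL2 u -> inL2 v -> inL2 (a *: u + v).
Proof.
move=> u2 v2; split; first by apply: measurable_spinor_lin; exact: inL2_measurable.
apply: le_lt_trans (L2normsq_lin_le a u2 v2) _.
rewrite -(fineK (L2normsq_fin_num u2)) -(fineK (L2normsq_fin_num v2)).
by rewrite -!EFinM -EFinD ltry.
Qed.

End L2.

(** * One-dimensional calculus and the nonlinearity *)

Section RealAnalysis.
Variable R : realType.
Local Notation mu := (@lebesgue_measure R).
Implicit Types (A : set R) (g : R -> R).

Lemma itv_one_sqr (g : R -> R) (x y : R) : measurable_fun `[x, y] g ->
  x <= y ->
  (\int[mu]_(s in `[x, y]) (1 + g s ^+ 2)%:E =
   (y - x)%:E + \int[mu]_(s in `[x, y]) (g s ^+ 2)%:E)%E.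
Proof.
move=> mg xy.
rewrite -[X in (X + _)%E]mul1e.
have -> : (1 * (y - x)%:E = \int[mu]_(s in `[x, y]) cst 1 s)%E.
  rewrite integral_cst//; congr (_ * _)%E.
  rewrite /= lebesgue_measure_itv/= lte_fin; case: ltgtP xy => // -> _.
  by rewrite subrr.
rewrite -ge0_integralD//.
- by move=> s _; rewrite lee_fin sqr_ge0.
- by apply/measurable_EFinP; exact: measurable_funX.
Qed.

(** On a bounded interval |g| <= 1 + g^2. *)
Lemma sqr_integrable_itv (g : R -> R) (x y : R) : measurable_fun `[x, y] g -> x <= y ->
  (\int[mu]_(s in `[x, y]) (g s ^+ 2)%:E < +oo)%E ->
  mu.-integrable `[x, y] (EFin \o g).
Proof.
move=> mg xy g2.
apply: (@le_integrable _ _ R mu `[x, y] _ (EFin \o g) (EFin \o (fun s => 1 + g s ^+ 2))) => //.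
- exact/measurable_EFinP.
- move=> s _ /=; rewrite lee_fin.
  have := sqr_ge0 (1 - `|g s|); rewrite sqrrB expr1n mul1r real_normK ?num_real// => h.
  have := sqr_ge0 (g s) => h2; rewrite [leRHS]ger0_norm ?addr_ge0//.
  by have := normr_ge0 (g s); lra.
- apply/integrableP; split.
    by apply/measurable_EFinP; apply: measurable_funD => //; exact: measurable_funX.
  under eq_integral => s _.
    rewrite /= ger0_norm; last by rewrite addr_ge0 ?sqr_ge0.
    over.
  by rewrite itv_one_sqr// lte_add_pinfty// ltry.
Qed.

Lemma normr_Rintegral_le (g : R -> R) (x y : R) : measurable_fun `[x, y] g -> x <= y ->
  (\int[mu]_(s in `[x, y]) (g s ^+ 2)%:E < +oo)%E ->
  `|\int[mu]_(s in `[x, y]) g s| <=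
  (y - x) + fine (\int[mu]_(s in `[x, y]) (g s ^+ 2)%:E).
Proof.
move=> mg xy g2; apply: le_trans (le_normr_Rintegral _ (sqr_integrable_itv mg xy g2)) _ => //.
have f2 : (\int[mu]_(s in `[x, y]) (g s ^+ 2)%:E)%E \is a fin_num.
  by rewrite ge0_fin_numE// integral_ge0// => s _; rewrite lee_fin sqr_ge0.
have -> : y - x + fine (\int[mu]_(s in `[x, y]) (g s ^+ 2)%:E) =
  fine (\int[mu]_(s in `[x, y]) (1 + g s ^+ 2)%:E).
  by rewrite itv_one_sqr// [RHS]fineD.
rewrite /Rintegral; apply: fine_le.
- rewrite ge0_fin_numE; last by apply: integral_ge0.
  by have /integrableP[_] := sqr_integrable_itv mg xy g2.
- by rewrite itv_one_sqr// fin_numD f2.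
- apply: ge0_le_integral => //.
  + by apply/measurable_EFinP; exact: measurableT_comp.
  + by apply/measurable_EFinP; apply: measurable_funD => //; exact: measurable_funX.
  + move=> s _; rewrite lee_fin.
    have := sqr_ge0 (1 - `|g s|); rewrite sqrrB expr1n mul1r real_normK ?num_real// => h.
    by have := sqr_ge0 (g s); have := normr_ge0 (g s); lra.
Qed.

(** The length l depends on the interval only and x may be either end, so that
    averaging over [y, z] bounds a function at x uniformly in x. *)
Lemma subinterval_near (a b : \bar R) : (a < b)%E ->
  exists2 l : R, 0 < l <= 1 & forall x, (a <= x%:E)%E -> (x%:E <= b)%E ->
    exists y z, [/\ (x = y \/ x = z), z = y + l &
      `[y, z] `<=` [set t | (a <= t%:E)%E /\ (t%:E <= b)%E]].
Proof.
move=> ab.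
have [l [l0 l1 lab]] : exists l : R, [/\ 0 < l, l <= 1 & (a + (2 * l)%:E <= b)%E].
  move: a b ab => [a| |] [b| |] //=; rewrite ?lte_fin => ab.
  - exists (Num.min 1 ((b - a) / 2)); split.
    + by rewrite lt_min ltr01 divr_gt0// subr_gt0.
    + by rewrite ge_min lexx.
    + rewrite -EFinD lee_fin;
        have : Num.min 1 ((b - a) / 2) <= (b - a) / 2 by rewrite ge_min lexx orbT.
      by lra.
  - by exists 1; rewrite ?leey.
  - by exists 1; rewrite leNye.
  - by exists 1; rewrite ?leey.
exists l; first by rewrite l0.
move=> x ax xb.
have [h|h] := leP ((x + l)%:E) b.
  exists x, (x + l); split=> //; first by left.
  move=> t /=; rewrite in_itv/= => /andP[xt tx]; split.
    by apply: le_trans ax _; rewrite lee_fin.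
  by apply: le_trans h; rewrite lee_fin.
exists (x - l), x; split=> //; [by right|by rewrite subrK|].
move=> t /=; rewrite in_itv/= => /andP[xt tx]; split; last first.
  by apply: le_trans xb; rewrite lee_fin.
move: a b ab lab h ax xb => [a| |] [b| |] //=; rewrite ?leNye// ?lee_fin ?lte_fin -?EFinD ?lee_fin.
  by move=> *; lra.
Qed.

(** The oscillation of g on the subinterval at x is at most K, because |g'| <=
    1 + g'^2; so g(x)^2 <= 2 g(t)^2 + 2 K^2 for t in the subinterval, and
    averaging over t bounds g(x)^2 by the L^2 norm of g. *)
Lemma H1_bounded (a b : \bar R) (g g' : R -> R) : (a < b)%E ->
  let A := [set t : R | (a <= t%:E)%E /\ (t%:E <= b)%E] in
  measurable A -> measurable_fun A g -> measurable_fun A g' ->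
  (\int[mu]_(s in A) (g s ^+ 2)%:E < +oo)%E ->
  (\int[mu]_(s in A) (g' s ^+ 2)%:E < +oo)%E ->
  (forall x y, A x -> A y -> x <= y -> g y - g x = \int[mu]_(s in `[x, y]) g' s) ->
  exists2 M, 0 <= M & forall x, A x -> g x ^+ 2 <= M.
Proof.
move=> ab A mA mg mg' g2 g'2 gg'.
have [l /andP[l0 l1] sub] := subinterval_near ab.
have fin_sub (h : R -> R) x y : measurable_fun A h -> `[x, y] `<=` A ->
  (\int[mu]_(s in A) (h s ^+ 2)%:E < +oo)%E ->
  (\int[mu]_(s in `[x, y]) (h s ^+ 2)%:E <= \int[mu]_(s in A) (h s ^+ 2)%:E)%E.
  move=> mh xyA h2; apply: ge0_subset_integral => //.
  - by apply/measurable_EFinP; exact: measurable_funX.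
  - by move=> s _; rewrite lee_fin sqr_ge0.
have fn (h : R -> R) (B : set R) : (\int[mu]_(s in B) (h s ^+ 2)%:E < +oo)%E ->
  (\int[mu]_(s in B) (h s ^+ 2)%:E)%E \is a fin_num.
  by move=> ?; rewrite ge0_fin_numE// integral_ge0// => s _; rewrite lee_fin sqr_ge0.
pose N (h : R -> R) := fine (\int[mu]_(s in A) (h s ^+ 2)%:E).
have N0 h : 0 <= N h.
  by rewrite fine_ge0// integral_ge0// => s _; rewrite lee_fin sqr_ge0.
pose K := 1 + N g'.
(* The first term is twice the average of g^2 over an interval of length l. *)
exists (2 * N g / l + 2 * K ^+ 2).
  apply: addr_ge0; last by rewrite mulr_ge0// sqr_ge0.
  by rewrite divr_ge0 ?mulr_ge0// ltW.
move=> x [ax xb].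
have [y [z [xyz zy yzA]]] := sub x ax xb.
have yz : y <= z by rewrite zy lerDl ltW.
have xin : x \in `[y, z].
  by rewrite in_itv/=; case: xyz => ->; rewrite lexx ?yz.
have dif t : t \in `[y, z] -> `|g t - g x| <= K.
  have key p q : p \in `[y, z] -> q \in `[y, z] -> p <= q -> `|g q - g p| <= K.
    rewrite !in_itv/= => /andP[yp pz] /andP[yq qz] pq.
    have pqA : `[p, q] `<=` A.
      move=> r /=; rewrite in_itv/= => /andP[pt tq]; apply: yzA => /=.
      by rewrite in_itv/= (le_trans yp pt) (le_trans tq qz).
    rewrite gg'//; [|by apply: pqA; rewrite /= in_itv/= lexx pq..].
    have mpq : measurable_fun `[p, q] g' by apply: measurable_funS mg'.
    have lpq := fin_sub g' p q mg' pqA g'2.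
    apply: le_trans (normr_Rintegral_le mpq pq (le_lt_trans lpq g'2)) _.
    apply: lerD; first by lra.
    by apply: fine_le => //; apply: fn => //; exact: le_lt_trans lpq g'2.
  move=> tin; have [xt|/ltW tx] := leP x t; first exact: key.
  by rewrite distrC; exact: key.
have pw t : t \in `[y, z] -> g x ^+ 2 <= 2 * g t ^+ 2 + 2 * K ^+ 2.
  move=> /dif hd; have K0 : 0 <= K by rewrite addr_ge0.
  have hK : (g t - g x) ^+ 2 <= K ^+ 2.
    by rewrite -[leLHS]real_normK ?num_real// lerXn2r ?nnegrE.
  by have := sqr_ge0 (2 * g t - g x); nra.
have le1 : (\int[mu]_(t in `[y, z]) cst (g x ^+ 2)%:E t <=
    \int[mu]_(t in `[y, z]) ((2%:E * (g t ^+ 2)%:E) + (cst (2 * K ^+ 2)%:E t)))%E.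
  apply: ge0_le_integral => //.
  - by move=> t _; rewrite /= lee_fin sqr_ge0.
  - by apply: emeasurable_funD => //; apply: measurable_funeM; apply/measurable_EFinP;
      apply: measurable_funX; apply: measurable_funS mg.
have mlz : mu `[y, z] = l%:E.
  rewrite /= lebesgue_measure_itv/= lte_fin zy ltrDl l0 -EFinB.
  by congr EFin; lra.
have mg2 : measurable_fun `[y, z] (fun t => (g t ^+ 2)%:E).
  by apply/measurable_EFinP; apply: measurable_funX; apply: measurable_funS mg.
move: le1; rewrite ge0_integralD//; first last.
- by move=> t _; rewrite lee_fin mulr_ge0// sqr_ge0.
- exact: measurable_funeM.
- by move=> t _; rewrite -EFinM lee_fin mulr_ge0// sqr_ge0.
rewrite ge0_integralZl//; last first.
  by move=> t _; rewrite lee_fin sqr_ge0.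
rewrite !integral_cst//= -/mu mlz => le1.
have lyz := fin_sub g y z mg yzA g2.
have le2 : ((g x ^+ 2)%:E * l%:E <= 2%:E * (N g)%:E + (2 * K ^+ 2)%:E * l%:E)%E.
  apply: le_trans le1 _; apply: leeD2r; apply: lee_pmul => //.
  by apply: integral_ge0 => t _; rewrite lee_fin sqr_ge0.
  by rewrite /N fineK// fn.
move: le2; rewrite -!EFinM -EFinD lee_fin => le2.
rewrite -(ler_pM2r l0) mulrDl divfK//.
by rewrite gt_eqF.
Qed.

End RealAnalysis.

Section Primitive.
Variables (R : realType) (f : R -> R).
Hypotheses (hF1 : F1 f) (hF4 : F4 f).
Local Notation mu := (@lebesgue_measure R).

Lemma f_ge0 t : 0 <= t -> 0 <= f t. Proof. by case: hF1 => _; exact. Qed.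

(** At s = 0 monotonicity follows from f(0) = 0 and f >= 0. *)
Lemma f_nondecreasing s t : 0 <= s -> s <= t -> f s <= f t.
Proof.
rewrite le_eqVlt => /predU1P[<- t0|s0 st]; last exact: hF4.
by case: hF1 => -> h; exact: h.
Qed.

Lemma fid_nondecreasing s t : 0 <= s -> s <= t -> f s * s <= f t * t.
Proof.
by move=> s0 st; rewrite ler_pM ?f_ge0// f_nondecreasing.
Qed.

Lemma fid_ge0 t : 0 <= t -> 0 <= f t * t.
Proof. by move=> t0; rewrite mulr_ge0 ?f_ge0. Qed.

Lemma measurable_fid (A : set R) : measurable A -> A `<=` [set t | 0 <= t] ->
  measurable_fun A (fun s => f s * s).
Proof.
move=> mA A0.
have m : measurable_fun A (fun s => if s < 0 then 0 else f s * s).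
  apply: nondecreasing_measurable => // s t st.
  have [s0|s0] := ltP s 0; have [t0|t0] := ltP t 0 => //.
  - exact: fid_ge0.
  - by move: (le_lt_trans st t0); rewrite ltNge s0.
  - exact: fid_nondecreasing.
apply: eq_measurable_fun m => s; rewrite inE => /A0 /= s0.
by rewrite ltNge s0.
Qed.

Lemma fid_integrable a b : 0 <= a -> mu.-integrable `[a, b] (EFin \o (fun s => f s * s)).
Proof.
move=> a0.
have sub : `[a, b] `<=` [set t : R | 0 <= t].
  by move=> s /=; rewrite in_itv/= => /andP[/(le_trans a0)].
apply: measurable_bounded_integrable => //.
- by rewrite /= lebesgue_measure_itv/=; case: ifP => // _; rewrite -EFinB ltry.
- exact: measurable_fid.
- exists (f b * b); split; first exact: num_real.
  move=> y hy s /= hs.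
  move: (hs); rewrite in_itv/= => /andP[as_ sb].
  rewrite ger0_norm ?fid_ge0 ?(le_trans a0)//.
  by apply: le_trans (ltW hy); rewrite fid_nondecreasing// (le_trans a0).
Qed.

(** The integrand f(s) s is nondecreasing and so is at most f(t) t on ]s, t];
    hence F is nondecreasing and locally Lipschitz. *)
Lemma primF_sub s t : 0 <= s -> s <= t ->
  0 <= primF f t - primF f s <= f t * t * (t - s).
Proof.
move=> s0 st.
rewrite /primF (Rintegral_itvB (fid_integrable t (lexx 0))) ?bnd_simp//.
have int : mu.-integrable `]s, t] (EFin \o (fun s => f s * s)).
  apply: integrableS (fid_integrable t s0) => //.
  by apply: subset_itvr; rewrite bnd_simp.
apply/andP; split.
  apply: Rintegral_ge0 => r /=; rewrite in_itv/= => /andP[sr _].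
  by rewrite fid_ge0// (le_trans s0)// ltW.
have lst : (mu `]s, t] = (t - s)%:E)%E.
  rewrite /= lebesgue_measure_itv/= lte_fin -EFinB; case: ltgtP st => // -> _.
  by rewrite subrr.
have -> : f t * t * (t - s) = \int[mu]_(r in `]s, t]) cst (f t * t) r.
  by rewrite Rintegral_cst//= lst.
apply: le_Rintegral => //.
  apply: measurable_bounded_integrable => //;
      first exact: (eq_ind_r (fun x => x < +oo)%E (ltry (t - s)) lst).
  exact: bounded_cst.
move=> r /=; rewrite in_itv/= => /andP[sr rt].
by apply: fid_nondecreasing => //; rewrite (le_trans s0)// ltW.
Qed.

Lemma primF_ge0 t : 0 <= primF f t.
Proof.
apply: Rintegral_ge0 => s /=; rewrite in_itv/= => /andP[s0 _].
exact: fid_ge0.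
Qed.

Lemma primF0 : primF f 0 = 0.
Proof. by rewrite /primF set_itv1 Rintegral_set1. Qed.

Lemma primF_nondecreasing : {homo primF f : s t / s <= t}.
Proof.
move=> s t st; have [s0|s0] := leP 0 s.
  by have /andP[] := primF_sub s0 st; rewrite subr_ge0.
by rewrite {1}/primF set_itv_ge ?Rintegral_set0 ?primF_ge0// bnd_simp -ltNge.
Qed.

Lemma primF_measurable : measurable_fun setT (primF f).
Proof. by apply: nondecreasing_measurable => //; exact: primF_nondecreasing. Qed.

(** Consequently a bounded square-integrable spinor has finite potential
    energy. *)
Lemma primF_le_sqr t K : 0 <= t -> t <= K -> primF f t <= f K * t ^+ 2.
Proof.
move=> t0 tK; have /andP[_] := primF_sub (lexx 0) t0.
rewrite primF0 !subr0 => /le_trans; apply.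
by rewrite -mulrA -expr2 ler_wpM2r ?sqr_ge0// f_nondecreasing.
Qed.

Lemma primF_cvg (t_ : nat -> R) t : (forall n, 0 <= t_ n) ->
  t_ @ \oo --> t -> primF f (t_ n) @[n --> \oo] --> primF f t.
Proof.
move=> t_0 tt.
have t0 : 0 <= t.
  rewrite -(cvg_lim _ tt)//; apply: limr_ge; first by apply/cvg_ex; exists t.
  exact: nearW.
(* A Lipschitz constant of F on [0, t + 1], made positive by the last term. *)
set C := f (t + 1) * (t + 1) + 1.
have C0 : 0 < C by rewrite ltr_wpDl// fid_ge0// addr_ge0.
have lip a b : 0 <= a -> a <= b -> b <= t + 1 -> primF f b - primF f a <= C * (b - a).
  move=> a0 ab bt; have /andP[_ /le_trans] := primF_sub a0 ab; apply.
  apply: ler_wpM2r; first by rewrite subr_ge0.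
  by rewrite /C -[leLHS]addr0 lerD// fid_nondecreasing// (le_trans a0).
apply/cvgrPdist_le => e e0.
have m0 : 0 < Num.min 1 (e / C) by rewrite lt_min ltr01 divr_gt0.
have /cvgrPdist_le/(_ _ m0) := tt.
apply: filterS => n; rewrite le_min => /andP[d1 d2].
have d3 : C * `|t - t_ n| <= e by rewrite mulrC -ler_pdivlMr.
apply: le_trans d3.
have [h|h] := leP t (t_ n).
  rewrite distrC [X in C * X]distrC !ger0_norm ?subr_ge0 ?primF_nondecreasing//.
  by apply: lip => //; move: d1; rewrite ler_norml; lra.
have tn := ltW h; rewrite !ger0_norm ?subr_ge0 ?primF_nondecreasing//.
by apply: lip => //; lra.
Qed.

End Primitive.

(** * Masses of a spectral measure *)

Section SpectralMass.
Variables (R : realType) (G : metric_graph R).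
Variables (D : spinor G -> spinor G -> Prop) (E : spectral_measure D).
Local Notation mu := (@lebesgue_measure R).
Implicit Types (u v w : spinor G) (A B : set (measurableTypeR R)) (g : R -> R).

Lemma mass_aeq u v B : measurable B -> inL2 u -> inL2 v -> spinor_aeq u v ->
  mass E u B = mass E v B.
Proof.
move=> mB u2 v2 uv; rewrite !mass_proj//; apply: L2normsq_aeq.
- exact: proj_L2.
- exact: proj_L2.
- exact: proj_aeq.
Qed.

Lemma mass_setT u : inL2 u -> mass E u setT = L2normsq u.
Proof.
move=> u2; rewrite mass_proj//; apply: L2normsq_aeq => //; first exact: proj_L2.
exact: proj_setT.
Qed.

(** All estimates below compare masses setwise and integrate afterwards,
    without the inner product. *)
Lemma mass_lin_le (a : R[i]) u v B : measurable B -> inL2 u -> inL2 v ->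
  (mass E (a *: u + v)%R B <=
   (2 * sqr_modulus a)%:E * mass E u B + 2%:E * mass E v B)%E.
Proof.
move=> mB u2 v2; rewrite !mass_proj//; last exact: inL2_lin.
have pu := proj_L2 E mB u2; have pv := proj_L2 E mB v2.
apply: le_trans (L2normsq_lin_le a pu pv).
rewrite (@L2normsq_aeq _ _ (spectral_proj E B (a *: u + v)) (a *: spectral_proj E B u +
    spectral_proj E B v)) //.
- by apply: proj_L2 => //; exact: inL2_lin.
- exact: inL2_lin.
- exact: proj_linear.
Qed.

Lemma mass_proj_proj u A B : measurable A -> measurable B -> inL2 u ->
  mass E (spectral_proj E A u) B = mass E u (B `&` A).
Proof.
move=> mA mB u2; rewrite !mass_proj//; last 2 first.
- exact: measurableI.
- exact: proj_L2.
symmetry; apply: L2normsq_aeq.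
- by apply: proj_L2 => //; exact: measurableI.
- by apply: proj_L2 => //; exact: proj_L2.
- exact: proj_setI.
Qed.

(** The spectral projection of A annihilates u - E(A) u. *)
Lemma mass_compl_proj u A : measurable A -> inL2 u ->
  mass E ((-1) *: spectral_proj E A u + u) A = 0%E.
Proof.
move=> mA u2; have pu := proj_L2 E mA u2; have ppu := proj_L2 E mA pu.
rewrite mass_proj//; last exact: inL2_lin.
rewrite (@L2normsq_aeq _ _ _ (fun _ _ => 0)) ?/L2normsq.
- apply: big1 => e _; apply: integral0_eq => x _.
  by rewrite C2norm0 expr0n.
- by apply: proj_L2 => //; exact: inL2_lin.
- rewrite (_ : (fun _ _ => 0) = (-1) *: u + u); first exact: inL2_lin.
  by rewrite scaleN1r addNr.
apply: spinor_aeq_trans (proj_linear E _ mA pu u2) _.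
rewrite (_ : (fun _ _ => 0) = (-1) *: spectral_proj E A u + spectral_proj E A u); last first.
  by rewrite scaleN1r addNr.
apply: spinor_aeq_lin; last exact: spinor_aeq_refl.
apply: spinor_aeq_sym.
by have := proj_setI E mA mA u2; rewrite setIid.
Qed.

Lemma int_mass_lin_le (a : R[i]) u v B (g : R -> \bar R) : measurable B ->
  (forall t, (0 <= g t)%E) -> measurable_fun setT g -> inL2 u -> inL2 v ->
  (\int[mass E (a *: u + v)%R]_(t in B) g t <=
   (2 * sqr_modulus a)%:E * \int[mass E u]_(t in B) g t
   + 2%:E * \int[mass E v]_(t in B) g t)%E.
Proof.
move=> mB g0 mg u2 v2.
have c0 : 0 <= 2 * sqr_modulus a by rewrite mulr_ge0// sqr_modulus_ge0.
have mgB : measurable_fun B g by exact: measurable_funTS.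
have ku0 : 0 <= (2 : R) by [].
set m1 := mass E u; set m2 := mass E v.
have -> : ((2 * sqr_modulus a)%:E * \int[m1]_(t in B) g t + 2%:E * \int[m2]_(t in B) g t =
   \int[measure_add (mscale (NngNum c0) m1) (mscale (NngNum ku0) m2)]_(t in B) g t)%E.
  by rewrite ge0_integral_measure_add// !ge0_integral_mscale.
apply: ge0_le_measure_integral => // S mS.
by rewrite [leRHS]measure_addE; exact: mass_lin_le.
Qed.

Definition int_mass u := (\int[mass E u]_t (`|t|)%:E)%E.

Lemma measurable_abs : measurable_fun setT (fun t : R => (`|t|)%:E).
Proof. by apply/measurable_EFinP; exact: (@normr_measurable R setT). Qed.

Lemma int_mass_ge0 u : (0 <= int_mass u)%E.
Proof. by apply: integral_ge0 => t _; rewrite lee_fin. Qed.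

Lemma Ynormsq_EFin u : inY E u -> (Ynormsq E u)%:E = int_mass u.
Proof. by case=> u2 h; rewrite fineK// ge0_fin_numE// int_mass_ge0. Qed.

Lemma Ynormsq_ge0 u : 0 <= Ynormsq E u.
Proof. by apply: Rintegral_ge0. Qed.

Lemma inY_lin (a : R[i]) u v : inY E u -> inY E v -> inY E (a *: u + v).
Proof.
move=> [u2 hu] [v2 hv]; split; first exact: inL2_lin.
have u0 := int_mass_ge0 u; have v0 := int_mass_ge0 v.
apply: le_lt_trans (int_mass_lin_le a measurableT _ measurable_abs u2 v2) _.
  by move=> t; rewrite lee_fin.
rewrite -/(int_mass u) -/(int_mass v).
rewrite -(Ynormsq_EFin (conj u2 hu)) -(Ynormsq_EFin (conj v2 hv)).
by rewrite -!EFinM -EFinD ltry.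
Qed.

Lemma Ynormsq_lin_le (a : R[i]) u v : inY E u -> inY E v ->
  Ynormsq E (a *: u + v) <= 2 * sqr_modulus a * Ynormsq E u + 2 * Ynormsq E v.
Proof.
move=> hu hv; rewrite -lee_fin EFinD !(EFinM _ (Ynormsq _ _)).
rewrite !Ynormsq_EFin//; last exact: inY_lin.
case: hu hv => [u2 _] [v2 _].
apply: (int_mass_lin_le a measurableT _ measurable_abs u2 v2).
by move=> t; rewrite lee_fin.
Qed.

Lemma int_mass_proj_le u A B (g : R -> \bar R) : measurable A -> measurable B ->
  (forall t, (0 <= g t)%E) -> measurable_fun setT g -> inL2 u ->
  (\int[mass E (spectral_proj E A u)]_(t in B) g t <= \int[mass E u]_(t in B) g t)%E.
Proof.
move=> mA mB g0 mg u2; apply: ge0_le_measure_integral => // S mS.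
by rewrite mass_proj_proj//; apply: le_measure; rewrite ?inE//; exact: measurableI.
Qed.

Lemma inY_proj u A : measurable A -> inY E u -> inY E (spectral_proj E A u).
Proof.
move=> mA [u2 hu]; split; first exact: proj_L2.
apply: le_lt_trans hu; apply: int_mass_proj_le => //; exact: measurable_abs.
Qed.

Lemma Ynormsq_proj_le u A : measurable A -> inY E u ->
  Ynormsq E (spectral_proj E A u) <= Ynormsq E u.
Proof.
move=> mA hu; rewrite -lee_fin !Ynormsq_EFin//; last exact: inY_proj.
case: hu => u2 _; apply: int_mass_proj_le => //; exact: measurable_abs.
Qed.

Lemma integral_setC_split (m : {measure set (measurableTypeR R) -> \bar R}) A
  (g : R -> \bar R) : measurable A -> (forall t, (0 <= g t)%E) -> measurable_fun setT g ->
  (\int[m]_t g t = \int[m]_(t in A) g t + \int[m]_(t in ~` A) g t)%E.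
Proof.
move=> mA g0 mg; transitivity (\int[m]_(t in A `|` ~` A) g t)%E; first by rewrite setUv.
rewrite ge0_integral_setU//.
- exact: measurableC.
- by rewrite setUv.
- by apply/disj_setPCl.
Qed.

(** The mass of u - E(A) u does not charge A, and elsewhere it is controlled
    by the mass of u. *)
Lemma int_mass_compl_proj u A (g : R -> \bar R) : measurable A ->
  (forall t, (0 <= g t)%E) -> measurable_fun setT g -> inL2 u ->
  (\int[mass E ((-1) *: spectral_proj E A u + u)%R]_t g t <=
   4%:E * \int[mass E u]_(t in ~` A) g t)%E.
Proof.
move=> mA g0 mg u2; have mC : measurable (~` A) by exact: measurableC.
have pu := proj_L2 E mA u2.
rewrite (integral_setC_split _ mA)//.
rewrite null_set_integral//; last 2 first.
- exact: measurable_funTS.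
- exact: mass_compl_proj.
rewrite add0e; apply: le_trans (int_mass_lin_le _ mC g0 mg pu u2) _.
rewrite (_ : sqr_modulus (-1) = 1); last by rewrite /sqr_modulus/= sqrrN oppr0 expr1n expr0n addr0.
have := int_mass_proj_le mA mC g0 mg u2.
set x := (\int[_]_(t in _) _)%E; set y := (\int[_]_(t in _) _)%E => xy.
have y0 : (0 <= y)%E by exact: integral_ge0.
have -> : (4%:E * y = 2%:E * y + 2%:E * y)%E.
  by rewrite -ge0_muleDl// -EFinD -natrD.
by rewrite mulr1; apply: leeD2r; apply: lee_pmul => //; exact: integral_ge0.
Qed.

(** The mass of the truncation is carried by [- n, n], where t^2 <= n^2. *)
Lemma proj_itv_dom u n : inL2 u ->
  exists v, D (spectral_proj E `[- n, n] u) v.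
Proof.
move=> u2; have mA : measurable (`[- n, n] : set R) by [].
have pu := proj_L2 E mA u2.
apply/(spectral_dom E pu).
have mC : measurable (~` `[- n, n] : set R) by exact: measurableC.
have mg : measurable_fun setT (fun t : R => (t ^+ 2)%:E).
  by apply/measurable_EFinP; exact: (@exprn_measurable R setT 2).
have g0 (t : R) : (0 <= (t ^+ 2)%:E)%E by rewrite lee_fin sqr_ge0.
rewrite (integral_setC_split _ mA)//.
rewrite [X in (_ + X)%E]null_set_integral ?adde0//; last 2 first.
- exact: measurable_funTS.
- by rewrite mass_proj_proj// setICl measure0.
apply: (@le_lt_trans _ _ (\int[mass E (spectral_proj E `[(- n)%R, n] u)]_(t in `[(- n)%R, n])
    cst (n ^+ 2)%:E t)%E).
  apply: ge0_le_integral => //.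
  - exact: measurable_funTS.
  - move=> t /=; rewrite in_itv/= => /andP[h1 h2]; rewrite lee_fin.
    by nra.
rewrite integral_cst//.
have : (mass E (spectral_proj E `[(- n)%R, n] u) [set` `[(- n)%R, n]] <= mass E u setT)%E.
  by rewrite mass_proj_proj//; apply: le_measure; rewrite ?inE//; exact: measurableI.
rewrite mass_setT// => h.
have hf : mass E (spectral_proj E `[- n, n] u) [set` `[- n, n]] \is a fin_num.
  by rewrite ge0_fin_numE// (le_lt_trans h)//; case: u2.
by rewrite -(fineK hf) -EFinM ltry.
Qed.

Lemma tail_integral (m : {measure set (measurableTypeR R) -> \bar R}) (g : R -> \bar R) (eps : R) :
  (forall t, (0 <= g t)%E) -> measurable_fun setT g -> (\int[m]_t g t < +oo)%E ->
  0 < eps -> exists n : R, (\int[m]_(t in ~` `[(- n)%R, n]) g t <= eps%:E)%E.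
Proof.
move=> g0 mg gf e0.
pose F (k : nat) : set R := `[- (k%:R), k%:R]%classic.
have ndF : {homo F : n m / (n <= m)%N >-> (n <= m)%O}.
  move=> i j ij; apply/subsetPset => t; rewrite /F/= !in_itv/= => /andP[h1 h2].
  have : i%:R <= j%:R :> R by rewrite ler_nat.
  by move=> ijR; apply/andP; split; lra.
have cF : \bigcup_k F k = setT.
  apply/seteqP; split=> // t _; exists (Num.truncn `|t|).+1 => //=.
  have := truncnS_gt `|t|; rewrite /F/= in_itv/= -ler_norml => /ltW.
  by [].
have mF k : measurable (F k) by exact: measurable_itv.
have mgF k : measurable_fun (F k) g by exact: measurable_funTS.
have := @ge0_nondecreasing_set_cvg_integral _ (measurableTypeR R) R F g m ndF mF mgF (fun _ t _
    => g0 t).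
rewrite cF => cv.
have tf : (\int[m]_t g t)%E \is a fin_num by rewrite ge0_fin_numE// integral_ge0.
have /fine_cvgP[_ /cvgrPdist_le/(_ _ e0)[N _ hN]] : (\int[m]_(x in F i) g x)%E @[i --> \oo] -->
    (fine (\int[m]_t g t))%:E.
  by rewrite fineK.
exists N%:R; have := hN N (leqnn _) => /=.
have split := @integral_setC_split m (F N) g (mF N) g0 mg.
have x0 : (0 <= \int[m]_(t in F N) g t)%E by exact: integral_ge0.
have y0 : (0 <= \int[m]_(t in ~` F N) g t)%E by exact: integral_ge0.
move: tf; rewrite split fin_numD => /andP[fx fy].
rewrite -/(F N) -(fineK fx) -(fineK fy) -EFinD /= lee_fin => h.
by move: h; rewrite addrAC subrr add0r => /ler_normlP[].
Qed.

End SpectralMass.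

(** * Bounded spinors and semicontinuity of the potential energy *)

Section DomainBounded.
Variables (R : realType) (G : metric_graph R).
Local Notation mu := (@lebesgue_measure R).
Implicit Types (u v w : spinor G).

Lemma entry_sqr_integral w e k : inL2 w ->
  (\int[mu]_(x in edge_dom e) (complex.Re (w e x k 0) ^+ 2)%:E < +oo)%E /\
  (\int[mu]_(x in edge_dom e) (complex.Im (w e x k 0) ^+ 2)%:E < +oo)%E.
Proof.
move=> w2; have [mr mi] := inL2_measurable w2 e k.
have mD := measurable_edge_dom e.
have mw := @measurable_sqr_C2norm _ _ w e (inL2_measurable w2).
split; (apply: le_lt_trans (inL2_edge_lty e w2); apply: ge0_le_integral => //).
- by move=> x _; rewrite lee_fin sqr_ge0.
- by apply/measurable_EFinP; exact: measurable_funX.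
- by move=> x _; rewrite lee_fin; case: (C2norm_entry_le (w e x) k).
- by move=> x _; rewrite lee_fin sqr_ge0.
- by apply/measurable_EFinP; exact: measurable_funX.
- by move=> x _; rewrite lee_fin; case: (C2norm_entry_le (w e x) k).
Qed.

Lemma H1_derivative_bounded w w' e : H1_derivative w w' ->
  exists2 K, 0 <= K & forall x, edge_dom e x -> C2norm (w e x) <= K.
Proof.
case=> w2 w'2 ww'.
have mD := measurable_edge_dom e.
have bd k : exists2 M, 0 <= M & forall x, edge_dom e x ->
    complex.Re (w e x k 0) ^+ 2 + complex.Im (w e x k 0) ^+ 2 <= M.
  have [mr mi] := inL2_measurable w2 e k; have [mr' mi'] := inL2_measurable w'2 e k.
  have [fr fi] := entry_sqr_integral e k w2; have [fr' fi'] := entry_sqr_integral e k w'2.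
  have [x y ex ey xy|M1 M10 hM1] :=
    @H1_bounded _ _ _ (fun x => complex.Re (w e x k 0)) (fun x => complex.Re (w' e x k 0))
        (bound_lt e) mD mr mr' fr fr'.
    have /(congr1 (@complex.Re R)) := ww' e x y ex ey xy k.
    by rewrite raddfB.
  have [x y ex ey xy|M2 M20 hM2] :=
    @H1_bounded _ _ _ (fun x => complex.Im (w e x k 0)) (fun x => complex.Im (w' e x k 0))
        (bound_lt e) mD mi mi' fi fi'.
    have /(congr1 (@complex.Im R)) := ww' e x y ex ey xy k.
    by rewrite raddfB.
  exists (M1 + M2); first exact: addr_ge0.
  by move=> x ex; apply: lerD; [exact: hM1|exact: hM2].
have [M0 M00 h0] := bd 0; have [M1 M10 h1] := bd 1.
exists (1 + (M0 + M1)); first by rewrite !addr_ge0.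
move=> x ex; have : C2norm (w e x) ^+ 2 <= M0 + M1.
  rewrite C2norm_sqr big_ord_recl big_ord1; apply: lerD; first exact: h0.
  by rewrite (_ : lift ord0 ord0 = 1); [exact: h1|exact/val_inj].
by have := sqr_ge0 (1 - C2norm (w e x)); have := sqr_ge0 (C2norm (w e x)); nra.
Qed.

(** Spinors in the domain are bounded on every edge, so their potential energy
    is at most a multiple of the squared L^2 norm. *)
Lemma dirac_dom_potential (m c : R) (f : R -> R) u v e : F1 f -> F4 f ->
  dirac_op m c u v ->
  (\int[mu]_(x in edge_dom e) (primF f (C2norm (u e x)))%:E < +oo)%E.
Proof.
move=> hF1 hF4 [u2 _ [w [w' [uw H _ _]]]].
have [w2 _ _] := H.
have mF := primF_measurable hF1 hF4.
rewrite (modulus_integral_aeq mF (primF_ge0 hF1) (inL2_measurable u2) (inL2_measurable w2) uw).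
have [K K0 hK] := H1_derivative_bounded e H.
have mw := @measurable_sqr_C2norm _ _ w e (inL2_measurable w2).
have mD := measurable_edge_dom e.
apply: (@le_lt_trans _ _ ((f K)%:E * \int[mu]_(x in edge_dom e) (C2norm (w e x) ^+ 2)%:E)%E).
  rewrite -ge0_integralZl//.
  - apply: ge0_le_integral => //.
    + by move=> x _; rewrite lee_fin (primF_ge0 hF1).
    + exact: (measurable_modulus mF (inL2_measurable w2)).
    + exact: measurable_funeM.
    + move=> x ex; rewrite -EFinM lee_fin; apply: primF_le_sqr => //; first exact: C2norm_ge0.
      exact: hK.
  - by move=> x _; rewrite lee_fin sqr_ge0.
  - by rewrite lee_fin (f_ge0 hF1).
have h := inL2_edge_lty e w2.
have hf : (\int[mu]_(x in edge_dom e) (C2norm (w e x) ^+ 2)%:E)%E \is a fin_num.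
  by rewrite ge0_fin_numE// integral_ge0// => x _; rewrite lee_fin sqr_ge0.
by rewrite -(fineK hf) -EFinM ltry.
Qed.

End DomainBounded.

Section Fatou.
Variables (R : realType) (G : metric_graph R) (f : R -> R).
Hypotheses (hF1 : F1 f) (hF4 : F4 f).
Local Notation mu := (@lebesgue_measure R).
Implicit Types (u v w : spinor G).

(** Each real component is controlled by the modulus of the difference, and
    the modulus is a continuous function of the components. *)
Lemma C2norm_cvg (z_ : nat -> 'cV[R[i]]_2) z :
  C2norm (z - z_ n) ^+ 2 @[n --> \oo] --> (0 : R) ->
  C2norm (z_ n) @[n --> \oo] --> C2norm z.
Proof.
move=> h.
have sq0 (a_ : nat -> R) (a : R) : (forall n, (a - a_ n) ^+ 2 <= C2norm (z - z_ n) ^+ 2) ->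
    a_ n @[n --> \oo] --> a.
  move=> hle; apply/cvgrPdist_le => e e0.
  have e20 : 0 < e ^+ 2 by rewrite exprn_gt0.
  move/cvgrPdist_le : h => /(_ _ e20); apply: filterS => n.
  rewrite sub0r normrN ger0_norm ?sqr_ge0// => hn.
  have hn2 := le_trans (hle n) hn.
  by rewrite -(@ler_pXn2r _ 2)// ?nnegrE ?(ltW e0)// real_normK ?num_real.
have re k : complex.Re (z_ n k 0) @[n --> \oo] --> complex.Re (z k 0).
  apply: sq0 => n; have [+ _] := C2norm_entry_le (z - z_ n) k.
  by rewrite !mxE raddfB.
have im k : complex.Im (z_ n k 0) @[n --> \oo] --> complex.Im (z k 0).
  apply: sq0 => n; have [_ +] := C2norm_entry_le (z - z_ n) k.
  by rewrite !mxE raddfB.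
rewrite /C2norm; apply: (cvg_comp (fun n => \sum_k ComplexField.Normc.normc (z_ n k 0) ^+ 2)
    Num.sqrt); last exact: sqrt_continuous.
have c k : ComplexField.Normc.normc (z_ n k 0) ^+ 2 @[n --> \oo] -->
    ComplexField.Normc.normc (z k 0) ^+ 2.
  rewrite normc_sqr; under eq_fun do rewrite normc_sqr !expr2.
  by rewrite !expr2; exact: (cvgD (cvgM (re k) (re k)) (cvgM (im k) (im k))).
rewrite big_ord_recl big_ord1.
under eq_fun do rewrite big_ord_recl big_ord1.
exact: (cvgD (c _) (c _)).
Qed.

(** The rate of convergence is summable: the sum of the |w - w_n|^2 is then
    integrable, hence finite almost everywhere, so w_n converges to w almost
    everywhere and no subsequence has to be extracted. *)
Lemma potential_fatou e (w_ : nat -> spinor G) w (M : \bar R) :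
  (forall n, inL2 (w_ n)) -> inL2 w ->
  (forall n, (L2normsq (w - w_ n)%R <= (1 / (2 ^ n.+1)%:R)%:E)%E) ->
  (forall n, (\int[mu]_(x in edge_dom e) (primF f (C2norm (w_ n e x)))%:E <= M)%E) ->
  (\int[mu]_(x in edge_dom e) (primF f (C2norm (w e x)))%:E <= M)%E.
Proof.
move=> w_2 w2 near_ le_M.
have mD := measurable_edge_dom e.
have d2 n : inL2 (w - w_ n).
  by rewrite addrC -scaleN1r; exact: inL2_lin.
pose S x := (\sum_(0 <= n <oo) (C2norm ((w - w_ n) e x) ^+ 2)%:E)%E.
have mS n : measurable_fun (edge_dom e) (fun x => (C2norm ((w - w_ n) e x) ^+ 2)%:E).
  by apply: measurable_sqr_C2norm; exact: inL2_measurable.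
have p0 n x : (0 <= (C2norm ((w - w_ n) e x) ^+ 2)%:E)%E by rewrite lee_fin sqr_ge0.
have intS : (\int[mu]_(x in edge_dom e) S x < +oo)%E.
  rewrite /S integral_nneseries//.
  apply: (@le_lt_trans _ _ (\sum_(0 <= n <oo) (1 / (2 ^ n.+1)%:R)%:E)%E); last first.
    by apply: le_lt_trans (epsilon_trick0 _ _) _ => //; rewrite ltry.
  apply: lee_nneseries => [n _ _|n _]; first exact: integral_ge0.
  apply: le_trans (near_ n); rewrite /L2normsq (bigD1 e)//= leeDl// sume_ge0//.
  by move=> i _; apply: integral_ge0 => x _; rewrite lee_fin sqr_ge0.
have S0 x : (0 <= S x)%E by apply: nneseries_ge0.
have mSS : measurable_fun (edge_dom e) S.
  by apply: ge0_emeasurable_sum => // k x _ _.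
have aeS_ : {ae mu, forall x, edge_dom e x -> S x \is a fin_num}.
  apply: integrable_ae => //; apply/integrableP; split => //.
  by under eq_integral do rewrite gee0_abs//.
have ptw : {ae mu, forall x, edge_dom e x ->
    limn_einf (fun n => (primF f (C2norm (w_ n e x)))%:E) = (primF f (C2norm (w e x)))%:E}.
  apply: aeS aeS_ => x h /h Sx.
  suff : (primF f (C2norm (w_ n e x)))%:E @[n --> \oo] --> (primF f (C2norm (w e x)))%:E.
    by move=> cv; rewrite (cvg_limn_einf_sup cv).
  apply: cvg_EFin; first exact: nearW.
  apply: primF_cvg => //; first by move=> n; exact: C2norm_ge0.
  apply: C2norm_cvg.
  pose a n := (C2norm ((w - w_ n) e x) ^+ 2)%:E.
  have a0 n : (0 <= a n)%E by exact: p0.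
  have Slty : (\sum_(0 <= n <oo) a n < +oo)%E by rewrite -ge0_fin_numE ?nneseries_ge0.
  have ct := @nneseries_tail_cvg _ a xpredT Slty (fun k _ => a0 k).
  have : a n @[n --> \oo] --> 0%E.
    apply: (squeeze_cvge _ (cvg_cst 0%E) ct); apply: nearW => n.
    by rewrite a0/= (nneseries_split n 1)// addn1 big_nat1 leeDl// nneseries_ge0.
  by move/fine_cvg.
have mf n : measurable_fun (edge_dom e) (fun x => (primF f (C2norm (w_ n e x)))%:E).
  by apply: measurable_modulus; [exact: primF_measurable|exact: inL2_measurable].
apply: (@le_trans _ _ (\int[mu]_(x in edge_dom e)
    limn_einf (fun n => (primF f (C2norm (w_ n e x)))%:E))%E).
  apply: ae_ge0_le_integral => //.
  - by move=> x _; rewrite lee_fin primF_ge0.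
  - by apply: measurable_modulus; [exact: primF_measurable|exact: inL2_measurable].
  - move=> x _; rewrite limn_einf_lim; apply: lime_ge; first exact: is_cvg_einfs.
    apply: nearW => n; apply: le_ereal_inf_tmp => _ [k _ <-].
    by rewrite lee_fin primF_ge0.
  - have meq x : limn_einf (fun n => (primF f (C2norm (w_ n e x)))%:E) =
        (- limn_esup (fun n => - (primF f (C2norm (w_ n e x)))%:E))%E.
      by rewrite -[X in (- X)%E]/(limn_esup (-%E \o _)) limn_esupN oppeK.
    under eq_fun do rewrite meq.
    apply: measurableT_comp => //.
    by apply: measurable_fun_limn_esup => n; apply: measurableT_comp (mf n).
  - by apply: aeS ptw => x h /h ->.
have nn n (x : R) : edge_dom e x -> (0 <= (primF f (C2norm (w_ n e x)))%:E)%E.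
  by move=> _; rewrite lee_fin primF_ge0.
have ft := fatou mu mD mf nn.
apply: (le_trans ft).
rewrite limn_einf_lim; apply: lime_le; first exact: is_cvg_einfs.
apply: nearW => n; apply: le_trans (le_M n).
by apply: ereal_inf_lbound; exists n => //=.
Qed.

End Fatou.

(** * Finite potential energy near a point of differentiability *)

Section PotentialFinite.
Variables (R : realType) (G : metric_graph R) (m c lam : R) (f : R -> R).
Hypotheses (hF1 : F1 f) (hF4 : F4 f).
Variable E : spectral_measure (@dirac_op R G m c).
Local Notation mu := (@lebesgue_measure R).
Local Notation J := (action_functional E f lam).
Implicit Types (u v w h : spinor G).

(** The derivative is a bounded linear form, so J is bounded near u. *)
Lemma frechet_derivative_bounded u L : frechet_derivative E J u L ->
  exists2 del : R, 0 < del & exists C : R, forall h,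
    inY E h -> Ynorm E h < del -> `|J (u + h)| <= C.
Proof.
case=> _ [K hK] /(_ 1 ltr01)[del del0 hdel]; exists del => //.
exists (`|J u| + `|K| * del + del) => h hY hn.
have h1 := hdel h hY hn; have h2 := hK h hY.
have n0 : 0 <= Ynorm E h by exact: sqrtr_ge0.
have h3 : K * Ynorm E h <= `|K| * del.
  apply: (@le_trans _ _ (`|K| * Ynorm E h)); first by rewrite ler_wpM2r// ler_norm.
  by rewrite ler_wpM2l// ltW.
move: h1 h2 h3 hn; move: (J (u + h)) (J u) (L h) (Ynorm E h) => a b l y h1 h2 h3 hn.
have -> : a = (a - b - l) + (b + l) by ring.
apply: le_trans (ler_normD _ _) _; rewrite mul1r in h1.
have := le_trans h1 (ltW hn); have := ler_normD b l.
by have := le_trans h2 h3; lra.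
Qed.

Lemma L2normsq_mass_le u A : measurable A -> inL2 u ->
  fine (L2normsq (spectral_proj E A u)) <= fine (L2normsq u).
Proof.
move=> mA u2; have pu := proj_L2 E mA u2.
apply: fine_le; rewrite ?L2normsq_fin_num//.
by rewrite -(mass_proj E)// -(mass_setT E)//; apply: le_measure; rewrite ?inE.
Qed.

(** Truncation does not increase the norms in Y and in L^2, which bound the
    quadratic part of the action; up to sign, the rest of the action is the
    potential energy. *)
Lemma potential_bound u n C : inY E u -> `|J (spectral_proj E `[- n, n] u)| <= C ->
  forall e, (\int[mu]_(x in edge_dom e)
    (primF f (C2norm (spectral_proj E `[(- n)%R, n] u e x)))%:E <=
    (2^-1 * Ynormsq E u + `|lam| / 2 * fine (L2normsq u) + C)%:E)%E.
Proof.
move=> uY hJ e; set w := spectral_proj _ _ _.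
have mA : measurable (`[- n, n] : set R) by [].
have [u2 _] := uY.
have w2 : inL2 w by exact: proj_L2.
have wY : inY E w by exact: inY_proj.
have [v Dv] := proj_itv_dom E n u2.
have ge0i e' : (0 <= \int[mu]_(x in edge_dom e') (primF f (C2norm (w e' x)))%:E)%E.
  by apply: integral_ge0 => x _; rewrite lee_fin primF_ge0.
have fin e' : (\int[mu]_(x in edge_dom e') (primF f (C2norm (w e' x)))%:E)%E \is a fin_num.
  by rewrite ge0_fin_numE//; exact: dirac_dom_potential Dv.
rewrite -(fineK (fin e)) lee_fin.
apply: (@le_trans _ _ (\sum_(e : edge G)
      \int[mu]_(x in edge_dom e) primF f (C2norm (w e x)))).
  rewrite (bigD1 e)//= lerDl sumr_ge0// => e' _.
  by apply: Rintegral_ge0 => x _; exact: primF_ge0.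
move: hJ; rewrite -/w /action_functional ler_norml => /andP[hJ _].
have pY : Ynormsq E (pos_part E w) <= Ynormsq E u.
  apply: (@le_trans _ _ (Ynormsq E w)); exact: Ynormsq_proj_le.
have nY := Ynormsq_ge0 E (neg_part E w).
have h2 : lam / 2 * fine (L2normsq w) <= `|lam| / 2 * fine (L2normsq u).
  apply: (@le_trans _ _ (`|lam| / 2 * fine (L2normsq w))).
    apply: ler_wpM2r; first by rewrite fine_ge0// L2normsq_ge0.
    by rewrite ler_wpM2r ?invr_ge0// ler_norm.
  apply: ler_wpM2l; first by rewrite divr_ge0.
  exact: L2normsq_mass_le.
move: (\sum_(e : edge G) _) (Ynormsq E (pos_part E w)) (Ynormsq E (neg_part E w))
  (Ynormsq E u) (lam / 2 * _) (`|lam| / 2 * _) hJ pY nY h2 => a1 a2 a3 a4 a5 a6 *.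
by lra.
Qed.

(** Truncate w = u + h at levels n_k chosen such that the tail of the mass of
    w, weighted by 1 + |t|, is at most eps_k.  This makes the truncations
    converge to w at a summable rate in L^2, and it keeps them in the ball
    around u where the action is bounded. *)
Lemma frechet_potential_finite u L : inY E u -> frechet_derivative E J u L ->
  exists2 del : R, 0 < del & forall h, inY E h -> Ynorm E h < del -> forall e,
    (\int[mu]_(x in edge_dom e) (primF f (C2norm ((u + h)%R e x)))%:E < +oo)%E.
Proof.
move=> uY /frechet_derivative_bounded[del del0 [C hC]].
exists (del / 2); first by rewrite divr_gt0.
move=> h hY hdel e; set w := u + h.
have wY : inY E w by rewrite /w -[u]scale1r; exact: inY_lin.
have [w2 wint] := wY.
have hX : Ynormsq E h < del ^+ 2 / 4.
  have : Ynorm E h ^+ 2 < (del / 2) ^+ 2.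
    by rewrite ltrXn2r ?nnegrE ?sqrtr_ge0// ltW// divr_gt0.
  rewrite sqr_sqrtr ?Ynormsq_ge0// expr_div_n => /lt_le_trans; apply.
  by rewrite (_ : 2 ^+ 2 = 4) // -natrX.
(* The weight 1 controls the L^2 norm of the tail, |t| its norm in Y. *)
pose g (t : R) : \bar R := (1 + `|t|)%:E.
have g0 t : (0 <= g t)%E by rewrite lee_fin addr_ge0.
have mg : measurable_fun setT g.
  by apply/measurable_EFinP; apply: measurable_funD => //; exact: (@normr_measurable R setT).
have gw : (\int[mass E w]_t g t < +oo)%E.
  under eq_integral do rewrite /g EFinD.
  rewrite ge0_integralD//; last exact: measurable_abs.
  rewrite integral_cst// mul1e mass_setT//; apply: lte_add_pinfty => //.
  by case: w2.
(* The tail enters with a factor 4.  The first bound keeps the truncations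
   within del of u, the second one is the summable rate. *)
pose eps k : R := Num.min (del ^+ 2 / 32) (1 / (2 ^ k.+1)%:R / 4).
have eps0 k : 0 < eps k.
  by rewrite lt_min !divr_gt0 ?exprn_gt0// ltr0n expn_gt0.
have [n_ hn] := choice (fun k => tail_integral g0 mg gw (eps0 k)).
pose w_ k := spectral_proj E `[- n_ k, n_ k] w.
pose v_ k := (-1) *: w_ k + w.
have mA k : measurable (`[- n_ k, n_ k] : set R) by [].
have w_Y k : inY E (w_ k) by exact: inY_proj.
have v_Y k : inY E (v_ k) by exact: inY_lin.
have gv k : (\int[mass E (v_ k)]_t g t <= (4 * eps k)%:E)%E.
  apply: le_trans (int_mass_compl_proj E (mA k) g0 mg w2) _.
  by rewrite EFinM; apply: lee_pmul => //; exact: integral_ge0.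
have mT (k : nat) : measurable [set: measurableTypeR R] by [].
have L2v k : (L2normsq (v_ k) <= (1 / (2 ^ k.+1)%:R)%:E)%E.
  have [v2 _] := v_Y k; rewrite -(mass_setT E)//.
  rewrite -[leLHS]mul1e -integral_cst//.
  apply: (@le_trans _ _ (4 * eps k)%:E).
    apply: le_trans (gv k); apply: ge0_le_integral => //.
    by move=> t _; rewrite /g /= lee_fin lerDl.
  by rewrite lee_fin mulrC -ler_pdivlMr// /eps ge_min lexx orbT.
have Yv k : Ynormsq E (v_ k) <= del ^+ 2 / 8.
  rewrite -lee_fin Ynormsq_EFin//; apply: (@le_trans _ _ (4 * eps k)%:E).
    apply: le_trans (gv k); apply: ge0_le_integral => //; first exact: measurable_abs.
    by move=> t _; rewrite /g lee_fin lerDr.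
  rewrite lee_fin mulrC -ler_pdivlMr// /eps ge_min; apply/orP; left; lra.
have Jb k : `|J (w_ k)| <= C.
  rewrite (_ : w_ k = u + ((-1) *: v_ k + h)); last first.
    by rewrite /v_ !scaleN1r opprD opprK /w opprD !addrA subrK addrAC subrr add0r.
  apply: hC; first exact: inY_lin.
  rewrite /Ynorm -[ltRHS](gtr0_norm del0) -sqrtr_sqr ltr_sqrt ?exprn_gt0//.
  apply: le_lt_trans (Ynormsq_lin_le (-1) (v_Y k) hY) _.
  have -> : sqr_modulus (-1 : R[i]) = 1.
    by rewrite /sqr_modulus/= sqrrN oppr0 expr1n expr0n addr0.
  by move: (Ynormsq E h) (Ynormsq E (v_ k)) (Yv k) hX (exprn_gt0 2 del0) => *; lra.
have w_2 k : inL2 (w_ k) by case: (w_Y k).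
have near k : (L2normsq (w - w_ k)%R <= (1 / (2 ^ k.+1)%:R)%:E)%E.
  by have := L2v k; rewrite /v_ scaleN1r addrC.
have lim_le := potential_fatou hF1 hF4 w_2 w2 near (fun k => potential_bound wY (Jb k) e).
exact: le_lt_trans lim_le (ltry _).
Qed.

End PotentialFinite.

(** * Transport of the variational problem *)

Section L2innerAeq.
Variables (R : realType) (G : metric_graph R).
Local Notation mu := (@lebesgue_measure R).
Implicit Types (u v w : spinor G).

Definition pairing u v (e : edge G) (x : R) : R[i] :=
  \sum_k u e x k 0 * conjc (v e x k 0).

Lemma Re_pairing u v e x : complex.Re (pairing u v e x) =
  \sum_k (complex.Re (u e x k 0) * complex.Re (v e x k 0)
          + complex.Im (u e x k 0) * complex.Im (v e x k 0)).
Proof.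
rewrite raddf_sum; apply: eq_bigr => k _.
by case: (u e x k 0) (v e x k 0) => a b [p q] /=; rewrite mulrN opprK.
Qed.

Lemma Im_pairing u v e x : complex.Im (pairing u v e x) =
  \sum_k (complex.Im (u e x k 0) * complex.Re (v e x k 0)
          - complex.Re (u e x k 0) * complex.Im (v e x k 0)).
Proof.
rewrite raddf_sum; apply: eq_bigr => k _.
by case: (u e x k 0) (v e x k 0) => a b [p q] /=; rewrite mulrN addrC.
Qed.

Lemma measurable_pairing u v e : measurable_spinor u -> measurable_spinor v ->
  measurable_fun (edge_dom e) (fun x => complex.Re (pairing u v e x)) /\
  measurable_fun (edge_dom e) (fun x => complex.Im (pairing u v e x)).
Proof.
move=> mu_ mv; split.
  under eq_fun do rewrite Re_pairing.
  apply: measurable_sum => k; have [ur ui] := mu_ e k; have [vr vi] := mv e k.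
  by apply: measurable_funD; exact: measurable_funM.
under eq_fun do rewrite Im_pairing.
apply: measurable_sum => k; have [ur ui] := mu_ e k; have [vr vi] := mv e k.
by apply: measurable_funB; exact: measurable_funM.
Qed.

Lemma L2inner_aeq u u' v v' : measurable_spinor u -> measurable_spinor u' ->
  measurable_spinor v -> measurable_spinor v' ->
  spinor_aeq u u' -> spinor_aeq v v' -> L2inner u v = L2inner u' v'.
Proof.
move=> u2 u'2 v2 v'2 uu' vv'; apply: eq_bigr => e _.
have [m1 m2] := measurable_pairing e u2 v2; have [m3 m4] := measurable_pairing e u'2 v'2.
have mD := measurable_edge_dom e.
have aep : {ae mu, forall x, edge_dom e x -> pairing u v e x = pairing u' v' e x}.
  apply: (aeS2 _ (uu' e) (vv' e)) => x h1 h2 ex.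
  by rewrite /pairing h1// h2.
rewrite /Cintegral; congr (_ +i* _); congr fine.
  apply: ae_eq_integral => //; [exact/measurable_EFinP|exact/measurable_EFinP|].
  by apply: aeS aep => x h /h; rewrite /pairing => ->.
apply: ae_eq_integral => //; [exact/measurable_EFinP|exact/measurable_EFinP|].
by apply: aeS aep => x h /h; rewrite /pairing => ->.
Qed.

(** The condition on u in [dirac_op] is the existence of a continuous
    representative. *)
Lemma dirac_op_aeq (m c : R) u u' v : inL2 u' -> spinor_aeq u u' ->
  dirac_op m c u v -> dirac_op m c u' v.
Proof.
move=> u'2 uu' [_ v2 [w [w' [uw H K vw]]]]; split=> //; exists w, w'; split => //.
exact: spinor_aeq_trans (spinor_aeq_sym uu') uw.
Qed.

End L2innerAeq.

(** What the variational problem sees of an isomorphism between two graphs.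
    Linearity is required as an equality of functions because the derivative
    of the action is evaluated at a v + w; everything else matters only up to
    null sets. *)
Record spinor_morphism (R : realType) (G1 G2 : metric_graph R) (m c : R)
    (T : spinor G1 -> spinor G2) : Prop := SpinorMorphism {
  morph_lin : forall (a : R[i]) u v, T (a *: u + v) = a *: T u + T v;
  morph_aeq : forall u v, spinor_aeq u v -> spinor_aeq (T u) (T v);
  morph_L2 : forall u, inL2 u -> inL2 (T u);
  morph_inner : forall u v, inL2 u -> inL2 v -> L2inner (T u) (T v) = L2inner u v;
  morph_modulus : forall (g : R -> R) (u : spinor G1), measurable_fun setT g -> (forall t, 0 <= g
      t) ->
    inL2 u -> modulus_integral g (T u) = modulus_integral g u;
  morph_dirac : forall u v, dirac_op m c u v -> dirac_op m c (T u) (T v) }.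

Lemma morph_L2normsq (R : realType) (G1 G2 : metric_graph R) (m c : R)
    (T : spinor G1 -> spinor G2) (mT : spinor_morphism m c T) u :
  inL2 u -> L2normsq (T u) = L2normsq u.
Proof.
have sq0 (t : R) : 0 <= t ^+ 2 by exact: sqr_ge0.
move=> u2; exact: (morph_modulus mT (@exprn_measurable R setT 2) sq0 u2).
Qed.

Section Energies.
Variables (R : realType) (G : metric_graph R).
Variables (D : spinor G -> spinor G -> Prop) (E : spectral_measure D).
Variables (f : R -> R) (lam : R).

Definition quadratic_energy (u : spinor G) : R :=
  2^-1 * (Ynormsq E (pos_part E u) - Ynormsq E (neg_part E u))
  + lam / 2 * fine (L2normsq u).

Definition potential_energy (u : spinor G) : R :=
  \sum_(e : edge G)
    \int[@lebesgue_measure R]_(x in edge_dom e) primF f (C2norm (u e x)).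

Lemma actionE u :
  action_functional E f lam u = quadratic_energy u - potential_energy u.
Proof. by []. Qed.

End Energies.

Section Transport.
Variables (R : realType) (G1 G2 : metric_graph R) (m c lam : R) (f : R -> R).
Hypotheses (hF1 : F1 f) (hF4 : F4 f).
Variables (T : spinor G1 -> spinor G2) (T' : spinor G2 -> spinor G1).
Hypotheses (mT : spinor_morphism m c T) (mT' : spinor_morphism m c T').
Hypotheses (T'K : forall u, spinor_aeq (T' (T u)) u)
           (TK : forall u, spinor_aeq (T (T' u)) u).
Variable E : spectral_measure (@dirac_op R G2 m c).
Local Notation mu := (@lebesgue_measure R).

Let proj' A u := T' (spectral_proj E A (T u)).
Let mass' u := mass E (T u).

(** The projections are conjugated by T, and the mass of u is that of T u. *)
Lemma transported_spectral_measure : {E' : spectral_measure (@dirac_op R G1 m c) |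
  spectral_proj E' = proj' /\ mass E' = mass'}.
Proof.
have L2T u : inL2 u -> inL2 (T u) := @morph_L2 _ _ _ _ _ _ mT u.
have L2T' u : inL2 u -> inL2 (T' u) := @morph_L2 _ _ _ _ _ _ mT' u.
have p_L2 A u : measurable A -> inL2 u -> inL2 (proj' A u).
  by move=> mA u2; apply: L2T'; apply: proj_L2 => //; exact: L2T.
have p_aeq A u v : measurable A -> inL2 u -> inL2 v -> spinor_aeq u v ->
    spinor_aeq (proj' A u) (proj' A v).
  move=> mA u2 v2 uv; apply: (morph_aeq mT'); apply: proj_aeq => //.
  - exact: L2T.
  - exact: L2T.
  - exact: (morph_aeq mT).
have p_lin A (a : R[i]) u v : measurable A -> inL2 u -> inL2 v ->
    spinor_aeq (proj' A (a *: u + v)) (a *: proj' A u + proj' A v).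
  move=> mA u2 v2; rewrite /proj' -(morph_lin mT') (morph_lin mT).
  by apply: (morph_aeq mT'); apply: proj_linear => //; exact: L2T.
have p_sym A u v : measurable A -> inL2 u -> inL2 v ->
    L2inner (proj' A u) v = L2inner u (proj' A v).
  move=> mA u2 v2; have Tu2 := L2T u u2; have Tv2 := L2T v v2.
  have pu := proj_L2 E mA Tu2; have pv := proj_L2 E mA Tv2.
  rewrite -(morph_inner mT (p_L2 _ _ mA u2) v2) -(morph_inner mT u2 (p_L2 _ _ mA v2)).
  transitivity (L2inner (spectral_proj E A (T u)) (T v)).
    exact: (L2inner_aeq (inL2_measurable (L2T _ (L2T' _ pu))) (inL2_measurable pu)
      (inL2_measurable Tv2) (inL2_measurable Tv2) (TK _) (spinor_aeq_refl _)).
  rewrite proj_sym//; symmetry.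
  exact: (L2inner_aeq (inL2_measurable Tu2) (inL2_measurable Tu2)
    (inL2_measurable (L2T _ (L2T' _ pv))) (inL2_measurable pv)
    (spinor_aeq_refl _) (TK _)).
have p_setT u : inL2 u -> spinor_aeq (proj' setT u) u.
  move=> u2; apply: spinor_aeq_trans (T'K u); apply: (morph_aeq mT').
  by apply: proj_setT; exact: L2T.
have p_setI A B u : measurable A -> measurable B -> inL2 u ->
    spinor_aeq (proj' (A `&` B) u) (proj' A (proj' B u)).
  move=> mA mB u2; apply: (morph_aeq mT').
  have Tu2 := L2T u u2; have pu := proj_L2 E mB Tu2.
  apply: spinor_aeq_trans (proj_setI E mA mB Tu2) _.
  exact: (proj_aeq E mA pu (L2T _ (L2T' _ pu)) (spinor_aeq_sym (TK _))).
have m_proj A u : measurable A -> inL2 u -> mass' u A = L2normsq (proj' A u).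
  move=> mA u2; have Tu2 := L2T u u2; rewrite /mass' /proj' (mass_proj E mA Tu2).
  by rewrite (morph_L2normsq mT' (proj_L2 E mA Tu2)).
have s_dom u : inL2 u -> (exists v, dirac_op m c u v) <->
    (\int[mass' u]_t (t ^+ 2)%:E < +oo)%E.
  move=> u2; have Tu2 := L2T u u2; rewrite -(spectral_dom E Tu2); split=> -[v Dv].
    by exists (T v); exact: (morph_dirac mT).
  exists (T' v); apply: dirac_op_aeq (morph_dirac mT' Dv) => //; exact: T'K.
have s_act u v : dirac_op m c u v -> L2inner v u = (\int[mass' u]_t (t : R))%:C.
  move=> Duv; have [u2 v2 _] := Duv; rewrite -(morph_inner mT v2 u2).
  by apply: spectral_action; exact: (morph_dirac mT).
by exists (SpectralMeasure p_L2 p_aeq p_lin p_sym p_setT p_setI m_proj s_dom s_act).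
Qed.

Lemma morph_add u v : T (u + v) = T u + T v.
Proof. by rewrite -[u in LHS]scale1r (morph_lin mT) scale1r. Qed.

Lemma action_aeq (G : metric_graph R) (F : spectral_measure (@dirac_op R G m c)) u v :
  inL2 u -> inL2 v -> spinor_aeq u v ->
  action_functional F f lam u = action_functional F f lam v.
Proof.
move=> u2 v2 uv.
have mA1 : measurable (`]0, +oo[ : set R) by [].
have mA2 : measurable (`]-oo, 0[ : set R) by [].
have Y A : measurable A -> Ynormsq F (spectral_proj F A u) = Ynormsq F (spectral_proj F A v).
  move=> mA; congr fine; apply: eq_measure_integral => B mB _.
  exact: (mass_aeq F mB (proj_L2 F mA u2) (proj_L2 F mA v2) (proj_aeq F mA u2 v2 uv)).
have P : \sum_(e : edge G) \int[mu]_(x in edge_dom e) primF f (C2norm (u e x)) =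
    \sum_(e : edge G) \int[mu]_(x in edge_dom e) primF f (C2norm (v e x)).
  apply: eq_bigr => e _.
  exact: (congr1 fine (modulus_integral_aeq (primF_measurable hF1 hF4) (primF_ge0 hF1)
    (inL2_measurable u2) (inL2_measurable v2) uv e)).
rewrite !actionE /quadratic_energy /pos_part /neg_part (Y _ mA1) (Y _ mA2).
by rewrite (L2normsq_aeq u2 v2 uv) (P : potential_energy f u = potential_energy f v).
Qed.

(** Here finiteness enters: a divergent integral would contribute 0 to the
    left side. *)
Lemma potential_energyE (G : metric_graph R) (u : spinor G) :
  (forall e, (\int[mu]_(x in edge_dom e) (primF f (C2norm (u e x)))%:E < +oo)%E) ->
  potential_energy f u = fine (modulus_integral (primF f) u).
Proof.
move=> h; rewrite /potential_energy /modulus_integral -sum_fine//= => e _.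
rewrite ge0_fin_numE//; apply: integral_ge0 => x _.
by rewrite lee_fin primF_ge0.
Qed.

Variable E' : spectral_measure (@dirac_op R G1 m c).
Hypotheses (E'proj : spectral_proj E' = proj') (E'mass : mass E' = mass').

(** Finiteness of the integrals on one side gives it on the other, as T
    preserves their extended sum; then both potential energies are the real
    value of that sum. *)
Lemma transported_action u : inL2 u ->
  (forall e, (\int[mu]_(x in edge_dom e) (primF f (C2norm (T u e x)))%:E < +oo)%E) ->
  action_functional E' f lam u = action_functional E f lam (T u).
Proof.
move=> u2 fin2; have Tu2 := morph_L2 mT u2.
have mA1 : measurable (`]0, +oo[ : set R) by [].
have mA2 : measurable (`]-oo, 0[ : set R) by [].
have Y A : measurable A ->
    Ynormsq E' (spectral_proj E' A u) = Ynormsq E (spectral_proj E A (T u)).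
  move=> mA; have pu := proj_L2 E mA Tu2.
  rewrite /Ynormsq E'mass E'proj /mass' /proj'; congr fine.
  apply: eq_measure_integral => B mB _.
  exact: (mass_aeq E mB (morph_L2 mT (morph_L2 mT' pu)) pu (TK _)).
have FT := morph_modulus mT (primF_measurable hF1 hF4) (primF_ge0 hF1) u2.
have fin1 e : (\int[mu]_(x in edge_dom e) (primF f (C2norm (u e x)))%:E < +oo)%E.
  apply: (@le_lt_trans _ _ (modulus_integral (primF f) u)).
    rewrite /modulus_integral (bigD1 e)//= leeDl// sume_ge0// => i _.
    by apply: integral_ge0 => x _; rewrite lee_fin primF_ge0.
  rewrite -FT; apply: lte_sum_pinfty => e' _; exact: fin2.
rewrite !actionE /quadratic_energy /pos_part /neg_part (Y _ mA1) (Y _ mA2).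
by rewrite (morph_L2normsq mT u2) (potential_energyE fin2) (potential_energyE fin1) FT.
Qed.

End Transport.

Section NullSpinors.
Variables (R : realType) (G : metric_graph R).
Variables (D : spinor G -> spinor G -> Prop) (E : spectral_measure D).

Lemma spinor_aeq_add (u u' v v' : spinor G) :
  spinor_aeq u u' -> spinor_aeq v v' -> spinor_aeq (u + v) (u' + v').
Proof.
by move=> h1 h2; have := @spinor_aeq_lin _ _ 1 _ _ _ _ h1 h2; rewrite !scale1r.
Qed.

Lemma inL2_zero : inL2 (0 : spinor G).
Proof.
split=> [e k|]; last first.
  rewrite /L2normsq big1 ?ltry// => e _; apply: integral0_eq => x _.
  by rewrite C2norm0 expr0n.
by split; (rewrite [X in measurable_fun _ X](_ : _ = cst 0);
  last by apply/funext => x; rewrite mxE).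
Qed.

(** A derivative of the action is only known to be linear and bounded for the
    norm of Y; this shows that it does not distinguish spinors that agree
    almost everywhere. *)
Lemma Ynorm_null (u : spinor G) : inL2 u -> spinor_aeq u 0 ->
  (\int[mass E u]_t (`|t|)%:E = 0)%E /\ Ynorm E u = 0.
Proof.
move=> u2 uz; have m0 : mass E u setT = 0%E.
  rewrite (mass_setT E)// (L2normsq_aeq u2 inL2_zero uz).
  apply: big1 => e _; apply: integral0_eq => x _.
  by rewrite C2norm0 expr0n.
have i0 : (\int[mass E u]_t (`|t|)%:E = 0)%E.
  by apply: null_set_integral => //; exact: measurable_abs.
by split=> //; rewrite /Ynorm /Ynormsq /Rintegral i0/= sqrtr0.
Qed.

End NullSpinors.

Section NehariTransport.
Variables (R : realType) (G1 G2 : metric_graph R) (m c lam : R) (f : R -> R).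
Hypotheses (hF1 : F1 f) (hF4 : F4 f).
Variables (T : spinor G1 -> spinor G2) (T' : spinor G2 -> spinor G1).
Hypotheses (mT : spinor_morphism m c T) (mT' : spinor_morphism m c T').
Hypotheses (T'K : forall u, spinor_aeq (T' (T u)) u)
           (TK : forall u, spinor_aeq (T (T' u)) u).
Local Notation mu := (@lebesgue_measure R).

(** The derivative at T' u is L o T.  Differentiability only concerns small h,
    and for these [frechet_potential_finite] makes the two actions agree. *)
Lemma nehari_transport (E : spectral_measure (@dirac_op R G2 m c)) u :
  nehari E f lam u -> exists (E' : spectral_measure (@dirac_op R G1 m c)) u',
    nehari E' f lam u' /\ action_functional E f lam u = action_functional E' f lam u'.
Proof.
move=> [uY nuY [L [frL Lu0 Leta0]]]; have [u2 _] := uY.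
have [E' [E'proj E'mass]] := transported_spectral_measure mT mT' T'K TK E.
have T'u2 := morph_L2 mT' u2; have TT'u2 := morph_L2 mT T'u2.
have YE h : inY E' h -> inY E (T h).
  by case=> h2; rewrite E'mass => hf; split=> //; exact: (morph_L2 mT h2).
have YnE h : Ynorm E' h = Ynorm E (T h) by rewrite /Ynorm /Ynormsq E'mass.
have mE B : measurable B -> mass E (T (T' u)) B = mass E u B.
  by move=> mB; exact: (mass_aeq E mB TT'u2 u2 (TK u)).
have TT'uY : inY E (T (T' u)).
  split=> //; case: uY => _; congr (_ < _)%E; apply: eq_measure_integral => B mB _.
  by rewrite mE.
have T'uY : inY E' (T' u).
  by split=> //; rewrite E'mass; case: TT'uY.
have [del0 del00 fin0] := frechet_potential_finite hF1 hF4 uY frL.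
have act h : inY E' h -> Ynorm E' h < del0 ->
    action_functional E' f lam (T' u + h) = action_functional E f lam (u + T h).
  move=> hY hn; have ThY := YE h hY; have [h2 _] := hY; have [Th2 _] := ThY.
  have s2 : inL2 (T' u + h) by rewrite -[T' u]scale1r; exact: inL2_lin.
  have Ts2 := morph_L2 mT s2.
  have us2 : inL2 (u + T h) by rewrite -[u]scale1r; exact: inL2_lin.
  have aeqs : spinor_aeq (T (T' u + h)) (u + T h).
    rewrite (morph_add mT).
    exact: (spinor_aeq_add (TK u) (spinor_aeq_refl (T h))).
  rewrite (transported_action lam hF1 hF4 mT mT' TK E'proj E'mass s2); last first.
    move=> e; rewrite (modulus_integral_aeq (primF_measurable hF1 hF4) (primF_ge0 hF1)
      (inL2_measurable Ts2) (inL2_measurable us2) aeqs).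
    by apply: fin0 => //; rewrite -YnE.
  exact: (@action_aeq R m c lam f hF1 hF4 G2 E _ _ Ts2 us2 aeqs).
have T0 : T 0 = 0.
  have := morph_add mT 0 0; rewrite addr0 => /eqP.
  by rewrite -subr_eq0 opprD addrA subrr sub0r oppr_eq0 => /eqP.
have [i0 Yn0] := Ynorm_null E' (inL2_zero G1) (spinor_aeq_refl 0).
have Y'0 : inY E' 0.
  by split; [exact: inL2_zero|rewrite i0].
have act0 : action_functional E' f lam (T' u) = action_functional E f lam u.
  by have := act 0 Y'0; rewrite Yn0 T0 !addr0 => ->.
exists E', (T' u); split; last by [].
split.
- exact: T'uY.
- move=> [_ ng]; apply: nuY; split=> //.
  have mA2 : measurable (`]-oo, 0[ : set R) by [].
  have := morph_aeq mT ng; rewrite /neg_part E'proj => h.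
  apply: spinor_aeq_trans (TK u); apply: spinor_aeq_trans h.
  apply: spinor_aeq_trans (spinor_aeq_sym (TK _)).
  exact: (proj_aeq E mA2 u2 TT'u2 (spinor_aeq_sym (TK u))).
exists (L \o T); case: (frL) => Llin [K hK] Ld; split.
- split.
  + move=> a v w vY wY /=; rewrite (morph_lin mT).
    by apply: Llin; exact: YE.
  + exists K => v vY /=; rewrite YnE.
    by apply: hK; exact: YE.
  + move=> eps eps0; have [del del_gt0 hdel] := Ld eps eps0.
    exists (Num.min del del0); first by rewrite lt_min del_gt0.
    move=> h hY; rewrite lt_min => /andP[h1 h2].
    rewrite (act h hY h2) act0 YnE /comp.
    by apply: hdel; [exact: YE|rewrite -YnE].
- rewrite /comp.
  (* L vanishes at u, and the null spinor d has norm 0 in Y. *)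
  set d := (-1) *: T (T' u) + u.
  have dY : inY E d by exact: inY_lin.
  have [d2 _] := dY.
  have dz : spinor_aeq d 0.
    rewrite (_ : 0 = (-1) *: u + u); last by rewrite scaleN1r addNr.
    exact: (@spinor_aeq_lin _ _ (-1) _ _ _ _ (TK u) (spinor_aeq_refl u)).
  have [_ dn] := Ynorm_null E d2 dz.
  have Ld0 : L d = 0.
    by apply/eqP; rewrite -normr_le0; have := hK d dY; rewrite dn mulr0.
  have := Llin (-1) (T (T' u)) u TT'uY uY.
  rewrite (_ : (-1)%:C = -1) -/d ?Ld0 ?Lu0 ?addr0; last by rewrite rmorphN1.
  by move/eqP; rewrite mulN1r eq_sym oppr_eq0 => /eqP.
- move=> eta [etaY etan]; rewrite /comp; apply: Leta0; split; first exact: YE.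
  have [eta2 _] := etaY.
  apply: spinor_aeq_trans (morph_aeq mT etan).
  by rewrite /neg_part E'proj; apply: spinor_aeq_sym; exact: TK.
Qed.

End NehariTransport.

Lemma ground_level_iso (R : realType) (G1 G2 : metric_graph R) (m c lam : R) (f : R -> R)
    (T : spinor G1 -> spinor G2) (T' : spinor G2 -> spinor G1) :
  F1 f -> F4 f -> spinor_morphism m c T -> spinor_morphism m c T' ->
  (forall u, spinor_aeq (T' (T u)) u) -> (forall u, spinor_aeq (T (T' u)) u) ->
  ground_level m c f G1 lam = ground_level m c f G2 lam.
Proof.
move=> hF1 hF4 mT mT' T'K TK; congr ereal_inf; apply/seteqP; split=> y [E [u [Nu ->]]].
  have [E' [u' [Nu' ->]]] := nehari_transport hF1 hF4 mT' mT TK T'K Nu.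
  by exists E', u'.
have [E' [u' [Nu' ->]]] := nehari_transport hF1 hF4 mT mT' T'K TK Nu.
by exists E', u'.
Qed.

(** * Affine coordinates and reflected spinors *)

Section AffineChange.
Variables (R : realType) (r : bool) (tau : R).
Local Notation mu := (@lebesgue_measure R).

Definition sgn : R := (-1) ^+ r.
(** A coordinate of the line in terms of the arclength of an edge; r tells
    whether the edge is reflected. *)
Definition aff (x : R) : R := sgn * x + tau.
Definition affinv (y : R) : R := sgn * (y - tau).

Lemma sgn_sqr : sgn * sgn = 1. Proof. by rewrite -expr2 sqrr_sign. Qed.

Lemma affK : cancel aff affinv.
Proof. by move=> x; rewrite /affinv addrK mulrA sgn_sqr mul1r. Qed.

Lemma affinvK : cancel affinv aff.
Proof. by move=> x; rewrite /aff /affinv mulrA sgn_sqr mul1r subrK. Qed.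

Lemma aff_measurable (D : set R) : measurable_fun D aff.
Proof.
apply: measurable_funTS; apply: continuous_measurable_fun => x.
apply: cvgD; last exact: cvg_cst.
by apply: cvgM; [exact: cvg_cst|exact: cvg_id].
Qed.

Lemma affinv_measurable (D : set R) : measurable_fun D affinv.
Proof.
apply: measurable_funTS; apply: continuous_measurable_fun => x.
apply: cvgM; first exact: cvg_cst.
by apply: cvgB; [exact: cvg_id|exact: cvg_cst].
Qed.

(** The Lebesgue measure is determined by the intervals ]a, b], and the
    preimage of such an interval is an interval of the same length. *)
Lemma aff_lebesgue (A : set R) : measurable A -> mu (aff @^-1` A) = mu A.
Proof.
move=> mA; symmetry.
have mphi : measurable_fun (setT : set (measurableTypeR R)) (aff : measurableTypeR R ->
    measurableTypeR R).
  exact: aff_measurable.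
pose nu := pushforward mu (aff : measurableTypeR R -> measurableTypeR R).
have h : forall X, ocitv X -> mu X = nu X.
  move=> X [[a b] /= _ <-]; rewrite /nu /pushforward.
  have [rT|rF] := boolP r.
    have -> : aff @^-1` `]a, b] = `[tau - b, tau - a[%classic.
      apply/seteqP; split=> x /=; rewrite !in_itv/= /aff /sgn rT expr1 => /andP[h1 h2];
      by apply/andP; split; lra.
    rewrite /= !lebesgue_measure_itv/= !lte_fin ltrD2l ltrN2.
    by case: ifP => // _; rewrite -!EFinB; congr EFin; ring.
  have -> : aff @^-1` `]a, b] = `]a - tau, b - tau]%classic.
    apply/seteqP; split=> x /=; rewrite !in_itv/= /aff /sgn (negbTE rF) expr0 => /andP[h1 h2];
    by apply/andP; split; lra.
  rewrite /= !lebesgue_measure_itv/= !lte_fin ltrD2r.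
  by case: ifP => // _; rewrite -!EFinB; congr EFin; ring.
exact: (@lebesgue_measure_unique R nu h A mA).
Qed.

Lemma measurable_aff_preimage (A : set R) : measurable A -> measurable (aff @^-1` A).
Proof.
by move=> mA; rewrite -[X in measurable X]setTI; exact: (aff_measurable measurableT mA).
Qed.

Lemma ge0_integral_aff (A : set R) (h : R -> \bar R) : measurable A ->
  measurable_fun A h -> (forall y, A y -> (0 <= h y)%E) ->
  (\int[mu]_(x in aff @^-1` A) h (aff x) = \int[mu]_(y in A) h y)%E.
Proof.
move=> mA mh h0.
have mphi : measurable_fun (setT : set (measurableTypeR R)) (aff : measurableTypeR R ->
    measurableTypeR R).
  exact: aff_measurable.
have := ge0_integral_pushforward mphi mu mA mh.
rewrite /comp => <-; last by move=> y; rewrite inE; exact: h0.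
apply: eq_measure_integral => B mB _.
exact: (aff_lebesgue mB).
Qed.

Lemma integral_aff (A : set R) (h : R -> \bar R) : measurable A ->
  measurable_fun A h ->
  (\int[mu]_(x in aff @^-1` A) h (aff x) = \int[mu]_(y in A) h y)%E.
Proof.
move=> mA mh; rewrite integralE [RHS]integralE; congr (_ - _)%E.
  rewrite -[RHS]ge0_integral_aff//; last exact: measurable_funepos.
  by apply: eq_integral => x _; rewrite !funeposE.
rewrite -[RHS]ge0_integral_aff//; last exact: measurable_funeneg.
by apply: eq_integral => x _; rewrite !funenegE.
Qed.

Lemma ae_aff (P : R -> Prop) :
  {ae mu, forall y, P y} -> {ae mu, forall x, P (aff x)}.
Proof.
move=> [N [mN N0 hN]]; exists (aff @^-1` N); split.
- exact: measurable_aff_preimage.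
- by rewrite aff_lebesgue.
- by move=> x nPx; apply: hN.
Qed.

Lemma ae_affinv (P : R -> Prop) :
  {ae mu, forall x, P x} -> {ae mu, forall y, P (affinv y)}.
Proof.
move=> [N [mN N0 hN]]; have mM : measurable (affinv @^-1` N).
  by rewrite -[X in measurable X]setTI; exact: (affinv_measurable measurableT mN).
exists (affinv @^-1` N); split => //.
- rewrite -aff_lebesgue// [X in mu X](_ : _ = N)//.
  by apply/seteqP; split=> x /=; rewrite affK.
- by move=> x nPx; apply: hN.
Qed.

Lemma aff_preimage_itv x y :
  let a := if r then aff y else aff x in let b := if r then aff x else aff y in
  `[x, y]%classic = aff @^-1` `[a, b].
Proof.
move=> a b; rewrite /a /b /aff /sgn; apply/seteqP.
by case: r; rewrite ?expr1 ?expr0; split=> s /=; rewrite !in_itv/= => /andP[h1 h2];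
  apply/andP; split; lra.
Qed.

Lemma Rintegral_aff_itv (h : R -> R) (x y : R) :
  let a := if r then aff y else aff x in let b := if r then aff x else aff y in
  measurable_fun `[a, b] h ->
  \int[mu]_(s in `[x, y]) h (aff s) = \int[mu]_(t in `[a, b]) h t.
Proof.
move=> a b mh; rewrite /Rintegral; congr fine.
rewrite -[RHS](@integral_aff `[a, b] (EFin \o h))//; last exact/measurable_EFinP.
by rewrite (aff_preimage_itv x y).
Qed.

End AffineChange.

Section Flip.
Variable R : realType.
Implicit Types (z y : 'cV[R[i]]_2).

(** The matrix flip 1 true is diag(1, -1), and flip 0 true is diag(-1, 1) = -
    flip 1 true; flip j false is the identity.  Spinors transform by flip 1,
    and their derivatives by flip 0 because a reflection also changes the sign
    of the derivative. *)
Definition flip_sign (r : bool) (j k : 'I_2) : R[i] := (-1) ^+ (r && (k == j)).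
Definition flip (j : 'I_2) (r : bool) z : 'cV[R[i]]_2 :=
  \col_k (flip_sign r j k * z k 0).

Lemma flipE j r z k : flip j r z k 0 = flip_sign r j k * z k 0.
Proof. by rewrite mxE. Qed.

Lemma flip_sign_sqr r j k : flip_sign r j k * flip_sign r j k = 1.
Proof. by rewrite -expr2 sqrr_sign. Qed.

Lemma flipK j r : involutive (flip j r).
Proof.
move=> z; apply/matrixP => k l; rewrite [l]ord1 !flipE mulrA flip_sign_sqr.
by rewrite mul1r.
Qed.

Lemma flip_lin j r (a : R[i]) z y : flip j r (a *: z + y) = a *: flip j r z + flip j r y.
Proof.
apply/matrixP => k l; rewrite !mxE; ring.
Qed.

Lemma Re_flip j r z k : complex.Re (flip j r z k 0) = (-1) ^+ (r && (k == j)) * complex.Re (z k 0).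
Proof.
rewrite flipE /flip_sign; case: (r && _); case: (z k 0) => a b; rewrite ?expr1 ?expr0.
  by rewrite !mulN1r.
by rewrite !mul1r.
Qed.

Lemma Im_flip j r z k : complex.Im (flip j r z k 0) = (-1) ^+ (r && (k == j)) * complex.Im (z k 0).
Proof.
rewrite flipE /flip_sign; case: (r && _); case: (z k 0) => a b; rewrite ?expr1 ?expr0.
  by rewrite !mulN1r.
by rewrite !mul1r.
Qed.

Lemma C2norm_flip j r z : C2norm (flip j r z) = C2norm z.
Proof.
rewrite /C2norm; congr Num.sqrt; apply: eq_bigr => k _.
by rewrite !normc_sqr Re_flip Im_flip !exprMn !sqrr_sign !mul1r.
Qed.

Lemma flip_pairing j r z y :
  \sum_k flip j r z k 0 * conjc (flip j r y k 0) = \sum_k z k 0 * conjc (y k 0).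
Proof.
apply: eq_bigr => k _; rewrite !flipE /flip_sign; case: (r && _); rewrite ?expr0 ?mul1r//.
by rewrite expr1 !mulN1r rmorphN mulrNN.
Qed.

(** The matrix sigma_1 exchanges the two components and so turns flip 0 into
    flip 1, while sigma_3 is diagonal and commutes with flip 1. *)
Lemma flip_dirac (p q : R[i]) r z y :
  flip 1 r (p *: (pauli1 R *m z) + q *: (pauli3 R *m y)) =
  p *: (pauli1 R *m flip 0 r z) + q *: (pauli3 R *m flip 1 r y).
Proof.
apply/matrixP => k l; rewrite [l]ord1 flipE !mxE !big_ord_recl !big_ord0 !mxE.
rewrite /flip_sign; case: r; case: k => [[|[|//]] ik] /=;
  rewrite ?expr0 ?expr1 ?mul1r ?mul0r ?addr0 ?add0r ?mulN1r; ring.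
Qed.

End Flip.

(** * A graph laid out along the line *)

Lemma ae_forall_fin (R : realType) (I : finType) (P : I -> R -> Prop) :
  (forall i, {ae @lebesgue_measure R, forall x, P i x}) ->
  {ae @lebesgue_measure R, forall x, forall i, P i x}.
Proof.
move=> h; have : {ae @lebesgue_measure R, forall x, forall i, i \in enum I -> P i x}.
  elim: (enum I) => [|i s IH]; first exact: aeW.
  apply: (aeS2 _ (h i) IH) => x Pi Ps k; rewrite inE => /orP[/eqP->//|]; exact: Ps.
by apply: aeS => x hx i; apply: hx; rewrite mem_enum.
Qed.

(** A placement of the edges along the line: the edge of rank k occupies the
    interval from cut k to cut k.+1, read backwards when rev holds.  At each
    finite cut the two neighbouring edges share a vertex to which no other
    edge is attached, and every vertex is of this kind. *)
Record line_layout (R : realType) (G : metric_graph R) := LineLayout {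
  pieces : nat;
  cut : nat -> \bar R;
  rank : edge G -> nat;
  rev : edge G -> bool;
  shift : edge G -> R;
  cut_first : cut 0 = -oo%E;
  cut_last : cut pieces = +oo%E;
  cut_lt : forall k, (k < pieces)%N -> (cut k < cut k.+1)%E;
  rank_lt : forall e, (rank e < pieces)%N;
  rank_inj : injective rank;
  rank_surj : forall k, (k < pieces)%N -> exists e, rank e = k;
  dom_layout : forall e x, edge_dom e x <->
    (cut (rank e) <= (aff (rev e) (shift e) x)%:E)%E /\
    ((aff (rev e) (shift e) x)%:E <= cut (rank e).+1)%E;
  junction : forall e e', rank e' = (rank e).+1 -> exists v t,
    [/\ ends_at v = [set (e, ~~ rev e); (e', rev e')]%SET, cut (rank e') = t%:E,
       aff (rev e) (shift e) (end_coord (e, ~~ rev e)) = t &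
       aff (rev e') (shift e') (end_coord (e', rev e')) = t];
  vertex_junction : forall v, exists e e', rank e' = (rank e).+1 /\
    ends_at v = [set (e, ~~ rev e); (e', rev e')]%SET }.

Section Layout.
Variables (R : realType) (G : metric_graph R) (L : line_layout G).
Local Notation mu := (@lebesgue_measure R).
Local Notation B := (cut L).
Local Notation ix := (rank L).
Local Notation rev := (rev L).
Local Notation phi e := (aff (rev e) (shift L e)).
Local Notation psi e := (affinv (rev e) (shift L e)).

(** Half-open, so that the slots of the edges form a partition of the line. *)
Definition slot (e : edge G) : set R :=
  [set y | (B (ix e) < y%:E)%E /\ (y%:E <= B (ix e).+1)%E].

Lemma cut_mono i j : (i <= j <= pieces L)%N -> (B i <= B j)%E.
Proof.
move=> /andP[ij jn]; elim: j ij jn => [|j IH]; first by rewrite leqn0 => /eqP->.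
rewrite leq_eqVlt => /predU1P[->//|ij] jn.
by apply: le_trans (ltW (cut_lt jn)); apply: IH => //; exact: ltnW.
Qed.

Lemma slot_ex y : exists e, slot e y.
Proof.
have ex : exists k, (y%:E <= B k)%E by exists (pieces L); rewrite cut_last leey.
case: (ex_minnP ex) => -[|k]; first by rewrite cut_first leeNy_eq.
move=> yk min; have kn : (k < pieces L)%N by apply: min; rewrite cut_last leey.
have [e ek] := rank_surj kn; exists e; rewrite /slot /= ek; split=> //.
by rewrite ltNge; apply/negP => /min; rewrite ltnn.
Qed.

Lemma slot_inj e e' y : slot e y -> slot e' y -> e = e'.
Proof.
move=> [l1 u1] [l2 u2]; apply: (@rank_inj _ _ L).
case: (ltngtP (ix e) (ix e')) => // h.
  have := lt_le_trans l2 u1; rewrite ltNge cut_mono//.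
  by rewrite h (ltnW (rank_lt L _)).
have := lt_le_trans l1 u2; rewrite ltNge cut_mono//.
by rewrite h (ltnW (rank_lt L _)).
Qed.

(** The edge on which a point of the line lies; at a cut, the edge on the
    left. *)
Definition loc y : edge G := projT1 (cid (slot_ex y)).

Lemma locP y : slot (loc y) y. Proof. exact: (projT2 (cid (slot_ex y))). Qed.

Lemma locE e y : slot e y -> loc y = e.
Proof. by move=> h; exact: slot_inj (locP y) h. Qed.

Lemma measurable_slot e : measurable (slot e).
Proof.
rewrite [slot e](_ : _ = EFin @^-1` [set` `]B (ix e), B (ix e).+1]]).
  rewrite -[X in measurable X]setTI; apply: (@EFin_measurable R setT) => //.
  exact: emeasurable_itv.
by apply/seteqP; split=> x /=; rewrite in_itv/=; [case=> -> ->|case/andP].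
Qed.

Lemma slot_dom e y : slot e y -> edge_dom e (psi e y).
Proof. by case=> h1 h2; apply/(dom_layout L); rewrite affinvK; split=> //; exact: ltW. Qed.

Lemma bigsetU_slot : \big[setU/set0]_(e <- enum (edge G)) slot e = setT.
Proof.
apply/seteqP; split=> // y _.
rewrite (bigD1_seq (loc y)) /= ?mem_enum ?enum_uniq//.
by left; exact: locP.
Qed.

Lemma integral_slots (h : R -> R) : measurable_fun setT h ->
  (\int[mu]_y (h y)%:E = \sum_(e : edge G) \int[mu]_(y in slot e) (h y)%:E)%E.
Proof.
move=> mh; rewrite -bigsetU_slot integral_bigsetU_EFin//.
- by rewrite big_enum.
- exact: measurable_slot.
- exact: enum_uniq.
- move=> e e' _ _ [y [h1 h2]]; exact: slot_inj h1 h2.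
- by rewrite bigsetU_slot; exact/measurable_EFinP.
Qed.

(** The slot misses at most the left endpoint. *)
Lemma edge_dom_slot e : exists2 N : set R, measurable N /\ mu N = 0%E &
  edge_dom e = (phi e @^-1` slot e) `|` N /\ [disjoint (phi e @^-1` slot e) & N].
Proof.
exists (edge_dom e `&` phi e @^-1` [set y | y%:E = B (ix e)]).
  have sub : edge_dom e `&` phi e @^-1` [set y | y%:E = B (ix e)] `<=`
     [set psi e (fine (B (ix e)))].
    by move=> x [_ /= <-]; rewrite /= affK.
  have [->|->] := subset_set1 sub; first by split=> //; exact: measure0.
  by split=> //; exact: lebesgue_measure_set1.
split.
  apply/seteqP; split=> [x ex|x [h|[]//]].
    have /(dom_layout L)[h1 h2] := ex.
    move: (h1); rewrite le_eqVlt => /predU1P[eqB|lt]; last by left.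
    by right; split.
  by apply/(dom_layout L); case: h => h1 h2; split=> //; exact: ltW.
apply/disj_setPS => x [[h _] [_ /= hB]].
by move: h; rewrite /= hB ltxx.
Qed.

Lemma integral_edge (h : R -> \bar R) e : measurable_fun setT h ->
  (\int[mu]_(x in edge_dom e) h (phi e x) = \int[mu]_(y in slot e) h y)%E.
Proof.
move=> mh; have [N [mN N0] [-> dis]] := edge_dom_slot e.
have mS := measurable_aff_preimage (rev e) (shift L e) (measurable_slot e).
have mhp (A : set R) : measurable_fun A (fun x => h (phi e x)).
  exact: (measurableT_comp mh (@aff_measurable R (rev e) (shift L e) A)).
rewrite integral_setU//; last exact: mhp.
rewrite [X in (_ + X)%E]null_set_integral//; last exact: mhp.
rewrite adde0 integral_aff//.
- exact: measurable_slot.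
- exact: measurable_funTS.
Qed.

(** The line is the disjoint union of the slots, and each slot is the image of
    an edge up to a null set. *)
Lemma integral_line (h : R -> R) : measurable_fun setT h ->
  (\int[mu]_y (h y)%:E = \sum_(e : edge G) \int[mu]_(x in edge_dom e) (h (phi e x))%:E)%E.
Proof.
move=> mh; rewrite integral_slots//; apply: eq_bigr => e _.
by rewrite (@integral_edge (EFin \o h))//; exact/measurable_EFinP.
Qed.

Lemma Rintegral_line (h : R -> R) : mu.-integrable setT (EFin \o h) ->
  \int[mu]_y h y = \sum_(e : edge G) \int[mu]_(x in edge_dom e) h (phi e x).
Proof.
move=> /integrableP[/measurable_EFinP mh ih].
rewrite /Rintegral integral_line// sum_fine// => e _.
have mab : measurable_fun setT (fun y => `|h y|) by exact: measurableT_comp.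
have fin : (\int[mu]_(x in edge_dom e) `|(h (phi e x))%:E| < +oo)%E.
  apply: le_lt_trans ih; rewrite [leRHS](integral_line mab) (bigD1 e)//= leeDl//.
  by apply: sume_ge0 => i _; apply: integral_ge0.
rewrite -integral_fin_num_abs//; first exact: measurable_edge_dom.
exact: (measurableT_comp mh (@aff_measurable R (rev e) (shift L e) _)).
Qed.

Lemma edge_dom_line (e : edge (line R)) : edge_dom e = setT.
Proof. by apply/seteqP; split=> // x _; split; rewrite /= ?leNye ?leey. Qed.

(** The index j selects the transformation rule: 1 for spinors, 0 for
    derivatives. *)
Definition to_graph (j : 'I_2) (u : spinor (line R)) : spinor G :=
  fun e x => flip j (rev e) (u tt (phi e x)).

Definition to_line (j : 'I_2) (w : spinor G) : spinor (line R) :=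
  fun _ y => flip j (rev (loc y)) (w (loc y) (psi (loc y) y)).

(** An equality everywhere, whereas [to_lineK] only holds almost everywhere:
    at a vertex a spinor on the graph may take several values. *)
Lemma to_graphK j u : to_line j (to_graph j u) = u.
Proof. by apply/funext => -[]; apply/funext => y; rewrite /to_line /to_graph flipK affinvK. Qed.

Lemma to_graph_lin j (a : R[i]) u v :
  to_graph j (a *: u + v) = a *: to_graph j u + to_graph j v.
Proof. by apply/funext => e; apply/funext => x; rewrite /to_graph !fctE flip_lin. Qed.

Lemma to_line_lin j (a : R[i]) u v :
  to_line j (a *: u + v) = a *: to_line j u + to_line j v.
Proof. by apply/funext => e; apply/funext => x; rewrite /to_line !fctE flip_lin. Qed.

Lemma to_graph_aeq j u v : spinor_aeq u v -> spinor_aeq (to_graph j u) (to_graph j v).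
Proof.
move=> uv e; apply: aeS (ae_aff (rev e) (shift L e) (uv tt)) => x h _.
by rewrite /to_graph h// edge_dom_line.
Qed.

Lemma to_line_aeq j u v : spinor_aeq u v -> spinor_aeq (to_line j u) (to_line j v).
Proof.
move=> uv []; have : {ae mu, forall y, forall e, edge_dom e (psi e y) -> u e (psi e y) = v e (psi
    e y)}.
  by apply: ae_forall_fin => e; exact: (ae_affinv (rev e) (shift L e) (uv e)).
by apply: aeS => y h _; rewrite /to_line h//; apply: slot_dom; exact: locP.
Qed.

Lemma to_lineK j w : spinor_aeq (to_graph j (to_line j w)) w.
Proof.
move=> e; have [N [mN N0] [domE dis]] := edge_dom_slot e.
exists N; split=> // x /= /not_implyP[ex ne].
move: ex; rewrite domE => -[sx|//]; exfalso; apply: ne.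
by rewrite /to_graph /to_line (locE sx) flipK affK.
Qed.

Lemma measurable_to_graph j u : measurable_spinor u -> measurable_spinor (to_graph j u).
Proof.
move=> mu_ e k; have [mr mi] := mu_ tt k; rewrite edge_dom_line in mr mi.
split.
  rewrite [X in measurable_fun _ X](_ : _ = fun x => (-1) ^+ (rev e && (k == j)) *
    complex.Re (u tt (phi e x) k 0)); last by apply/funext => x; rewrite Re_flip.
  apply: measurable_funM => //.
  exact: (measurableT_comp mr (@aff_measurable R (rev e) (shift L e) _)).
rewrite [X in measurable_fun _ X](_ : _ = fun x => (-1) ^+ (rev e && (k == j)) *
  complex.Im (u tt (phi e x) k 0)); last by apply/funext => x; rewrite Im_flip.
apply: measurable_funM => //.
exact: (measurableT_comp mi (@aff_measurable R (rev e) (shift L e) _)).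
Qed.

Lemma measurable_slots (h : R -> R) : (forall e, measurable_fun (slot e) h) ->
  measurable_fun setT h.
Proof.
move=> mh; (* Either the slot of the edge of rank k, or empty if there is no such edge. *)
pose F (k : nat) := [set y | ix (loc y) = k].
have FE e : F (ix e) = slot e.
  apply/seteqP; split=> y; last by move=> /locE yE; rewrite /F /= yE.
  by rewrite /F /= => /rank_inj <-; exact: locP.
have F0 k : (forall e, ix e <> k) -> F k = set0.
  by move=> nk; apply/seteqP; split=> // y /=; exact: nk.
have cases k : (exists e, F k = slot e) \/ F k = set0.
  have [[e <-]|ne] := pselect (exists e, ix e = k); first by left; exists e; exact: FE.
  by right; apply: F0 => e ek; apply: ne; exists e.
have -> : setT = \bigcup_k F k by apply/seteqP; split=> // y _; exists (ix (loc y)).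
apply/measurable_fun_bigcup => k; case: (cases k) => [[e ->]|->] //.
- exact: measurable_slot.
- exact: measurable_fun_set0.
Qed.

Lemma measurable_to_line j w : measurable_spinor w -> measurable_spinor (to_line j w).
Proof.
move=> mw [] k; rewrite edge_dom_line.
have mc (h : edge G -> R -> R) : (forall e, measurable_fun (edge_dom e) (h e)) ->
    measurable_fun setT (fun y => (-1) ^+ (rev (loc y) && (k == j)) * h (loc y) (psi (loc y) y)).
  move=> mh; apply: measurable_slots => e.
  apply: (eq_measurable_fun (fun y => (-1) ^+ (rev e && (k == j)) * h e (psi e y))).
    by move=> y; rewrite inE => sy; rewrite (locE sy).
  apply: measurable_funM => //.
  apply: (measurable_comp _ _ (mh e)).
  - exact: measurable_edge_dom.
  - by move=> _ [y sy <-]; exact: slot_dom.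
  - exact: affinv_measurable.
split.
  rewrite [X in measurable_fun _ X](_ : _ = fun y => (-1) ^+ (rev (loc y) && (k == j)) *
    complex.Re (w (loc y) (psi (loc y) y) k 0)); last by apply/funext => x; rewrite Re_flip.
  by apply: (mc (fun e x => complex.Re (w e x k 0))) => e; case: (mw e k).
rewrite [X in measurable_fun _ X](_ : _ = fun y => (-1) ^+ (rev (loc y) && (k == j)) *
  complex.Im (w (loc y) (psi (loc y) y) k 0)); last by apply/funext => x; rewrite Im_flip.
by apply: (mc (fun e x => complex.Im (w e x k 0))) => e; case: (mw e k).
Qed.

Lemma to_graph_modulus j (g : R -> R) u : measurable_fun setT g -> measurable_spinor u ->
  modulus_integral g (to_graph j u) = modulus_integral g u.
Proof.
move=> mg mu_; have mc := @measurable_modulus R (line R) g u tt mg mu_.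
rewrite edge_dom_line in mc.
rewrite /modulus_integral (bigD1 tt)//= [X in (_ + X)%E]big1; last by case.
rewrite adde0 edge_dom_line.
rewrite (integral_line (h := fun y => g (C2norm (u tt y)))); last exact/measurable_EFinP.
by apply: eq_bigr => e _; apply: eq_integral => x _; rewrite C2norm_flip.
Qed.

(** Reduced to [to_graph_modulus], since [to_graph] undoes [to_line] almost
    everywhere. *)
Lemma to_line_modulus j (g : R -> R) w : measurable_fun setT g -> (forall t, 0 <= g t) ->
  measurable_spinor w -> modulus_integral g (to_line j w) = modulus_integral g w.
Proof.
move=> mg g0 mw; have mVw := measurable_to_line j mw.
rewrite -(to_graph_modulus j mg mVw); apply: eq_bigr => e _.
exact: (modulus_integral_aeq mg g0 (measurable_to_graph j mVw) mw (to_lineK j w)).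
Qed.

Lemma inL2_to_graph j u : inL2 u -> inL2 (to_graph j u).
Proof.
move=> u2; have mu_ := inL2_measurable u2; split; first exact: measurable_to_graph.
rewrite L2normsq_modulus to_graph_modulus//; first by case: u2.
Qed.

Lemma inL2_to_line j w : inL2 w -> inL2 (to_line j w).
Proof.
move=> w2; have mw := inL2_measurable w2; split; first exact: measurable_to_line.
rewrite L2normsq_modulus to_line_modulus//; first by case: w2.
by move=> t; exact: sqr_ge0.
Qed.

End Layout.

(** * Inner products and vertex conditions on a layout *)

Section PairingIntegrable.
Variables (R : realType) (G : metric_graph R).
Local Notation mu := (@lebesgue_measure R).

Lemma pairing_bound (u v : spinor G) e x :
  `|complex.Re (pairing u v e x)| <= C2norm (u e x) ^+ 2 + C2norm (v e x) ^+ 2 /\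
  `|complex.Im (pairing u v e x)| <= C2norm (u e x) ^+ 2 + C2norm (v e x) ^+ 2.
Proof.
rewrite Re_pairing Im_pairing !C2norm_sqr -big_split/=.
split; apply: le_trans (ler_norm_sum _ _ _) _; apply: ler_sum => k _;
  case: (u e x k 0) (v e x k 0) => a b [p q] /=; rewrite ler_norml;
  have := sqr_ge0 (a + p); have := sqr_ge0 (a - p); have := sqr_ge0 (b + q);
  have := sqr_ge0 (b - q); have := sqr_ge0 (b + p); have := sqr_ge0 (b - p);
  have := sqr_ge0 (a + q); have := sqr_ge0 (a - q); have := sqr_ge0 a;
  have := sqr_ge0 b; have := sqr_ge0 p; have := sqr_ge0 q;
  rewrite !expr2 => *; apply/andP; split; lra.
Qed.

(** The pairing is dominated by the sum of the squared moduli. *)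
Lemma integrable_pairing (u v : spinor G) e : inL2 u -> inL2 v ->
  mu.-integrable (edge_dom e) (EFin \o (fun x => complex.Re (pairing u v e x))) /\
  mu.-integrable (edge_dom e) (EFin \o (fun x => complex.Im (pairing u v e x))).
Proof.
move=> u2 v2; have mD := measurable_edge_dom e.
have mw w : inL2 w -> measurable_fun (edge_dom e) (fun x => (C2norm (w e x) ^+ 2)%:E).
  by move=> w2; apply: measurable_sqr_C2norm; exact: inL2_measurable.
have int w : inL2 w -> mu.-integrable (edge_dom e) (fun x => (C2norm (w e x) ^+ 2)%:E).
  move=> w2; apply/integrableP; split; first exact: mw.
  under eq_integral do rewrite gee0_abs ?lee_fin ?sqr_ge0//.
  exact: inL2_edge_lty.
have dom := @integrableD _ (measurableTypeR R) R mu (edge_dom e) mD _ _ (int u u2) (int v v2).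
have [mr mi] := measurable_pairing e (inL2_measurable u2) (inL2_measurable v2).
split.
  apply: (@le_integrable _ (measurableTypeR R) R mu (edge_dom e) mD _ _ _ _ dom);
      first exact/measurable_EFinP.
  move=> x _ /=; rewrite lee_fin; apply: le_trans (ler_norm _).
  by case: (pairing_bound u v e x).
apply: (@le_integrable _ (measurableTypeR R) R mu (edge_dom e) mD _ _ _ _ dom);
    first exact/measurable_EFinP.
move=> x _ /=; rewrite lee_fin; apply: le_trans (ler_norm _).
by case: (pairing_bound u v e x).
Qed.

Lemma sum_complex (I : finType) (a b : I -> R) :
  \sum_i (a i +i* b i) = (\sum_i a i) +i* (\sum_i b i).
Proof.
apply/eqP; rewrite eq_complex/= !raddf_sum/=.
by apply/andP; split; apply/eqP; apply: eq_bigr.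
Qed.

End PairingIntegrable.

Section LayoutDirac.
Variables (R : realType) (G : metric_graph R) (L : line_layout G).
Local Notation mu := (@lebesgue_measure R).
Local Notation B := (cut L).
Local Notation ix := (rank L).
Local Notation rev := (rev L).
Local Notation phi e := (aff (rev e) (shift L e)).
Local Notation psi e := (affinv (rev e) (shift L e)).

Lemma to_graph_inner j (u v : spinor (line R)) : inL2 u -> inL2 v ->
  L2inner (to_graph L j u) (to_graph L j v) = L2inner u v.
Proof.
move=> u2 v2; have [ir ii] := @integrable_pairing R (line R) u v tt u2 v2.
rewrite edge_dom_line in ir ii.
rewrite /L2inner [RHS](bigD1 tt)//= [X in _ + X]big1 ?addr0; last by case.
rewrite edge_dom_line /Cintegral (Rintegral_line L ir) (Rintegral_line L ii) sum_complex.
congr (_ +i* _); apply: eq_bigr => e _; apply: eq_Rintegral => x _.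
  by rewrite flip_pairing.
by rewrite flip_pairing.
Qed.

Lemma to_line_inner j (u v : spinor G) : inL2 u -> inL2 v ->
  L2inner (to_line L j u) (to_line L j v) = L2inner u v.
Proof.
move=> u2 v2; have u'2 := inL2_to_line L j u2; have v'2 := inL2_to_line L j v2.
rewrite -(to_graph_inner j u'2 v'2); apply: L2inner_aeq.
- exact: (inL2_measurable (inL2_to_graph L j u'2)).
- exact: (inL2_measurable u2).
- exact: (inL2_measurable (inL2_to_graph L j v'2)).
- exact: (inL2_measurable v2).
- exact: to_lineK.
- exact: to_lineK.
Qed.

(** Both edge ends at a vertex read the value of w at the same point of the
    line.  The second components cancel because the coordinate of the line
    enters the vertex along one end and leaves it along the other. *)
Lemma to_graph_dirac_kirchhoff (w : spinor (line R)) : dirac_kirchhoff (to_graph L 1 w).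
Proof.
move=> v; have [e [e' [ee' ends]]] := vertex_junction L v.
have [v' [t [ends' _ te te']]] := junction ee'.
have ne : (e, ~~ rev e) != (e', rev e').
  by apply/eqP => -[eqe _]; move: ee'; rewrite eqe => /n_Sn.
have va : end_value (to_graph L 1 w) (e, ~~ rev e) = flip 1 (rev e) (w tt t).
  by rewrite /end_value /to_graph te.
have vb : end_value (to_graph L 1 w) (e', rev e') = flip 1 (rev e') (w tt t).
  by rewrite /end_value /to_graph te'.
split.
  have v0 a : a \in ends_at v -> end_value (to_graph L 1 w) a 0 0 = w tt t 0 0.
    by rewrite ends !inE => /orP[] /eqP ->; rewrite ?va ?vb flipE /flip_sign andbF mul1r.
  by move=> a b /v0 -> /v0 ->.
rewrite ends big_setU1 ?inE//= big_set1 va vb !flipE /flip_sign /end_sign/= eqxx !andbT.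
by case: (rev e); case: (rev e');
    rewrite ?expr0 ?expr1 ?mul1r ?mulN1r ?mulNr ?mul1r ?opprK ?addNr ?subrr.
Qed.

(** At a cut [loc] picks the edge on the left; the vertex condition gives the
    same value from the edge on the right. *)
Lemma to_line_closed (w : spinor G) e y : dirac_kirchhoff w ->
  (B (ix e) <= y%:E)%E -> (y%:E <= B (ix e).+1)%E ->
  to_line L 1 w tt y = flip 1 (rev e) (w e (psi e y)).
Proof.
move=> K; rewrite le_eqVlt => /predU1P[eqB|lo] hi; last first.
  by rewrite /to_line (locE (L := L) (e := e)).
case ik : (ix e) => [|k]; first by move: eqB; rewrite ik cut_first.
have kn : (k < pieces L)%N by apply: leq_trans (rank_lt L e); rewrite ik.
have [e' e'k] := rank_surj kn.
have ee' : ix e = (ix e').+1 by rewrite ik e'k.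
have se' : slot L e' y.
  by rewrite /slot/= -ee' eqB; split=> //; rewrite -eqB ee'; apply: cut_lt; exact: rank_lt.
have [v [t [ends cutt te' te]]] := junction ee'.
have ty : t = y by apply: EFin_inj; rewrite -cutt -eqB.
have [K0 K1] := K v.
have ne : (e', ~~ rev e') != (e, rev e).
  by apply/eqP => -[eqe _]; move: ee'; rewrite eqe => /n_Sn.
have pe' : psi e' y = end_coord (e', ~~ rev e') by rewrite -ty -te' affK.
have pe : psi e y = end_coord (e, rev e) by rewrite -ty -te affK.
rewrite /to_line (locE se') pe pe'.
have h0 := K0 (e', ~~ rev e') (e, rev e); rewrite ends !inE !eqxx orbT in h0.
move/(_ isT isT) : h0; rewrite /end_value/= => h0.
move: K1; rewrite ends big_setU1 ?inE//= big_set1 /end_value /end_sign/=.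
move=> K1; apply/matrixP => k0 l; rewrite [l]ord1 !flipE /flip_sign.
case: k0 => [[|[|//]] ik0].
  by rewrite (_ : Ordinal ik0 = 0) ?andbF ?expr0 ?mul1r//; exact: val_inj.
rewrite (_ : Ordinal ik0 = 1) ?eqxx ?andbT; last exact: val_inj.
move: K1; case: (rev e'); case: (rev e); rewrite /= ?expr0 ?expr1 !mul1r ?mulN1r.
- by move/eqP; rewrite subr_eq0 => /eqP ->.
- by move/eqP; rewrite addr_eq0 => /eqP ->; rewrite opprK.
- by rewrite -opprD => /eqP; rewrite oppr_eq0 addr_eq0 => /eqP.
- by rewrite addrC => /eqP; rewrite subr_eq0 => /eqP.
Qed.

End LayoutDirac.

(** * Dirac operators of a layout *)

Section AffinePrimitive.
Variables (R : realType) (r : bool) (tau : R).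
Local Notation mu := (@lebesgue_measure R).

Lemma affinvE y : affinv r tau y = aff r (- (sgn R r * tau)) y.
Proof. by rewrite /affinv /aff mulrBr. Qed.

Lemma measurable_fun_aff (A : set R) (h : R -> R) : measurable A -> measurable_fun A h ->
  measurable_fun (aff r tau @^-1` A) (fun x => h (aff r tau x)).
Proof.
move=> mA mh; apply: (measurable_comp mA _ mh) => //; last exact: aff_measurable.
by move=> _ [x Ax <-].
Qed.

Lemma integrable_aff_itv (h : R -> R) (x y : R) : x <= y ->
  let a := if r then aff r tau y else aff r tau x in
  let b := if r then aff r tau x else aff r tau y in
  measurable_fun `[a, b] h -> (\int[mu]_(s in `[a, b]) (h s ^+ 2)%:E < +oo)%E ->
  mu.-integrable `[x, y] (EFin \o (fun s => h (aff r tau s))).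
Proof.
move=> xy a b mh h2; apply: sqr_integrable_itv => //.
  by rewrite (aff_preimage_itv r tau x y); apply: measurable_fun_aff.
rewrite (aff_preimage_itv r tau x y) -/a -/b.
rewrite (@ge0_integral_aff R r tau `[a, b] (fun s => (h s ^+ 2)%:E))//.
- by apply/measurable_EFinP; exact: measurable_funX.
- by move=> s _; rewrite lee_fin sqr_ge0.
Qed.

(** A reflection reverses the interval of integration; this sign is the
    quotient of the two signs (-1)^b0 and (-1)^b1. *)
Lemma sign_primitive (b0 b1 : bool) (W W' : R -> R) (x y : R) : x <= y ->
  b0 (+) b1 = r ->
  let a := if r then aff r tau y else aff r tau x in
  let b := if r then aff r tau x else aff r tau y in
  measurable_fun `[a, b] W' -> (\int[mu]_(s in `[a, b]) (W' s ^+ 2)%:E < +oo)%E ->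
  W b - W a = \int[mu]_(s in `[a, b]) W' s ->
  (-1) ^+ b1 * W (aff r tau y) - (-1) ^+ b1 * W (aff r tau x) =
  \int[mu]_(s in `[x, y]) ((-1) ^+ b0 * W' (aff r tau s)).
Proof.
move=> xy bb a b mW' W'2 prim.
rewrite RintegralZl//; last exact: integrable_aff_itv.
rewrite Rintegral_aff_itv -/a -/b// -prim /a /b.
move: bb; case: r; case: b0; case: b1 => //= _; rewrite ?expr0 ?expr1; ring.
Qed.

End AffinePrimitive.

(** For both components, the signs of flip 0 and flip 1 differ exactly when
    the edge is reflected. *)
Lemma signs_ord2 (r : bool) (k : 'I_2) : (r && (k == 0)) (+) (r && (k == 1)) = r.
Proof. by case: r; case: k => [[|[|//]] ik]. Qed.

Section LayoutDerivative.
Variables (R : realType) (G : metric_graph R) (L : line_layout G).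
Local Notation mu := (@lebesgue_measure R).
Local Notation B := (cut L).
Local Notation ix := (rank L).
Local Notation rev := (rev L).
Local Notation phi e := (aff (rev e) (shift L e)).
Local Notation psi e := (affinv (rev e) (shift L e)).

Lemma ReB (a b : R[i]) : complex.Re (a - b) = complex.Re a - complex.Re b.
Proof. by case: a b => ? ? []. Qed.

Lemma ImB (a b : R[i]) : complex.Im (a - b) = complex.Im a - complex.Im b.
Proof. by case: a b => ? ? []. Qed.

Lemma complex_eq (a : R[i]) (p q : R) : complex.Re a = p -> complex.Im a = q -> a = p +i* q.
Proof. by case: a => x y /= -> ->. Qed.

Lemma entry_sqr_subset (H : metric_graph R) (w : spinor H) (e : edge H) k (A : set R) :
  inL2 w -> measurable A -> A `<=` edge_dom e ->
  [/\ measurable_fun A (fun x => complex.Re (w e x k 0)),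
      measurable_fun A (fun x => complex.Im (w e x k 0)),
      (\int[mu]_(x in A) (complex.Re (w e x k 0) ^+ 2)%:E < +oo)%E &
      (\int[mu]_(x in A) (complex.Im (w e x k 0) ^+ 2)%:E < +oo)%E].
Proof.
move=> w2 mA sub; have mD := measurable_edge_dom e.
have [mr mi] := inL2_measurable w2 e k; have [fr fi] := entry_sqr_integral e k w2.
have p0 (h : R -> R) x : (0 <= (h x ^+ 2)%:E)%E by rewrite lee_fin sqr_ge0.
have le (h : R -> R) : measurable_fun (edge_dom e) h ->
    (\int[mu]_(x in A) (h x ^+ 2)%:E <= \int[mu]_(x in edge_dom e) (h x ^+ 2)%:E)%E.
  move=> mh; apply: ge0_subset_integral => //.
  by apply/measurable_EFinP; exact: measurable_funX.
split.
- exact: measurable_funS mr.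
- exact: measurable_funS mi.
- exact: le_lt_trans (le _ mr) fr.
- exact: le_lt_trans (le _ mi) fi.
Qed.

Lemma to_graph_H1 (w w' : spinor (line R)) : H1_derivative w w' ->
  H1_derivative (to_graph L 1 w) (to_graph L 0 w').
Proof.
case=> w2 w'2 ww'; split; [exact: inL2_to_graph|exact: inL2_to_graph|].
move=> e x y ex ey xy k.
set a := if rev e then phi e y else phi e x; set b := if rev e then phi e x else phi e y.
have ab : a <= b.
  by rewrite /a /b /aff /sgn; case: (rev e); rewrite ?expr1 ?expr0; lra.
have all (A : set R) : A `<=` edge_dom (tt : edge (line R)) by rewrite edge_dom_line.
have mab : measurable (`[a, b] : set R) by [].
have [m1 m2 f1 f2] := @entry_sqr_subset (line R) w' tt k `[a, b] w'2 mab (all _).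
have prim := ww' tt a b (all [set a] _ erefl) (all [set b] _ erefl) ab k.
apply: complex_eq.
  rewrite ReB !Re_flip (@sign_primitive R (rev e) (shift L e) (rev e && (k == 0)) (rev e && (k ==
      1))
    (fun s => complex.Re (w tt s k 0)) (fun s => complex.Re (w' tt s k 0)) x y xy (signs_ord2 _
        _) m1 f1) //.
    by apply: eq_Rintegral => s _; rewrite Re_flip.
  by rewrite -ReB prim.
rewrite ImB !Im_flip (@sign_primitive R (rev e) (shift L e) (rev e && (k == 0)) (rev e && (k == 1))
    (fun s => complex.Im (w tt s k 0)) (fun s => complex.Im (w' tt s k 0)) x y xy (signs_ord2 _
        _) m2 f2) //.
  by apply: eq_Rintegral => s _; rewrite Im_flip.
by rewrite -ImB prim.
Qed.

(** Induction on the number of cuts to the left of y. *)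
Lemma glue_primitive (g g' : R -> R) : measurable_fun setT g' ->
  (forall x y : R, x <= y -> mu.-integrable `[x, y] (EFin \o g')) ->
  (forall e x y, (B (ix e) <= x%:E)%E -> (y%:E <= B (ix e).+1)%E -> x <= y ->
     g y - g x = \int[mu]_(s in `[x, y]) g' s) ->
  forall x y, x <= y -> g y - g x = \int[mu]_(s in `[x, y]) g' s.
Proof.
move=> mg' ig' loc_.
have ind k : (k <= pieces L)%N -> forall x y, (y%:E <= B k)%E -> x <= y ->
    g y - g x = \int[mu]_(s in `[x, y]) g' s.
  elim: k => [_ x y|k IH kn x y yk xy]; first by rewrite cut_first leeNy_eq.
  have [yk'|ky] := leP (y%:E) (B k); first exact: IH (ltnW kn) x y yk' xy.
  have [e ek] := rank_surj kn.
  have [kx|xk] := leP (B k) (x%:E); first by apply: (loc_ e); rewrite ?ek.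
  have [t tE] : exists t, B k = t%:E.
    by move: ky xk; case: (B k) => [t _ _| |]; [exists t| |].
  move: ky xk; rewrite tE !lte_fin => ty xt.
  have h1 := IH (ltnW kn) x t; rewrite tE in h1.
  have h2 := loc_ e t y; rewrite ek tE in h2.
  have yk1 : (y%:E <= B k.+1)%E by [].
  have -> : g y - g x = (g y - g t) + (g t - g x) by ring.
  rewrite (h1 (lexx _) (ltW xt)) (h2 (lexx _) yk1 (ltW ty)).
  have := @Rintegral_itvB R g' (BLeft x) (BRight y) t (ig' _ _ xy).
  rewrite !bnd_simp => /(_ (ltW xt) (ltW ty)) /eqP.
  rewrite subr_eq => /eqP ->.
  rewrite (@Rintegral_itv_obnd_cbnd R t (BRight y) g') 1?addrC//.
  apply: integrableS (ig' _ _ (ltW ty)) => //.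
  by apply: subset_itvr; rewrite bnd_simp.
by move=> x y; apply: (ind (pieces L)) => //; rewrite cut_last leey.
Qed.

Lemma to_line_H1 (w w' : spinor G) : H1_derivative w w' -> dirac_kirchhoff w ->
  H1_derivative (to_line L 1 w) (to_line L 0 w').
Proof.
case=> w2 w'2 ww' K; split; [exact: inL2_to_line|exact: inL2_to_line|].
have l2 := inL2_to_line L 0 w'2.
move=> [] x y _ _ xy k.
have all (A : set R) : A `<=` edge_dom (tt : edge (line R)) by rewrite edge_dom_line.
have [mr mi _ _] := @entry_sqr_subset (line R) _ tt k setT l2 measurableT (all _).
have locint (p q : R) : p <= q ->
    mu.-integrable `[p, q] (EFin \o (fun s => complex.Re (to_line L 0 w' tt s k 0))) /\
    mu.-integrable `[p, q] (EFin \o (fun s => complex.Im (to_line L 0 w' tt s k 0))).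
  move=> pq; have mpq : measurable (`[p, q] : set R) by [].
  have [m1 m2 f1 f2] := @entry_sqr_subset (line R) _ tt k `[p, q] l2 mpq (all _).
  by split; exact: sqr_integrable_itv.
have piece (e : edge G) (p q : R) (c : R[i] -> R) :
    (forall (j : 'I_2) r z k, c (flip j r z k 0) = (-1) ^+ (r && (k == j)) * c (z k 0)) ->
    (forall a b : R, (edge_dom e a) -> edge_dom e b -> a <= b ->
      [/\ measurable_fun `[a, b] (fun s => c (w' e s k 0)),
          (\int[mu]_(s in `[a, b]) (c (w' e s k 0) ^+ 2)%:E < +oo)%E &
          c (w e b k 0) - c (w e a k 0) = \int[mu]_(s in `[a, b]) c (w' e s k 0)]) ->
    (forall r t : R, r <= t -> mu.-integrable `[r, t] (EFin \o (fun s => c (to_line L 0 w' tt s k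
        0)))) ->
    (B (ix e) <= p%:E)%E -> (q%:E <= B (ix e).+1)%E -> p <= q ->
    c (to_line L 1 w tt q k 0) - c (to_line L 1 w tt p k 0) =
    \int[mu]_(s in `[p, q]) c (to_line L 0 w' tt s k 0).
  move=> cf cprim cint xlo yhi xy'.
  have xhi : (p%:E <= B (ix e).+1)%E by apply: le_trans yhi; rewrite lee_fin.
  have ylo : (B (ix e) <= q%:E)%E by apply: le_trans xlo _; rewrite lee_fin.
  rewrite (to_line_closed K xlo xhi) (to_line_closed K ylo yhi) !cf.
  rewrite -(Rintegral_itv_obnd_cbnd (f := fun s => c (to_line L 0 w' tt s k 0))); last first.
    apply: integrableS (cint _ _ xy') => //.
    by apply: subset_itvr; rewrite bnd_simp.
  rewrite (@eq_Rintegral _ _ _ mu `]p, q] (fun s => (-1) ^+ (rev e && (k == 0)) * c (w' e (psi e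
      s) k 0))); last first.
    move=> s; rewrite inE/= in_itv/= => /andP[xs sy].
    rewrite /to_line (locE (L := L) (e := e)) ?cf//; split.
      by apply: le_lt_trans xlo _; rewrite lte_fin.
    by apply: le_trans yhi; rewrite lee_fin.
  have dx : edge_dom e (psi e p) by apply/(dom_layout L); rewrite affinvK.
  have dy : edge_dom e (psi e q) by apply/(dom_layout L); rewrite affinvK.
  set tau := - (sgn R (rev e) * shift L e).
  have pE s : psi e s = aff (rev e) tau s by exact: affinvE.
  set a := if rev e then psi e q else psi e p; set b := if rev e then psi e p else psi e q.
  have da : edge_dom e a by rewrite /a; case: ifP.
  have db : edge_dom e b by rewrite /b; case: ifP.
  have ab : a <= b.
    by rewrite /a /b /affinv /sgn; case: (rev e); rewrite ?expr1 ?expr0; lra.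
  have [m1 f1 prim] := cprim a b da db ab.
  rewrite /a /b !pE in m1 f1 prim.
  rewrite !pE (@sign_primitive R (rev e) tau (rev e && (k == 0)) (rev e && (k == 1))
    (fun s => c (w e s k 0)) (fun s => c (w' e s k 0)) p q xy' (signs_ord2 _ _) m1 f1 prim).
  under [in RHS]eq_Rintegral do rewrite pE.
  symmetry; apply: Rintegral_itv_obnd_cbnd.
  have mI : measurable (`[p, q] : set R) by [].
  have i1 := @integrableZl _ (measurableTypeR R) R mu `[p, q] mI ((-1) ^+ (rev e && (k == 0))) _
    (integrable_aff_itv xy' m1 f1).
  apply: integrableS i1 => //.
  by apply: subset_itvr; rewrite bnd_simp.
have prim (e : edge G) (a b : R) : edge_dom e a -> edge_dom e b -> a <= b ->
    `[a, b] `<=` edge_dom e.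
  move=> [a1 a2] [b1 b2] ab s; rewrite /= in_itv/= => /andP[h1 h2]; split.
    by apply: le_trans a1 _; rewrite lee_fin.
  by apply: le_trans b2; rewrite lee_fin.
apply: complex_eq.
  rewrite ReB; apply: (@glue_primitive (fun y => complex.Re (to_line L 1 w tt y k 0)) _ mr _ _ x
      y xy).
    by move=> a b ab; case: (locint a b ab).
  move=> e a b alo bhi ab; apply: (piece e a b (@complex.Re R)) => //.
  - exact: Re_flip.
  - move=> p q ep eq pq; have mI : measurable (`[p, q] : set R) by [].
    have [m1 _ f1 _] := entry_sqr_subset k w'2 mI (prim _ _ _ ep eq pq).
    by split=> //; rewrite -ReB (ww' e p q ep eq pq k).
  - by move=> p q pq; case: (locint p q pq).
rewrite ImB; apply: (@glue_primitive (fun y => complex.Im (to_line L 1 w tt y k 0)) _ mi _ _ x y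
    xy).
  by move=> a b ab; case: (locint a b ab).
move=> e a b alo bhi ab; apply: (piece e a b (@complex.Im R)) => //.
- exact: Im_flip.
- move=> p q ep eq pq; have mI : measurable (`[p, q] : set R) by [].
  have [_ m1 _ f1] := entry_sqr_subset k w'2 mI (prim _ _ _ ep eq pq).
  by split=> //; rewrite -ImB (ww' e p q ep eq pq k).
- by move=> p q pq; case: (locint p q pq).
Qed.

Lemma to_graph_dirac (m c : R) (u v : spinor (line R)) : dirac_op m c u v ->
  dirac_op m c (to_graph L 1 u) (to_graph L 1 v).
Proof.
case=> u2 v2 [w [w' [uw H _ vw]]]; split; [exact: inL2_to_graph|exact: inL2_to_graph|].
exists (to_graph L 1 w), (to_graph L 0 w'); split.
- exact: to_graph_aeq.
- exact: to_graph_H1.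
- exact: to_graph_dirac_kirchhoff.
- apply: spinor_aeq_trans (to_graph_aeq L 1 vw) _ => e.
  by apply: aeW => x _; rewrite /to_graph flip_dirac.
Qed.

Lemma to_line_dirac (m c : R) (u v : spinor G) : dirac_op m c u v ->
  dirac_op m c (to_line L 1 u) (to_line L 1 v).
Proof.
case=> u2 v2 [w [w' [uw H K vw]]]; split; [exact: inL2_to_line|exact: inL2_to_line|].
exists (to_line L 1 w), (to_line L 0 w'); split.
- exact: to_line_aeq.
- exact: to_line_H1.
- by case.
- apply: spinor_aeq_trans (to_line_aeq L 1 vw) _ => e.
  by apply: aeW => x _; rewrite /to_line flip_dirac.
Qed.

Lemma to_graph_morphism (m c : R) : spinor_morphism m c (to_graph L 1).
Proof.
split.
- exact: to_graph_lin.
- exact: to_graph_aeq.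
- exact: inL2_to_graph.
- exact: to_graph_inner.
- by move=> g u mg _ u2; apply: to_graph_modulus => //; exact: inL2_measurable.
- exact: to_graph_dirac.
Qed.

Lemma to_line_morphism (m c : R) : spinor_morphism m c (to_line L 1).
Proof.
split.
- exact: to_line_lin.
- exact: to_line_aeq.
- exact: inL2_to_line.
- exact: to_line_inner.
- by move=> g u mg g0 u2; apply: to_line_modulus => //; exact: inL2_measurable.
- exact: to_line_dirac.
Qed.

Lemma layout_ground_level (m c lam : R) (f : R -> R) : F1 f -> F4 f ->
  ground_level m c f G lam = ground_level m c f (line R) lam.
Proof.
move=> hF1 hF4; apply: (ground_level_iso lam hF1 hF4 (to_line_morphism m c) (to_graph_morphism m
    c)).
- exact: to_lineK.
- by move=> u; rewrite to_graphK; exact: spinor_aeq_refl.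
Qed.

End LayoutDerivative.

(** * Chains of traversals *)

Section ChainLayout.
Variables (R : realType) (G : metric_graph R).
Variables (a0 : edge G * bool) (chain : seq (edge G * bool)).
Local Notation s := (a0 :: chain).
Hypothesis chain_perm : perm_eq [seq a.1 | a <- s] (enum (edge G)).
Hypothesis chain_path : path (@through_transmissive R G) a0 chain.
Hypothesis chain_first : inc a0.1 a0.2 = None.
Hypothesis chain_last : inc (last a0 chain).1 (~~ (last a0 chain).2) = None.
Hypothesis degree2 : forall v : vertex G, degree v = 2.

(** The k-th traversal of the chain; as in [essential_reduction], an edge end
    stands for the traversal that starts there. *)
Definition trav k : edge G * bool := nth a0 s k.
Definition pos (e : edge G) : nat := index e [seq a.1 | a <- s].
Definition reversed (e : edge G) : bool := (trav (pos e)).2.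
Definition len k : R := fine (edge_length (trav k).1).
(** Position of the k-th cut: the first edge is infinite on the left, so the
    first finite cut, of index 1, is put at 0. *)
Definition break k : R := \sum_(1 <= i < k) len i.
Definition cuts k : \bar R :=
  if k == 0 then -oo%E else if (size s <= k)%N then +oo%E else (break k)%:E.
(** The first edge is anchored at its exit, every other edge at its entry.  If
    there is only one edge, its exit is infinite and [end_coord] is 0 there,
    so that the edge is anchored by its own coordinate. *)
Definition offset (e : edge G) : R :=
  if pos e == 0 then - (sgn R (reversed e) * end_coord (e, ~~ reversed e))
  else break (pos e) - sgn R (reversed e) * end_coord (e, reversed e).
Local Notation phi e := (aff (reversed e) (offset e)).

Lemma edges_uniq : uniq [seq a.1 | a <- s].
Proof. by rewrite (perm_uniq chain_perm) enum_uniq. Qed.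

Lemma edge_mem e : e \in [seq a.1 | a <- s].
Proof. by rewrite (perm_mem chain_perm) mem_enum. Qed.

Lemma pos_lt e : (pos e < size s)%N.
Proof. by have := edge_mem e; rewrite -index_mem size_map. Qed.

Lemma trav_pos e : trav (pos e) = (e, reversed e).
Proof.
rewrite /reversed /trav; set a := nth _ _ _; rewrite [a]surjective_pairing; congr (_, _).
by rewrite /a -(nth_map a0 a0.1 fst) ?pos_lt// nth_index// edge_mem.
Qed.

Lemma pos_trav k : (k < size s)%N -> pos (trav k).1 = k.
Proof.
move=> ks; rewrite /pos /trav -(nth_map a0 a0.1 fst)//.
by rewrite index_uniq ?size_map// edges_uniq.
Qed.

Lemma pos_inj : injective pos.
Proof. by move=> e e' h; have := trav_pos e; rewrite h trav_pos => -[]. Qed.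

Lemma trav_step k : (k.+1 < size s)%N ->
  exists2 v, inc (trav k).1 (~~ (trav k).2) = Some v & inc (trav k.+1).1 (trav k.+1).2 = Some v.
Proof.
move=> ks; have /(pathP a0) := chain_path => /(_ k); rewrite ltnS in ks.
move=> /(_ ks); rewrite /through_transmissive /opp_end /=.
rewrite -[nth a0 (a0 :: chain) k]/(trav k) -[nth a0 chain k]/(trav k.+1).
by case: (inc _ _) => // v /andP[_ /eqP h]; exists v.
Qed.

(** The interior ends of the chain are at vertices and its two extremities are
    not. *)
Lemma inc_entry e : (inc e (reversed e) == None) = (pos e == 0).
Proof.
have := trav_pos e; case pe : (pos e) => [|k] te.
  by move: chain_first; rewrite -[a0]/(trav 0) te /= => ->.
have [v _] := @trav_step k (leq_ltn_trans (eq_leq (esym pe)) (pos_lt e)).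
by rewrite te /= => ->.
Qed.

Lemma inc_exit e : (inc e (~~ reversed e) == None) = (size s <= (pos e).+1)%N.
Proof.
have te := trav_pos e; have [h|h] := leqP (size s) (pos e).+1.
  have pe : pos e = size chain.
    by apply/eqP; rewrite eqn_leq -ltnS (pos_lt e).
  by have := chain_last; rewrite (last_nth a0) -/(trav (size chain)) -pe te /= => ->.
have [v + _] := trav_step h.
by rewrite te /= => ->.
Qed.

Lemma end_coordK (e : edge G) b : inc e b != None -> (end_coord (e, b))%:E = bound e b.
Proof. by rewrite inc_bound negbK /end_coord => h; rewrite fineK. Qed.

Lemma lower_infty (e : edge G) : inc e false = None -> bound e false = -oo%E.
Proof.
move/eqP; rewrite inc_bound; have := bound_lt e.
by case: (bound e false) => //; rewrite ltNge leey.
Qed.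

Lemma upper_infty (e : edge G) : inc e true = None -> bound e true = +oo%E.
Proof.
move/eqP; rewrite inc_bound; have := bound_lt e.
by case: (bound e true) => //; rewrite ltNge leNye.
Qed.

Lemma break_entry e : pos e != 0 -> phi e (end_coord (e, reversed e)) = break (pos e).
Proof. by move=> pe; rewrite /aff /offset (negbTE pe) addrC subrK. Qed.

(** The exit lies one edge length further than the entry. *)
Lemma break_exit e : ((pos e).+1 < size s)%N -> phi e (end_coord (e, ~~ reversed e)) = break (pos
    e).+1.
Proof.
move=> ps; rewrite /aff /offset; case: ifP => [/eqP ->|pe].
  by rewrite addrN /break big_geq.
have ne1 : inc e (reversed e) != None by rewrite inc_entry pe.
have ne2 : inc e (~~ reversed e) != None by rewrite inc_exit leqNgt ps.
rewrite [RHS]big_nat_recr ?lt0n ?pe//= -/(break (pos e)) /len trav_pos/= /edge_length.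
have -> : fine (bound e true - bound e false)%E =
    sgn R (reversed e) * (end_coord (e, ~~ reversed e) - end_coord (e, reversed e)).
  move: ne1 ne2; rewrite /sgn; case: (reversed e) => ne1 ne2.
    by rewrite -!end_coordK//= expr1; ring.
  by rewrite -!end_coordK//= expr0; ring.
ring.
Qed.

Lemma break_lt k : (0 < k)%N -> (k.+1 < size s)%N -> break k < break k.+1.
Proof.
move=> k0 ks; rewrite [ltRHS]big_nat_recr//= -/(break k) ltrDl /len.
have ks' := ltnW ks; set e := (trav k).1.
have pe : pos e = k by exact: pos_trav.
have ne1 : inc e (reversed e) != None by rewrite inc_entry pe -lt0n.
have ne2 : inc e (~~ reversed e) != None by rewrite inc_exit pe leqNgt ks.
have [n1 n2] : inc e false != None /\ inc e true != None.
  by move: ne1 ne2; case: (reversed e).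
have := bound_lt e; rewrite /edge_length -!end_coordK//= lte_fin.
by rewrite subr_gt0.
Qed.

Lemma chain_dom e x : edge_dom e x <->
  (cuts (pos e) <= (phi e x)%:E)%E /\ ((phi e x)%:E <= cuts (pos e).+1)%E.
Proof.
have entry : (cuts (pos e) <= (phi e x)%:E)%E <->
    (if reversed e then x%:E <= bound e true else bound e false <= x%:E)%E.
  rewrite /cuts; case: ifP => p0.
    have : inc e (reversed e) = None by apply/eqP; rewrite inc_entry.
    case: (reversed e) => h; last by rewrite lower_infty// !leNye.
    by rewrite upper_infty// leNye leey.
  rewrite leqNgt (pos_lt e)/= lee_fin -(break_entry (negbT p0)).
  have : inc e (reversed e) != None by rewrite inc_entry p0.
  rewrite /aff lerD2r /sgn; case: (reversed e) => h; rewrite -end_coordK// lee_fin.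
    by rewrite expr1 !mulN1r lerN2.
  by rewrite expr0 !mul1r.
have exit : ((phi e x)%:E <= cuts (pos e).+1)%E <->
    (if reversed e then bound e false <= x%:E else x%:E <= bound e true)%E.
  rewrite /cuts /=; case: ifP => p0.
    have : inc e (~~ reversed e) = None by apply/eqP; rewrite inc_exit.
    case: (reversed e) => /= h; first by rewrite lower_infty// leey leNye.
    by rewrite upper_infty// !leey.
  have ps : ((pos e).+1 < size s)%N by move/negbT: p0; rewrite -ltnNge.
  rewrite lee_fin -(break_exit ps).
  have : inc e (~~ reversed e) != None by rewrite inc_exit leqNgt ps.
  rewrite /aff lerD2r /sgn; case: (reversed e) => h; rewrite -end_coordK// lee_fin.
    by rewrite expr1 !mulN1r lerN2.
  by rewrite expr0 !mul1r.
split=> [[h1 h2]|[/entry h1 /exit h2]].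
  by split; [apply/entry|apply/exit]; case: ifP.
by move: h1 h2; rewrite /edge_dom /=; case: (reversed e).
Qed.

Lemma cuts_lt k : (k < size s)%N -> (cuts k < cuts k.+1)%E.
Proof.
move=> ks; rewrite /cuts leqNgt ks /=; case: k ks => [|k] ks /=.
  by case: ifP => // _; rewrite ltNyr.
case: ifP => h; first by rewrite ltry.
by rewrite lte_fin break_lt// ltnNge; exact: negbT.
Qed.

Lemma chain_junction e e' : pos e' = (pos e).+1 -> exists v t,
  [/\ ends_at v = [set (e, ~~ reversed e); (e', reversed e')]%SET, cuts (pos e') = t%:E,
     phi e (end_coord (e, ~~ reversed e)) = t &
     phi e' (end_coord (e', reversed e')) = t].
Proof.
move=> ee'; have ps : ((pos e).+1 < size s)%N by rewrite -ee' pos_lt.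
have [v] := trav_step ps; rewrite -ee' !trav_pos /= => h1 h2.
exists v, (break (pos e')); split.
- apply/esym/eqP; rewrite eqEcard; apply/andP; split.
    by apply/fintype.subsetP => a; rewrite !inE => /orP[] /eqP -> /=; rewrite ?h1 ?h2.
  have := degree2 v; rewrite /degree => ->; rewrite cards2.
  by case: eqP => // -[ee _]; move: ee'; rewrite ee => /n_Sn.
- by rewrite /cuts ee' /= leqNgt ps.
- by rewrite ee'; exact: break_exit.
- by apply: break_entry; rewrite ee'.
Qed.

Lemma chain_vertex v : exists e e', pos e' = (pos e).+1 /\
  ends_at v = [set (e, ~~ reversed e); (e', reversed e')]%SET.
Proof.
have : (0 < #|ends_at v|)%N by have := degree2 v; rewrite /degree => ->.
case/card_gt0P => -[e b]; rewrite inE /= => /eqP eb.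
have same e1 e2 a : pos e2 = (pos e1).+1 ->
    a \in [set (e1, ~~ reversed e1); (e2, reversed e2)]%SET -> inc a.1 a.2 = Some v ->
    ends_at v = [set (e1, ~~ reversed e1); (e2, reversed e2)]%SET.
  move=> /chain_junction[v' [t [ends _ _ _]]]; rewrite -ends inE => /eqP h.
  by rewrite h => -[->].
have [br|br] := eqVneq b (reversed e).
  have p0 : pos e != 0 by rewrite -inc_entry -br eb.
  have pk : ((pos e).-1 < size s)%N by apply: leq_ltn_trans (leq_pred _) (pos_lt e).
  have pp : pos e = (pos (trav (pos e).-1).1).+1 by rewrite pos_trav// prednK// lt0n.
  exists (trav (pos e).-1).1, e; split=> //.
  by apply: (same _ _ (e, b)) => //; rewrite !inE br eqxx orbT.
have bn : b = ~~ reversed e by move: br; case: b {eb}; case: (reversed e).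
have ps : ((pos e).+1 < size s)%N by rewrite ltnNge -inc_exit -bn eb.
exists e, (trav (pos e).+1).1; split; first by rewrite pos_trav.
by apply: (same _ _ (e, b)) => //; rewrite ?pos_trav// !inE bn eqxx.
Qed.

Definition chain_layout : line_layout G.
Proof.
apply: (@LineLayout R G (size s) cuts pos reversed offset).
- by [].
- by rewrite /cuts /= leqnn.
- exact: cuts_lt.
- exact: pos_lt.
- exact: pos_inj.
- by move=> k ks; exists (trav k).1; exact: pos_trav.
- exact: chain_dom.
- exact: chain_junction.
- exact: chain_vertex.
Defined.

End ChainLayout.

(** * Vertices of a graph isometric to the line *)

Section WalkDistance.
Variables (R : realType) (H : metric_graph R).

(** A function on the metric graph, single-valued at the vertices, that is
    1-Lipschitz along each edge.  Such functions bound the distance from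
    below, while walks bound it from above. *)
Definition lipschitz_graph (g : edge H -> R -> R) : Prop :=
  (forall e x y, edge_dom e x -> edge_dom e y -> `|g e x - g e y| <= `|x - y|) /\
  (forall (a b : edge H * bool) v, inc a.1 a.2 = Some v -> inc b.1 b.2 = Some v ->
     g a.1 (end_coord a) = g b.1 (end_coord b)).

Lemma walk_lipschitz g p q l : lipschitz_graph g -> walk p q l ->
  `|g p.1 p.2 - g q.1 q.2| <= l.
Proof.
case=> lip glue; elim=> {p q l} [p|e x y q l ex ey _ IH|a b v q l av bv _ IH] /=.
- by rewrite subrr normr0.
- rewrite (_ : g e x - _ = (g e x - g e y) + (g e y - g q.1 q.2)); last by ring.
  by apply: le_trans (ler_normD _ _) _; apply: lerD => //; exact: lip.
- by rewrite (glue a b v).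
Qed.

(** Along a walk the function changes by at most the length of the walk. *)
Lemma lipschitz_le_dist g p q : lipschitz_graph g ->
  ((`|g p.1 p.2 - g q.1 q.2|)%:E <= graph_dist p q)%E.
Proof.
move=> lip; apply: le_ereal_inf_tmp => _ [l wl <-]; rewrite lee_fin.
exact: walk_lipschitz wl.
Qed.

Lemma graph_dist_le (p q : edge H * R) l : walk p q l -> (graph_dist p q <= l%:E)%E.
Proof. by move=> w; apply: ereal_inf_lbound; exists l. Qed.

Variable psi : edge H -> R -> R.
Hypothesis psi_iso : forall e x e' x', edge_dom e x -> edge_dom e' x' ->
  graph_dist (e, x) (e', x') = (`|psi e x - psi e' x'|)%:E.
Hypothesis psi_surj : forall y, exists e x, edge_dom e x /\ psi e x = y.

Lemma psi_lower g e x e' x' : lipschitz_graph g -> edge_dom e x -> edge_dom e' x' ->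
  `|g e x - g e' x'| <= `|psi e x - psi e' x'|.
Proof.
move=> lip ex ex'; rewrite -lee_fin -psi_iso//.
exact: (lipschitz_le_dist (e, x) (e', x') lip).
Qed.

Lemma psi_upper e x y : edge_dom e x -> edge_dom e y -> `|psi e x - psi e y| <= `|x - y|.
Proof.
move=> ex ey; rewrite -lee_fin -psi_iso//; apply: graph_dist_le.
by rewrite -[`|x - y|]addr0; apply: walk_along => //; exact: walk_refl.
Qed.

Lemma end_dom (a : edge H * bool) v : inc a.1 a.2 = Some v -> edge_dom a.1 (end_coord a).
Proof.
case: a => e b /= eb; have : bound e b \is a fin_num.
  by rewrite -[_ \is a _]negbK -inc_bound eb.
move=> /fineK h; rewrite /edge_dom /end_coord /= h; have := ltW (bound_lt e).
by case: b {eb h} => ->; rewrite lexx.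
Qed.

Lemma psi_vertex (a b : edge H * bool) v : inc a.1 a.2 = Some v -> inc b.1 b.2 = Some v ->
  psi a.1 (end_coord a) = psi b.1 (end_coord b).
Proof.
move=> av bv; apply/eqP; rewrite -subr_eq0 -normr_le0 -lee_fin -psi_iso//.
- by apply: graph_dist_le; apply: (walk_glue av bv); exact: walk_refl.
- exact: end_dom av.
- exact: end_dom bv.
Qed.

(** Half of the shortest edge length, or less: within distance d the ends of
    an edge do not interfere, even if the edge is a loop. *)
Lemma edge_separation : exists2 d : R, 0 < d &
  forall e : edge H, (bound e false + (2 * d)%:E <= bound e true)%E.
Proof.
have : exists2 d : R, 0 < d & forall e : edge H, e \in enum (edge H) ->
    (bound e false + (2 * d)%:E <= bound e true)%E.
  elim: (enum (edge H)) => [|e s [d d0 hd]]; first by exists 1.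
  have [de de0 hde] : exists2 de : R, 0 < de & forall d', d' <= de ->
      (bound e false + (2 * d')%:E <= bound e true)%E.
    have := bound_lt e; case: (bound e false) => [a| |]; case: (bound e true) => [b| |] //=;
        rewrite ?lte_fin.
    - move=> ab; exists ((b - a) / 2); first by rewrite divr_gt0// subr_gt0.
      by move=> d' hd'; rewrite -EFinD lee_fin; lra.
    - by move=> _; exists 1 => // d' _; rewrite leey.
    - by move=> _; exists 1 => // d' _; rewrite addNye leNye.
    - by move=> _; exists 1 => // d' _; rewrite leey.
  exists (Num.min d de); first by rewrite lt_min d0.
  move=> e'; rewrite inE => /orP[/eqP ->|es].
    by apply: hde; rewrite ge_min lexx orbT.
  apply: le_trans (hd _ es); apply: leeD2l; rewrite lee_fin.
  by rewrite ler_pM2l// ge_min lexx.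
by case=> d d0 hd; exists d => // e; apply: hd; rewrite mem_enum.
Qed.

Section AtVertex.
Variables (w : vertex H) (d : R).
Hypothesis d_gt0 : 0 < d.
Hypothesis sep : forall e : edge H, (bound e false + (2 * d)%:E <= bound e true)%E.
Variable c0 : edge H * bool.
Hypothesis c0w : inc c0.1 c0.2 = Some w.

Lemma end_bound (a : edge H * bool) v : inc a.1 a.2 = Some v -> bound a.1 a.2 = (end_coord a)%:E.
Proof.
case: a => e b /= eb; rewrite /end_coord fineK//.
by rewrite -[_ \is a _]negbK -inc_bound eb.
Qed.

Lemma sep_ends (e : edge H) v v' : inc e false = Some v -> inc e true = Some v' ->
  end_coord (e, false) + 2 * d <= end_coord (e, true).
Proof.
move=> h1 h2; have := sep e.
by rewrite (@end_bound (e, false) v)// (@end_bound (e, true) v')// -EFinD lee_fin.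
Qed.

Definition inward (a : edge H * bool) (t : R) : R :=
  if a.2 then end_coord a - t else end_coord a + t.

Lemma inward_dom a v t : inc a.1 a.2 = Some v -> 0 <= t -> t <= 2 * d -> edge_dom a.1 (inward a t).
Proof.
have d0 := d_gt0; move=> av t0 td; have := sep a.1; have := end_bound av.
case: a av => e [] /= av hb; rewrite /edge_dom /inward /= hb => hs; split.
- move: hs; case: (bound e false) => [x| |] //=; rewrite ?leNye// -?EFinD ?lee_fin; lra.
- by rewrite lee_fin; lra.
- by rewrite lee_fin; lra.
- by apply: le_trans hs; rewrite -EFinD lee_fin; lra.
Qed.

Definition hat (e : edge H) (b : bool) (x : R) : R :=
  if inc e b == Some w then `|x - end_coord (e, b)| else d.
(** The distance to w, cut off at d: this is single-valued at the other
    vertices, which are all further away than d. *)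
Definition dist_w (e : edge H) (x : R) : R := Num.min d (Num.min (hat e false x) (hat e true x)).

Lemma min_lip (a b a' b' t : R) : `|a - a'| <= t -> `|b - b'| <= t ->
  `|Num.min a b - Num.min a' b'| <= t.
Proof.
rewrite !ler_norml => /andP[h1 h2] /andP[h3 h4].
rewrite /Num.min; case: ltP => h5; case: ltP => h6; apply/andP; split; lra.
Qed.

Lemma max_lip (a b a' b' t : R) : `|a - a'| <= t -> `|b - b'| <= t ->
  `|Num.max a b - Num.max a' b'| <= t.
Proof.
rewrite !ler_norml => /andP[h1 h2] /andP[h3 h4].
rewrite /Num.max; case: ltP => h5; case: ltP => h6; apply/andP; split; lra.
Qed.

Lemma hat_lip e b x y : `|hat e b x - hat e b y| <= `|x - y|.
Proof.
rewrite /hat; case: ifP => _; last by rewrite subrr normr0.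
by apply: le_trans (ler_dist_dist _ _) _; rewrite opprB addrA subrK.
Qed.

Lemma hat_ge0 e b x : 0 <= hat e b x.
Proof. by rewrite /hat; case: ifP => // _; exact: ltW. Qed.

Lemma dist_w_end (a : edge H * bool) v : inc a.1 a.2 = Some v ->
  dist_w a.1 (end_coord a) = if v == w then 0 else d.
Proof.
have d0 := d_gt0; move=> av; case: eqP => [vw|vw].
  have h0 : hat a.1 a.2 (end_coord a) = 0.
    by rewrite /hat av vw eqxx -surjective_pairing subrr normr0.
  have hge b := hat_ge0 a.1 b (end_coord a).
  rewrite /dist_w; apply/eqP; rewrite eq_le; apply/andP; split.
    by case: a h0 {av hge} => e [] /= h0; rewrite !ge_min h0 lexx ?orbT.
  by rewrite !le_min (ltW d_gt0) !hge.
have h1 : hat a.1 a.2 (end_coord a) = d.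
  by rewrite /hat av; case: eqP => // -[].
have h2 : d <= hat a.1 (~~ a.2) (end_coord a).
  rewrite /hat; case: eqP => // h; case: a av h {h1} => e [] /= av h.
    have := sep_ends h av => hs; rewrite ger0_norm; lra.
  have := sep_ends av h => hs; rewrite ler0_norm; lra.
rewrite /dist_w; apply/eqP; rewrite eq_le ge_min lexx /= !le_min lexx /=.
by case: a h1 h2 {av} => e [] /= -> ->; rewrite lexx.
Qed.

Lemma dist_w_lipschitz : lipschitz_graph dist_w.
Proof.
split=> [e x y _ _|a b v av bv].
  apply: min_lip; first by rewrite subrr normr0.
  by apply: min_lip; exact: hat_lip.
by rewrite (dist_w_end av) (dist_w_end bv).
Qed.

Let r := d / 2.
Let y0 := psi c0.1 (end_coord c0).

(** The walk along the edge bounds the distance to w by r, and [dist_w] bounds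
    it from below. *)
Lemma inward_psi a : inc a.1 a.2 = Some w -> `|psi a.1 (inward a r) - y0| = r.
Proof.
move=> aw; have d0 := d_gt0; have r0 : 0 < r by rewrite divr_gt0.
have dom : edge_dom a.1 (inward a r) by apply: (inward_dom aw); rewrite /r; lra.
have dist : `|inward a r - end_coord a| = r.
  rewrite /inward; case: a.2; first by rewrite addrAC subrr add0r normrN gtr0_norm.
  by rewrite addrAC subrr add0r gtr0_norm.
rewrite /y0 (psi_vertex c0w aw); apply/eqP; rewrite eq_le; apply/andP; split.
  by rewrite -[leRHS]dist; apply: psi_upper => //; exact: end_dom aw.
have := psi_lower dist_w_lipschitz dom (end_dom aw).
rewrite (dist_w_end aw) eqxx subr0; apply: le_trans; apply: le_trans (ler_norm _).
have h1 : r <= hat a.1 a.2 (inward a r) by rewrite /hat aw eqxx -surjective_pairing dist.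
have h2 : r <= hat a.1 (~~ a.2) (inward a r).
  rewrite /hat; case: eqP => [h|_]; last by rewrite /r; lra.
  case: a aw h {dom dist h1} => e [] /= aw h; rewrite /inward /=.
    by have := sep_ends h aw; rewrite /r => hs; rewrite ger0_norm; lra.
  by have := sep_ends aw h; rewrite /r => hs; rewrite ler0_norm; lra.
rewrite /dist_w !le_min; apply/andP; split; first by rewrite /r; lra.
by case: a h1 h2 {aw dom dist} => e [] /= -> ->.
Qed.

(** The bump of radius r around the point on the end a is Lipschitz and
    vanishes at all vertices and at the point on any other end b, so these two
    points are at positive distance. *)
Lemma inward_inj a b : inc a.1 a.2 = Some w -> inc b.1 b.2 = Some w ->
  psi a.1 (inward a r) = psi b.1 (inward b r) -> a = b.
Proof.
move=> aw bw eqp; have d0 := d_gt0; have r0 : 0 < r by rewrite divr_gt0.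
apply/eqP/negPn/negP => ab.
pose g (e : edge H) (x : R) := if e == a.1 then Num.max 0 (r - `|x - inward a r|) else 0.
have da : edge_dom a.1 (inward a r) by apply: (inward_dom aw); rewrite /r; lra.
have db : edge_dom b.1 (inward b r) by apply: (inward_dom bw); rewrite /r; lra.
have far x : r <= `|x - inward a r| -> Num.max 0 (r - `|x - inward a r|) = 0.
  by move=> h; apply/max_idPl; rewrite subr_le0.
have gend (c : edge H * bool) v : inc c.1 c.2 = Some v -> g c.1 (end_coord c) = 0.
  move=> cv; rewrite /g; case: eqP => // ca; apply: far.
  case: c cv ca => e k /= cv ea; case: a aw {eqp ab g da} ea => e' k' /= aw ea; subst e'.
  rewrite /inward /=; case: (eqVneq k k') => [kk|kk].
    subst k'; case: (k); [rewrite opprB addrCA subrr addr0|rewrite opprD addrA subrr sub0r normrN];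
    by rewrite gtr0_norm.
  case: k k' cv aw kk => [] [] //= cv aw _.
    by have := sep_ends aw cv; rewrite /r => hs; rewrite ger0_norm; lra.
  by have := sep_ends cv aw; rewrite /r => hs; rewrite ler0_norm; lra.
have lip : lipschitz_graph g.
  split=> [e x y _ _|c c' v cv cv']; last by rewrite (gend _ _ cv) (gend _ _ cv').
  rewrite /g; case: eqP => _; last by rewrite subrr normr0.
  apply: max_lip; first by rewrite subrr normr0.
  rewrite opprB addrC addrA subrK distrC.
  by apply: le_trans (ler_dist_dist _ _) _; rewrite opprB addrA subrK.
have := psi_lower lip da db; rewrite eqp subrr normr0 normr_le0.
rewrite {1}/g eqxx subrr normr0 subr0 (_ : Num.max 0 r = r); last by apply/max_idPr; exact: ltW.
have -> : g b.1 (inward b r) = 0.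
  rewrite /g; case: eqP => // ea; apply: far.
  case: b bw ea {eqp db} ab => e k /= bw ea ab;
      case: a aw {g gend lip da} ea ab => e' k' /= aw ea ab; subst e'.
  have kk : k != k' by apply: contraNneq ab => ->.
  rewrite /inward /=; case: k k' bw aw kk {ab} => [] [] //= bw aw _.
    by have := sep_ends aw bw; rewrite /r => hs; rewrite ger0_norm; lra.
  by have := sep_ends bw aw; rewrite /r => hs; rewrite ler0_norm; lra.
by rewrite subr0 => /eqP; apply/eqP; rewrite gt_eqF.
Qed.

(** A point at distance r < d from w is within r of an end of its edge that
    sits at w, and it is exactly at distance r of it since walks bound the
    distance from above. *)
Lemma inward_surj y : `|y - y0| = r -> exists2 a, inc a.1 a.2 = Some w & psi a.1 (inward a r) = y.
Proof.
move=> yr; have [e [x [ex xy]]] := psi_surj y.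
have d0 := d_gt0; have r0 : 0 < r by rewrite divr_gt0.
have := psi_lower dist_w_lipschitz ex (end_dom c0w).
rewrite (dist_w_end c0w) eqxx subr0 xy -/y0 yr => h.
have [b bw xr] : exists2 b, inc e b = Some w & `|x - end_coord (e, b)| <= r.
  have := le_trans (ler_norm _) h.
  rewrite /dist_w !ge_min => /orP[|/orP[]].
  - by rewrite /r => ?; lra.
  - rewrite /hat; case: eqP => [hf hr|_]; first by exists false.
    by rewrite /r => ?; lra.
  - rewrite /hat; case: eqP => [hf hr|_]; first by exists true.
    by rewrite /r => ?; lra.
exists (e, b) => //=; rewrite -xy; congr (psi e _).
have up := psi_upper ex (@end_dom (e, b) w bw).
have xr' : `|x - end_coord (e, b)| = r.
  apply/eqP; rewrite eq_le xr /=; move: up.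
  by rewrite xy -(@psi_vertex c0 (e, b) w c0w bw) -/y0 yr.
have bb := @end_bound (e, b) w bw.
move: ex => [ex1 ex2]; rewrite /inward /=.
case: b bw xr xr' bb up => bw xr xr' /= bb up; rewrite ?bb ?lee_fin in ex1 ex2.
  by move: xr'; rewrite ler0_norm; lra.
by move: xr'; rewrite ger0_norm; lra.
Qed.

(** The points at distance r from the vertex are in bijection with its ends on
    one side, and with the two points y0 - r and y0 + r on the other. *)
Lemma degree_vertex : degree w = 2.
Proof.
have d0 := d_gt0; have r0 : 0 < r by rewrite divr_gt0.
pose side (a : edge H * bool) := psi a.1 (inward a r) == y0 + r.
have inj : {in ends_at w &, injective side}.
  move=> a b; rewrite !inE => /eqP aw /eqP bw; rewrite /side => sab.
  apply: inward_inj => //; move: sab; have := inward_psi aw; have := inward_psi bw.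
  move: (psi a.1 _) (psi b.1 _) => p q.
  have dich t : `|t - y0| = r -> t = y0 + r \/ t = y0 - r.
    move=> ht; have [h|h] := leP 0 (t - y0).
      by left; move: ht; rewrite ger0_norm//; lra.
    by right; move: ht; rewrite ltr0_norm//; lra.
  move=> /dich hq /dich hp; case: eqP => [->|np]; first by move/esym/eqP.
  move/esym/eqP => nq; by case: hp => // ->; case: hq => // ->.
have surj : (side @: ends_at w = [set: bool])%SET.
  apply/setP => k; rewrite inE; apply/imsetP; case: k.
    have [|a aw pa] := @inward_surj (y0 + r).
      by rewrite addrAC subrr add0r gtr0_norm.
    by exists a; rewrite ?inE ?aw//= /side pa eqxx.
  have [|a aw pa] := @inward_surj (y0 - r).
    by rewrite addrAC subrr add0r normrN gtr0_norm.
  exists a; rewrite ?inE ?aw//= /side pa; apply/esym/negbTE/eqP => h.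
  by move: r0; rewrite (_ : r = 0) ?ltxx//; lra.
rewrite /degree -(card_in_imset inj) surj cardsT card_bool.
by [].
Qed.

End AtVertex.
End WalkDistance.

(** * Essential reductions isometric to the line *)

Lemma uniq_flatten_inj (T S : eqType) (F : T -> seq S) (l : seq T) h h' x :
  uniq (flatten [seq F k | k <- l]) -> h \in l -> h' \in l ->
  x \in F h -> x \in F h' -> h = h'.
Proof.
elim: l => [|k l IH] //=; rewrite cat_uniq => /and3P[_ /hasPn dis ul].
have out h1 : h1 \in l -> x \in F h1 -> x \in F k -> False.
  move=> hl xh xk; suff /dis : x \in flatten [seq F k | k <- l] by rewrite /= xk.
  by apply/flatten_mapP; exists h1.
rewrite !inE => /orP[/eqP ->|hl] /orP[/eqP ->|hl'] xh xh' //.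
- by case: (out _ hl' xh' xh).
- by case: (out _ hl xh xh').
- exact: IH.
Qed.

Lemma uniq_flatten_block (T S : eqType) (F : T -> seq S) (l : seq T) h :
  uniq (flatten [seq F k | k <- l]) -> h \in l -> uniq (F h).
Proof.
elim: l => [|k l IH] //=; rewrite cat_uniq inE => /and3P[uk _ ul] /orP[/eqP -> //|].
exact: IH.
Qed.

Section Reduction.
Variables (R : realType) (G H : metric_graph R).
Variables (iota : vertex H -> vertex G) (first : edge H -> edge G * bool)
  (chain : edge H -> seq (edge G * bool)).
Hypothesis iota_inj : injective iota.
Hypothesis iota_im : forall v : vertex G, degree v != 2 <-> exists w, iota w = v.
Hypothesis cover : perm_eq (flatten [seq [seq a.1 | a <- first h :: chain h]
  | h <- enum (edge H)]) (enum (edge G)).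
Hypothesis paths : forall h, path (@through_transmissive R G) (first h) (chain h).
Hypothesis inc_first : forall h, omap iota (inc h false) = inc (first h).1 (first h).2.
Hypothesis inc_last : forall h, omap iota (inc h true) =
  inc (last (first h) (chain h)).1 (~~ (last (first h) (chain h)).2).

Local Notation fst_chain h := [seq a.1 | a <- first h :: chain h].

(** An end of an edge of H sits where the chain of that edge starts or
    finishes. *)
Definition reduced_end (a : edge H * bool) : edge G * bool :=
  if a.2 then opp_end (last (first a.1) (chain a.1)) else first a.1.

Lemma inc_reduced_end a : inc (reduced_end a).1 (reduced_end a).2 = omap iota (inc a.1 a.2).
Proof. by case: a => h [] /=; rewrite /reduced_end ?inc_first ?inc_last. Qed.

Lemma flatten_uniq : uniq (flatten [seq fst_chain h | h <- enum (edge H)]).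
Proof. by rewrite (perm_uniq cover) enum_uniq. Qed.

Lemma reduced_end_mem a : (reduced_end a).1 \in fst_chain a.1.
Proof.
case: a => h [] /=; rewrite /reduced_end /=; last by rewrite inE eqxx.
by rewrite -(map_cons (fun a => a.1)) map_f// mem_last.
Qed.

Lemma chain_step h k : (k.+1 < size (first h :: chain h))%N -> exists2 v, degree v = 2 &
  inc (nth (first h) (first h :: chain h) k).1 (~~ (nth (first h) (first h :: chain h) k).2) =
      Some v /\
  inc (nth (first h) (first h :: chain h) k.+1).1 (nth (first h) (first h :: chain h) k.+1).2 =
      Some v.
Proof.
move=> ks; have /(pathP (first h)) := paths h => /(_ k); rewrite ltnS in ks.
move=> /(_ ks); rewrite /through_transmissive /opp_end /=.
by case: (inc _ _) => // v /andP[/eqP dv /eqP h1]; exists v.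
Qed.

Lemma iota_degree w : degree (iota w) != 2.
Proof. by apply/iota_im; exists w. Qed.

(** An end at a vertex that is not suppressed is an extremity of the chain
    through its edge, because inner ends of a chain are at vertices of degree
    two. *)
Lemma reduced_end_surj w (a : edge G * bool) : inc a.1 a.2 = Some (iota w) ->
  exists2 c, inc c.1 c.2 = Some w & reduced_end c = a.
Proof.
move=> aw; have : a.1 \in flatten [seq fst_chain h | h <- enum (edge H)].
  by rewrite (perm_mem cover) mem_enum.
case/flatten_mapP => h _ /mapP[b bs ab].
have lift c : reduced_end c = a -> exists2 c, inc c.1 c.2 = Some w & reduced_end c = a.
  move=> ca; exists c => //; have := inc_reduced_end c; rewrite ca aw.
  by case: (inc c.1 c.2) => //= w' [/iota_inj ->].
set s := first h :: chain h in bs.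
have is_ : (index b s < size s)%N by rewrite index_mem.
have nb : nth (first h) s (index b s) = b by rewrite nth_index.
have [a2|a2] := eqVneq a.2 b.2.
  have eab : a = b by rewrite [a]surjective_pairing [b]surjective_pairing ab a2.
  case ib : (index b s) is_ nb => [|k] ks nb.
    by apply: (lift (h, false)); rewrite /reduced_end /= eab -nb.
  have [v dv [_ vi]] := chain_step ks; rewrite -/s nb -eab aw in vi.
  by case: vi dv => <- dv; have := iota_degree w; rewrite dv eqxx.
have eab : a = opp_end b.
  rewrite [a]surjective_pairing /opp_end ab; congr (_, _).
  by move: a2; case: a.2; case: b.2.
have [ks|ks] := ltnP (index b s).+1 (size s).
  have [v dv [vi _]] := chain_step ks; rewrite -/s nb in vi.
  move: aw; rewrite eab /= vi => -[vw]; move: dv; rewrite vw => dv.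
  by have := iota_degree w; rewrite dv eqxx.
apply: (lift (h, true)); rewrite /reduced_end /= eab; congr opp_end.
rewrite (last_nth (first h)) -/s -nb; congr nth.
by apply/eqP; rewrite eqn_leq -ltnS (leq_trans ks)//= -ltnS.
Qed.

(** Each edge of G occurs in one chain, and once only. *)
Lemma reduced_end_inj : injective reduced_end.
Proof.
move=> [h b] [h' b'] eqr.
have eh : h = h'.
  apply: (uniq_flatten_inj flatten_uniq _ _ (reduced_end_mem (h, b))); rewrite ?mem_enum//.
  by rewrite eqr; exact: reduced_end_mem.
subst h'; congr (_, _).
have un : uniq (fst_chain h) by apply: (uniq_flatten_block flatten_uniq); rewrite mem_enum.
have bad : opp_end (last (first h) (chain h)) <> first h.
  move=> eq; have : (last (first h) (chain h)).1 = (first h).1 by exact: (congr1 fst eq).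
  move: un eq; case/lastP: (chain h) => [|l z] /=.
    by move=> _ /(congr1 snd); rewrite /opp_end /=; case: (first h).2.
  rewrite last_rcons map_rcons mem_rcons inE negb_or => /andP[/andP[ne _] _] _ e1.
  by rewrite e1 eqxx in ne.
move: eqr; rewrite /reduced_end /=; case: b; case: b' => //.
by move/esym.
Qed.

(** Both sets of ends are in bijection by [reduced_end]. *)
Lemma reduced_degree w : degree w = degree (iota w).
Proof.
rewrite /degree -(card_in_imset (f := reduced_end)); last by move=> x y _ _; exact: reduced_end_inj.
apply: eq_card => a; rewrite [in RHS]inE; apply/imsetP/eqP => [[c cw ->]|aw].
  by rewrite inc_reduced_end; move: cw; rewrite inE => /eqP ->.
by have [c cw <-] := reduced_end_surj aw; exists c; rewrite ?inE ?cw.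
Qed.

(** A vertex of H would come from a vertex of degree different from two; that
    it has an end at all follows from the connectedness of G. *)
Lemma reduced_no_vertex : generalized_star G -> isometric_to_R H -> vertex H -> False.
Proof.
case=> conn _ [e0 be0] _ _ [psi [psi_iso psi_surj]] w.
have [a aw] : exists a : edge G * bool, inc a.1 a.2 = Some (iota w).
  move: be0; rewrite /bounded_edge; case e0v : (inc e0 false) => [v0|//] _.
  have /connectP[p] := conn (iota w) v0; case: p => [_ /= v0w|x p /= /andP[+ _] _].
    by exists (e0, false); rewrite /= e0v v0w.
  by case/existsP=> e /existsP[b /andP[/eqP eb _]]; exists (e, b).
have [c cw _] := reduced_end_surj aw.
have [d d0 sep] := edge_separation H.
have := degree_vertex psi_iso psi_surj d0 sep cw; rewrite reduced_degree => dw.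
by have := iota_degree w; rewrite dw eqxx.
Qed.

End Reduction.

Lemma walk_no_vertex (R : realType) (H : metric_graph R) (p q : edge H * R) l :
  (vertex H -> False) -> walk p q l -> p.1 = q.1.
Proof. by move=> nov; elim=> {p q l} // a b v q l _ _ _ _; case: (nov v). Qed.

(** Without vertices no walk leaves its edge, and distances on H are finite.
    *)
Lemma isometric_unique_edge (R : realType) (H : metric_graph R) :
  (vertex H -> False) -> isometric_to_R H -> exists h : edge H, forall h', h' = h.
Proof.
move=> nov [psi [psi_iso psi_surj]].
have incN (e : edge H) b : inc e b = None by case: (inc e b) => // v; case: (nov v).
have dom0 (e : edge H) : edge_dom e 0.
  by rewrite /edge_dom /= lower_infty// upper_infty// leNye leey.
have [h _] := psi_surj 0; exists h => h'.
have : (graph_dist (h', 0%R) (h, 0%R) < +oo)%E by rewrite psi_iso// ltry.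
have [[l wl] _|nw] := pselect (exists l, walk (h', 0) (h, 0) l).
  exact: (walk_no_vertex nov wl).
rewrite /graph_dist (_ : [set _ | _ in _] = set0) ?ereal_inf0//.
by apply/seteqP; split=> // t [l wl]; case: nw; exists l.
Qed.

Theorem theorem1p2 (R : realType) (m c : R) (f : R -> R)
    (hm : 0 < m) (hc : 0 < c)
    (hf : C1_nonneg f) (hF1 : F1 f) (hF2 : F2 f) (hF3 : F3 f) (hF4 : F4 f)
    (G H : metric_graph R)
    (hG : generalized_star G)
    (hGH : essential_reduction G H) (hH : isometric_to_R H) :
  forall lam : R, - (m * c ^+ 2) < lam -> lam < m * c ^+ 2 ->
    ground_level m c f G lam = ground_level m c f (line R) lam.
Proof.
move=> lam _ _; case: hGH => iota [first [chain [iota_inj iota_im cover paths ends]]].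
have inc_first h : omap iota (inc h false) = inc (first h).1 (first h).2 by case: (ends h).
have inc_last h : omap iota (inc h true) =
    inc (last (first h) (chain h)).1 (~~ (last (first h) (chain h)).2) by case: (ends h).
have nov := reduced_no_vertex iota_inj iota_im cover paths inc_first inc_last hG hH.
have [h hu] := isometric_unique_edge nov hH.
have incN b : inc h b = None by case: (inc h b) => // v; case: (nov v).
have deg2 (v : vertex G) : degree v = 2.
  apply/eqP; apply: contraT => dv.
  by have [w _] := (iota_im v).1 dv; case: (nov w).
have enumH : enum (edge H) = [:: h].
  apply: perm_small_eq => //; apply: uniq_perm => //; first exact: enum_uniq.
  by move=> h'; rewrite mem_enum (hu h') mem_seq1 eqxx.
rewrite enumH /= cats0 in cover.
have first0 : inc (first h).1 (first h).2 = None by rewrite -inc_first incN.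
have last0 := esym (inc_last h); rewrite incN /= in last0.
exact: (layout_ground_level (chain_layout cover (paths h) first0 last0 deg2) m c lam hF1 hF4).
Qed.
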